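(* For $\theta>0$ define signed measures on partitions $P_{sp}(\lambda)=Z_{sp}(\theta)^{-1}sp_\lambda(pl_{2\theta})s_\lambda(pl_\theta)$ and $P_o(\lambda)=Z_o(\theta)^{-1}o_\lambda(pl_{2\theta})s_\lambda(pl_\theta)$, where $Z_{sp}(\theta)=\sum_\lambda sp_\lambda(pl_{2\theta})s_\lambda(pl_\theta)$ and $Z_o(\theta)=\sum_\lambda o_\lambda(pl_{2\theta})s_\lambda(pl_\theta)$. Then for every $s\in\mathbb R$, $$\lim_{\theta\to\infty}P_{sp}\Big(\frac{\lambda_1-2\theta}{\theta^{1/3}}\le s\Big)=\det(1-\mathcal A^{+}),\qquad \lim_{\theta\to\infty}P_{o}\Big(\frac{\lambda_1-2\theta}{\theta^{1/3}}\le s\Big)=\det(1-\mathcal A^{-}),$$ where the Fredholm determinants are on $L^2(s,\infty)$ and $$\mathcal A^{\pm}(x,y)=\int_0^\infty \mathrm{Ai}(x+u)\mathrm{Ai}(y+u)\,du\pm\int_0^\infty\mathrm{Ai}(x-u)\mathrm{Ai}(y+u)\,du,$$ with $\mathrm{Ai}$ the Airy function.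
   Context: A specialization $\rho$ is a sequence $(p_n(\rho))_{n\ge1}$ of complex numbers; $H(\rho;z)=\exp\big(\sum_{n\ge1}p_n(\rho)z^n/n\big)=\sum_{k\ge0}h_k(\rho)z^k$ defines $h_k(\rho)$ ($h_k=0$ for $k<0$). The Plancherel specialization $pl_\theta$ has $p_1=\theta$ and $p_n=0$ for $n\ge2$ (so $h_k(pl_\theta)=\theta^k/k!$). For a partition $\lambda$ of length $\ell(\lambda)$, with determinants of size $\ell(\lambda)$ (equal to $1$ for the empty partition): $s_\lambda(\rho)=\det[h_{\lambda_i-i+j}(\rho)]$, $sp_\lambda(\rho)=\tfrac12\det[h_{\lambda_i-i+j}(\rho)+h_{\lambda_i-i-j+2}(\rho)]$, $o_\lambda(\rho)=\det[h_{\lambda_i-i+j}(\rho)-h_{\lambda_i-i-j}(\rho)]$. $\lambda_1$ is the largest part of $\lambda$; $P(E)=\sum_{\lambda\in E}P(\lambda)$. *)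

(* Defs.v *)
From HB Require Import structures.
From mathcomp Require Import all_boot all_order all_algebra.
From mathcomp Require Import all_classical all_reals all_analysis.
Set Implicit Arguments. Unset Strict Implicit. Unset Printing Implicit Defensive.
Import Order.TTheory GRing.Theory Num.Theory.
Import numFieldNormedType.Exports.
Local Open Scope classical_set_scope.
Local Open Scope ring_scope.

(* A partition is a weakly decreasing finite sequence of positive naturals;
   lam`_i (0-indexed) is lambda_{i+1}. *)
Definition is_partition (lam : seq nat) : bool :=
  sorted geq lam && all (fun x => 0 < x)%N lam.

Definition part1 (lam : seq nat) : nat := head 0%N lam.

(* Sum of F over all partitions of n (|lam| = n).  Every partition of n has
   length k <= n and parts <= n, so it is enumerated exactly once. *)
Definition sum_partitions_of (R : realType) (n : nat) (F : seq nat -> R) : R :=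
  \sum_(k < n.+1) \sum_(t : k.-tuple 'I_n.+1 |
        is_partition (map val t) && (sumn (map val t) == n)) F (map val t).

Definition sum_partitions (R : realType) (F : seq nat -> R) : R :=
  limn (fun N => \sum_(n < N) sum_partitions_of n F).

Definition h_pl (R : realType) (theta : R) (k : int) : R :=
  match k with
  | Posz n => theta ^+ n / (n`!)%:R
  | Negz _ => 0
  end.

Definition lidx (lam : seq nat) (i : nat) (c : int) : int :=
  (nth 0%N lam i)%:Z - i%:Z + c.

(* Schur: det[h_{lambda_i - i + j}]  (1-indexed i,j) *)
Definition schur (R : realType) (h : int -> R) (lam : seq nat) : R :=
  \det (\matrix_(i < size lam, j < size lam)
          h (lidx lam i j%:Z)).

(* symplectic: (1/2) det[h_{lambda_i-i+j} + h_{lambda_i-i-j+2}]  (=1 for lam = []) *)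
Definition sympl (R : realType) (h : int -> R) (lam : seq nat) : R :=
  if lam is [::] then 1 else
  2^-1 * \det (\matrix_(i < size lam, j < size lam)
          (h (lidx lam i j%:Z) + h (lidx lam i (- j%:Z)))).

(* orthogonal: det[h_{lambda_i-i+j} - h_{lambda_i-i-j}] *)
Definition orthog (R : realType) (h : int -> R) (lam : seq nat) : R :=
  \det (\matrix_(i < size lam, j < size lam)
          (h (lidx lam i j%:Z) - h (lidx lam i (- j%:Z - 2)))).

Definition w_sp (R : realType) (theta : R) (lam : seq nat) : R :=
  sympl (h_pl (2 * theta)) lam * schur (h_pl theta) lam.
Definition w_o (R : realType) (theta : R) (lam : seq nat) : R :=
  orthog (h_pl (2 * theta)) lam * schur (h_pl theta) lam.

Definition Z_sp (R : realType) (theta : R) : R :=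
  sum_partitions (fun lam => if is_partition lam then w_sp theta lam else 0).
Definition Z_o (R : realType) (theta : R) : R :=
  sum_partitions (fun lam => if is_partition lam then w_o theta lam else 0).

Definition P_sp (R : realType) (theta : R) (E : seq nat -> bool) : R :=
  sum_partitions (fun lam => if E lam then w_sp theta lam else 0) / Z_sp theta.
Definition P_o (R : realType) (theta : R) (E : seq nat -> bool) : R :=
  sum_partitions (fun lam => if E lam then w_o theta lam else 0) / Z_o theta.

Definition edge_event (R : realType) (theta s : R) (lam : seq nat) : bool :=
  ((part1 lam)%:R - 2 * theta) / (theta `^ (3^-1)) <= s.

Definition Airy (R : realType) (x : R) : R :=
  pi^-1 * lim ((fun T : R => \int[lebesgue_measure]_(t in `[0, T])
                      cos (t ^+ 3 / 3 + x * t)) @ +oo).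

Definition Akernel (R : realType) (sgn : R) (x y : R) : R :=
  \int[lebesgue_measure]_(u in `[0, +oo[) (Airy (x + u) * Airy (y + u))
  + sgn * \int[lebesgue_measure]_(u in `[0, +oo[) (Airy (x - u) * Airy (y + u)).

Fixpoint iter_int (R : realType) (s : R) (n : nat) (F : seq R -> R) : R :=
  match n with
  | 0%N => F [::]
  | n'.+1 => \int[lebesgue_measure]_(x in `]s, +oo[)
               iter_int s n' (fun l => F (x :: l))
  end.

Definition fredholm_det (R : realType) (K : R -> R -> R) (s : R) : R :=
  limn (fun N => \sum_(n < N)
     ((-1) ^+ n / (n`!)%:R *
      iter_int s n (fun l => \det (\matrix_(i < n, j < n)
                                     K (nth 0 l i) (nth 0 l j))))).

(* Main.v *)
(** Both cases differ by a sign only.  Cauchy-Binet and Jacobi's complementary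
    minor formula turn the total weight of the partitions with lambda_1 <= L into
    the leading L x L minor of an infinite matrix X, and the inverse of X is 1 - K
    with K built from products of the Bessel functions J_n(2 theta).  As in the
    Borodin-Okounkov formula, complementary minors of X and 1 - K are proportional,
    so P(lambda_1 <= L) is the Fredholm determinant of 1 - K on indices >= L.

    Write theta = A^3.  Then A J_n(2 theta) is the integral of cos over
    [0, pi A] of a phase with nonnegative second derivative, which tends to Ai when
    (n - 2 theta) / A converges (van der Corput bounds the tail), while moving
    the circle of integration to |z| = e^{k/A} gives a bound C_k e^{-k (n - 2 theta) / A}
    uniform in n and A.  Von Koch's expansion of the discrete determinant is a sum
    of iterated integrals of step functions; dominated convergence handles each
    integral, and Hadamard's inequality dominates the series. *)
Require Import Defs.
From HB Require Import structures.
From mathcomp Require Import all_boot all_order all_algebra all_fingroup.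
From mathcomp Require Import all_classical all_reals all_analysis.
From mathcomp Require Import measurable_realfun ring lra zify.
Set Implicit Arguments. Unset Strict Implicit. Unset Printing Implicit Defensive.
Import Order.TTheory GRing.Theory Num.Theory.
Import numFieldNormedType.Exports.
Local Open Scope classical_set_scope.
Local Open Scope ring_scope.

(** * Determinant identities *)

(** The weights are signed, so neither the convergence of the defining sums nor Z <> 0 is evident.
    For the sums, h_k is replaced by h_k w^k in the Schur factor: the determinants become
    polynomials in w whose coefficients are the sums over partitions of one size, and their l^1 norm
    at radius 2 is bounded uniformly in the box, which gives geometric tails. The value of Z is
    never computed: leading minors of X times bounded leading minors of 1 - K tend to 1, so the
    former cannot tend to 0.

    The inverse of X is found from the exponents of e^{s z + t / z}, which add under convolution. A
    column of it comes from a reflected Bessel sequence, made to vanish below the cut by a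
    correction of definite parity; e^{-theta (z + 1/z)} is invariant under z -> 1/z, so the fold
    does not see this correction.

    No infinite determinant is formed: identities hold for finite sections with an error O(2^-N). In
    the folded half of K one Bessel index decreases along the sum and its bound grows like e^{m/A};
    the other factor has to win, which is why exponential bounds at more than one rate k are
    needed. *)

Definition increasing n m (f : {ffun 'I_n -> 'I_m}) : bool :=
  [forall i : 'I_n, forall j : 'I_n, (i < j)%N ==> (f i < f j)%N].

Lemma increasingP n m (f : {ffun 'I_n -> 'I_m}) :
  reflect (forall i j : 'I_n, (i < j)%N -> (f i < f j)%N) (increasing f).
Proof.
apply: (iffP forallP) => [H i j ij|H i].
  by move/forallP/(_ j)/implyP: (H i); apply.
by apply/forallP => j; apply/implyP; apply: H.
Qed.

Lemma increasing_inj n m (f : {ffun 'I_n -> 'I_m}) : increasing f -> injective f.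
Proof.
move/increasingP => H i j fij; apply/val_inj/eqP.
by case: ltngtP => // /H; rewrite fij ltnn.
Qed.

Definition fcomp n m (f : {ffun 'I_n -> 'I_m}) (s : 'S_n) : {ffun 'I_n -> 'I_m} :=
  [ffun i => f (s i)].

Lemma increasing_codom n m (f : {ffun 'I_n -> 'I_m}) : increasing f ->
  sorted ltn [seq val (f i) | i <- enum 'I_n].
Proof.
move/increasingP => H; rewrite sorted_map.
have : sorted (relpre val ltn) (enum 'I_n).
  by rewrite -sorted_map val_enum_ord iota_ltn_sorted.
by apply: sub_sorted => i j; apply: H.
Qed.

Lemma increasing_codom_eq n m (f g : {ffun 'I_n -> 'I_m}) :
  increasing f -> increasing g -> codom f =i codom g -> f = g.
Proof.
move=> fI gI fg.
have E : [seq val (f i) | i <- enum 'I_n] = [seq val (g i) | i <- enum 'I_n].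
  apply: (irr_sorted_eq ltn_trans ltnn); rewrite ?increasing_codom// => x.
  apply/mapP/mapP => -[i _ ->].
    have : f i \in codom g by rewrite -fg codom_f.
    by move=> /codomP[j ->]; exists j; rewrite ?mem_enum.
  have : g i \in codom f by rewrite fg codom_f.
  by move=> /codomP[j ->]; exists j; rewrite ?mem_enum.
apply/ffunP => i; apply: val_inj.
by move/eq_in_map/(_ i): E; apply; rewrite mem_enum.
Qed.

Lemma fcomp_codom n m (f : {ffun 'I_n -> 'I_m}) s : codom (fcomp f s) =i codom f.
Proof.
move=> x; apply/codomP/codomP => -[i ->].
  by exists (s i); rewrite ffunE.
by exists (s^-1%g i); rewrite ffunE permKV.
Qed.

Lemma fcomp_increasing_inj n m (f g : {ffun 'I_n -> 'I_m}) (s t : 'S_n) :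
  increasing f -> increasing g -> fcomp f s = fcomp g t -> f = g /\ s = t.
Proof.
move=> fI gI fg.
have fgeq : f = g.
  apply: increasing_codom_eq => // x.
  by rewrite -(fcomp_codom f s) -(fcomp_codom g t) fg.
split=> //; apply/permP => i; apply: (increasing_inj fI).
by move/ffunP/(_ i): fg; rewrite !ffunE fgeq.
Qed.

(** Sorting the values of [f] produces [g], and [s] records the rank of each value. *)
Lemma fcomp_increasing_ex n m (f : {ffun 'I_n -> 'I_m}) : injective f ->
  exists g (s : 'S_n), increasing g /\ f = fcomp g s.
Proof.
move=> fI.
pose le (x y : 'I_m) := (x <= y)%N.
pose t := [tuple f i | i < n].
have sz : size (sort le t) == n by rewrite size_sort size_tuple.
have /tuple_permP [p tE] : perm_eq t (Tuple sz) by rewrite /= perm_sym perm_sort.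
pose g := [ffun i => tnth (Tuple sz) i].
exists g, p; split; last first.
  apply/ffunP => i; rewrite !ffunE -[LHS](tnth_mktuple f).
  have -> : [tuple f i0 | i0 < n] = [tuple tnth (Tuple sz) (p i0) | i0 < n] by apply: val_inj.
  by rewrite tnth_mktuple.
apply/increasingP => i j ij; rewrite !ffunE ltn_neqAle.
have szt : size (sort le t) = n by apply/eqP.
apply/andP; split.
  apply/negP => /eqP/val_inj/eqP; rewrite !(tnth_nth (f i)) /= nth_uniq ?szt//.
    by move/eqP => ij'; move: ij; rewrite ij' ltnn.
  by rewrite sort_uniq map_inj_uniq// enum_uniq.
rewrite !(tnth_nth (f i)) /=.
have so : sorted le (sort le t) by apply: sort_sorted => x y; apply: leq_total.
apply: (sorted_leq_nth _ _ _ so); rewrite ?inE ?szt ?ltn_ord//; first by move=> x y z; apply: leq_trans.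
exact: ltnW.
Qed.

(** An injective map is an increasing one precomposed with a permutation, in exactly one way. Both
    Cauchy-Binet and von Koch's expansion regroup a sum over all maps by this. *)
Lemma sum_injective (V : nmodType) n m (G : {ffun 'I_n -> 'I_m} -> V) :
  (forall f : {ffun 'I_n -> 'I_m}, ~ injective f -> G f = 0) ->
  \sum_f G f = \sum_(f | increasing f) \sum_(s : 'S_n) G (fcomp f s).
Proof.
move=> G0; rewrite pair_big_dep /=.
pose h (u : {ffun 'I_n -> 'I_m} * 'S_n) := fcomp u.1 u.2.
rewrite (bigID (fun f => f \in h @: [pred u | increasing u.1])) /=.
rewrite [X in _ + X]big1 ?addr0; last first.
  move=> f fN; apply: G0 => /fcomp_increasing_ex[g [s [gI fE]]].
  move/negP: fN; apply; apply/imsetP; exists (g, s) => //.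
rewrite big_imset /=; last first.
  move=> [f s] [g t]; rewrite !inE /= => fI gI E.
  by have [/= -> /= ->] := fcomp_increasing_inj fI gI E.
by apply: eq_bigl => -[f s]; rewrite !inE andbT.
Qed.

(** Expanding every row of the product gives a sum over all maps [f]. A repeated value repeats a row
    of [B]; over the rearrangements of one increasing map the signs assemble the minor of [A]. *)
Lemma Cauchy_Binet (R : comNzRingType) n m (A : 'M[R]_(n, m)) (B : 'M[R]_(m, n)) :
  \det (A *m B) = \sum_(f : {ffun 'I_n -> 'I_m} | increasing f)
    \det (\matrix_(i, j) A i (f j)) * \det (\matrix_(i, j) B (f i) j).
Proof.
transitivity (\sum_(f : {ffun 'I_n -> 'I_m})
    (\prod_i A i (f i)) * \det (\matrix_(i, j) B (f i) j)).
  transitivity (\sum_(s : 'S_n) (-1) ^+ s * \sum_(f : {ffun 'I_n -> 'I_m})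
     \prod_i (A i (f i) * B (f i) (s i))).
    apply: eq_bigr => s _; congr (_ * _).
    rewrite -(bigA_distr_bigA (fun i k => A i k * B k (s i))).
    by apply: eq_bigr => i _; rewrite mxE.
  under eq_bigr do rewrite mulr_sumr.
  rewrite exchange_big; apply: eq_bigr => f _.
  rewrite /determinant mulr_sumr; apply: eq_bigr => s _.
  rewrite big_split /= mulrCA; congr (_ * (_ * _)).
  by apply: eq_bigr => i _; rewrite mxE.
rewrite sum_injective => [|f fN]; last first.
  have [/injectiveP /fN//|/injectivePn [i [j ij fij]]] := boolP (injectiveb f).
  rewrite (determinant_alternate ij) ?mulr0// => k.
  by rewrite !mxE fij.
apply: eq_bigr => f _.
rewrite [X in X * _]/determinant mulr_suml; apply: eq_bigr => s _.
have -> : \matrix_(i, j) B (fcomp f s i) j = row_perm s (\matrix_(i, j) B (f i) j).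
  by apply/matrixP => i j; rewrite !mxE ffunE.
rewrite row_permE det_mulmx det_perm mulrCA mulrA; congr (_ * _ * _).
by apply: eq_bigr => i _; rewrite !mxE ffunE.
Qed.

(** Multiplying the first matrix by [block_mx 1%:M Dur 0 Ddr] turns its right block column into that
    of the identity, so the product is block triangular with [Cul] on its diagonal. *)
Lemma det_complementary_minor (R : comNzRingType) n m
  (Cul : 'M[R]_n) (Cur : 'M[R]_(n, m)) Cdl Cdr
  (Dul : 'M[R]_n) (Dur : 'M[R]_(n, m)) Ddl Ddr :
  block_mx Cul Cur Cdl Cdr *m block_mx Dul Dur Ddl Ddr = 1%:M ->
  \det Cul = \det (block_mx Cul Cur Cdl Cdr) * \det Ddr.
Proof.
rewrite mulmx_block scalar_mx_block => /eq_block_mx [_ E2 _ E4].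
have -> : \det Ddr = \det (block_mx 1%:M Dur 0 Ddr) by rewrite det_ublock det1 mul1r.
rewrite -det_mulmx mulmx_block !mulmx0 !addr0 !mulmx1 E2 E4.
by rewrite det_lblock det1 mulr1.
Qed.

Lemma det_reindex (R : comNzRingType) n (s : 'S_n) (A : 'M[R]_n) :
  \det (\matrix_(i, j) A (s i) (s j)) = \det A.
Proof.
have -> : \matrix_(i, j) A (s i) (s j) = row_perm s (col_perm s A).
  by apply/matrixP => i j; rewrite !mxE.
rewrite row_permE col_permE !det_mulmx !det_perm odd_permV.
by case: (odd_perm s); rewrite ?expr0 ?expr1; ring.
Qed.

(** One block matrix, multiplied on the right or on the left by the same unitriangular factor,
    becomes block triangular with one or the other determinant on its diagonal. *)
Lemma Sylvester_det (R : comNzRingType) m n (F : 'M[R]_(m, n)) (G : 'M[R]_(n, m)) :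
  \det (1%:M + F *m G) = \det (1%:M + G *m F).
Proof.
have E1 : block_mx 1%:M (- F) G 1%:M *m block_mx 1%:M F 0 1%:M =
    block_mx 1%:M 0 G (1%:M + G *m F).
  by rewrite mulmx_block !mulmx0 !mul1mx !mulmx1 !addr0 subrr addrC.
have E2 : block_mx 1%:M F 0 1%:M *m block_mx 1%:M (- F) G 1%:M =
    block_mx (1%:M + F *m G) 0 G 1%:M.
  by rewrite mulmx_block !mul0mx !mul1mx !mulmx1 !add0r addNr.
move/(congr1 determinant): E1; move/(congr1 determinant): E2.
rewrite !det_mulmx det_ublock !det1 mulr1 mul1r mulr1 !det_lblock !det1 mulr1 mul1r.
by move=> -> ->.
Qed.

Lemma det_1D_subsets (R : comNzRingType) m (K : 'M[R]_m) :
  \det (1%:M + K) = \sum_(S : {set 'I_m})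
    \det (\matrix_(i, j) if i \in S then K i j else (i == j)%:R).
Proof.
rewrite /determinant exchange_big /=; apply: eq_bigr => s _.
rewrite -mulr_sumr; congr (_ * _).
rewrite (eq_bigr (fun i => K i (s i) + (i == s i)%:R)); last first.
  by move=> i _; rewrite !mxE addrC.
rewrite bigA_distr; apply: eq_bigr => S _.
by apply: eq_bigr => i _; rewrite !mxE.
Qed.

(** With [F] the incidence matrix of [f], the large matrix is [1%:M + F *m (F^T *m (K - 1%:M))];
    exchanging the two factors by [Sylvester_det] leaves the minor of [K] on the range of [f]. *)
Lemma det_subset_inj (R : comNzRingType) n m (K : 'M[R]_m) (f : {ffun 'I_n -> 'I_m}) :
  injective f ->
  \det (\matrix_(i, j) if i \in codom f then K i j else (i == j)%:R) =
  \det (\matrix_(i, j) K (f i) (f j)).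
Proof.
move=> fI.
pose F : 'M[R]_(m, n) := \matrix_(i, j) (i == f j)%:R.
have FTE p (A : 'M[R]_(m, p)) i j : (F^T *m A) i j = A (f i) j.
  rewrite mxE (bigD1 (f i)) //= !mxE eqxx mul1r big1 ?addr0// => k kf.
  by rewrite !mxE (negbTE kf) mul0r.
have FE p (A : 'M[R]_(p, m)) i j : (A *m F) i j = A i (f j).
  rewrite mxE (bigD1 (f j)) //= !mxE eqxx mulr1 big1 ?addr0// => k kf.
  by rewrite !mxE (negbTE kf) mulr0.
have -> : \matrix_(i, j) (if i \in codom f then K i j else (i == j)%:R) =
    1%:M + F *m (F^T *m (K - 1%:M)).
  apply/matrixP => i j; rewrite mxE [in RHS]mxE [(1%:M) i j]mxE [X in _ + X]mxE.
  case: ifPn => [/codomP[k ->]|fi].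
    rewrite (bigD1 k) //= FTE !mxE eqxx mul1r big1 ?addr0; first by rewrite addrC subrK.
    by move=> l lk; rewrite !mxE (inj_eq fI) eq_sym (negbTE lk) mul0r.
  rewrite big1 ?addr0// => k _; rewrite !mxE; case: eqP => [ik|]; last by rewrite mul0r.
  by move: fi; rewrite ik codom_f.
rewrite Sylvester_det; congr determinant; apply/matrixP => i j.
rewrite mxE FE FTE !mxE (inj_eq fI).
by rewrite addrC subrK.
Qed.

(** Principal minors over subsets become a sum over increasing maps. Passing to all maps, the form
    that turns into an n-fold integral later, counts each minor n! times, since a simultaneous
    permutation of rows and columns does not change it. *)
Lemma von_Koch (R : numFieldType) m (K : 'M[R]_m) :
  \det (1%:M + K) = \sum_(n < m.+1) (n`!%:R)^-1 *
    \sum_(f : {ffun 'I_n -> 'I_m}) \det (\matrix_(i, j) K (f i) (f j)).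
Proof.
rewrite det_1D_subsets.
rewrite (partition_big (fun S : {set 'I_m} => inord #|S| : 'I_m.+1) xpredT) //=.
apply: eq_bigr => n _.
rewrite sum_injective => [|f fN]; last first.
  have [/injectiveP /fN//|/injectivePn [i [j ij fij]]] := boolP (injectiveb f).
  by rewrite (determinant_alternate ij)// => k; rewrite !mxE fij.
transitivity (\sum_(f : {ffun 'I_n -> 'I_m} | increasing f)
    \det (\matrix_(i, j) K (f i) (f j))); last first.
  rewrite mulr_sumr; apply: eq_bigr => f _.
  rewrite (eq_bigr (fun _ => \det (\matrix_(i, j) K (f i) (f j)))); last first.
    move=> s _; rewrite -[RHS](det_reindex s); congr determinant.
    by apply/matrixP => i j; rewrite !mxE !ffunE.
  rewrite sumr_const; have -> : #|'S_n| = n`! by rewrite -(card_Sn n).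
  set d := \det _; rewrite -(mulr_natl d) mulrA mulVf ?mul1r//.
pose h (f : {ffun 'I_n -> 'I_m}) : {set 'I_m} := finset (mem (codom f)).
have hE f x : (x \in h f) = (x \in codom f) by rewrite inE.
have hcard (f : {ffun 'I_n -> 'I_m}) : injective f -> #|h f| = n.
  by move=> fI; rewrite cardsE card_codom // card_ord.
rewrite (eq_bigl (fun S => S \in h @: [pred f | increasing f])); last first.
  move=> S; apply/eqP/imsetP => [Sn|[f fI ->]]; last first.
    rewrite hcard ?inord_val//.
    by apply: increasing_inj; rewrite inE in fI.
  have cS : #|S| = n.
    by rewrite -Sn inordK// ltnS -[X in (_ <= X)%N](card_ord m) max_card.
  pose f := [ffun i : 'I_n => enum_val (cast_ord (esym cS) i)].
  have fI : injective f.
    by move=> i j; rewrite !ffunE => /enum_val_inj/cast_ord_inj.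
  have [g [s [gI fE]]] := fcomp_increasing_ex fI.
  exists g; first by rewrite inE.
  apply/setP => x; rewrite hE -(fcomp_codom g s) -fE.
  apply/idP/codomP => [xS|[i ->]]; last by rewrite ffunE enum_valP.
  exists (cast_ord cS (enum_rank_in xS x)).
  by rewrite ffunE cast_ordK enum_rankK_in.
rewrite big_imset /=; last first.
  move=> f g; rewrite !inE => fI gI fg; apply: increasing_codom_eq => // x.
  by rewrite -!hE fg.
apply: eq_bigr => f fI; rewrite inE in fI.
rewrite -(det_subset_inj _ (increasing_inj fI)); congr determinant.
by apply/matrixP => i j; rewrite !mxE hE.
Qed.

Section norm_det.
Variables (A : comNzRingType) (R : realDomainType) (N : A -> R).
Hypothesis N0 : N 0 = 0.
Hypothesis N_ge0 : forall x, 0 <= N x.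
Hypothesis ND : forall x y, N (x + y) <= N x + N y.
Hypothesis NM : forall x y, N (x * y) <= N x * N y.
Hypothesis N1 : N 1 <= 1.
Hypothesis NN : forall x, N (- x) = N x.

Lemma norm_sum_le I (r : seq I) (P : pred I) (F : I -> A) :
  N (\sum_(i <- r | P i) F i) <= \sum_(i <- r | P i) N (F i).
Proof.
elim/big_rec2: _ => [|i y x _ IH]; first by rewrite N0.
by apply: le_trans (ND _ _) _; rewrite lerD2l.
Qed.

Lemma norm_prod_le I (r : seq I) (P : pred I) (F : I -> A) :
  N (\prod_(i <- r | P i) F i) <= \prod_(i <- r | P i) N (F i).
Proof.
elim/big_rec2: _ => [|i y x _ IH]; first exact: N1.
by apply: le_trans (NM _ _) _; apply: ler_wpM2l.
Qed.

(** The right-hand side expands into a sum over all maps, of which the permutations are a part. *)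
Lemma sum_perm_le n (F : 'I_n -> 'I_n -> R) : (forall i j, 0 <= F i j) ->
  \sum_(s : 'S_n) \prod_i F i (s i) <= \prod_i \sum_j F i j.
Proof.
move=> F0; rewrite bigA_distr_bigA /=.
pose h (s : 'S_n) : {ffun 'I_n -> 'I_n} := [ffun i => s i].
rewrite [leRHS](bigID (fun f => f \in h @: [pred _ | true])) /= -[leLHS]addr0.
apply: lerD; last by apply: sumr_ge0 => f _; apply: prodr_ge0.
rewrite big_imset /=; last first.
  by move=> s t _ _ st; apply/permP => i; move/ffunP/(_ i): st; rewrite !ffunE.
rewrite le_eqVlt; apply/orP; left; apply/eqP; apply: eq_big => //= s _.
by apply: eq_bigr => i _; rewrite ffunE.
Qed.

(** The bound serves for real entries and for polynomial entries measured by [poly_norm], hence an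
    abstract subadditive and submultiplicative [N]. *)
Lemma norm_det_le n (M : 'M[A]_n) : N (\det M) <= \prod_i \sum_j N (M i j).
Proof.
apply: le_trans (sum_perm_le (F := fun i j => N (M i j)) _) => //.
apply: le_trans (norm_sum_le _ _ _) _; apply: ler_sum => s _.
by rewrite mulr_sign; case: ifP => _; rewrite ?NN norm_prod_le.
Qed.
End norm_det.

(** In each permutation term the part without [E] cancels. What remains is dominated by nonnegative
    quantities, so the sum over permutations may be enlarged to all maps, where it factors into
    products of row sums. *)
Lemma det_perturbation (R : realDomainType) n (G E : 'M[R]_n) :
  `|\det (G + E) - \det G| <=
    \prod_i \sum_j (`|G i j| + `|E i j|) - \prod_i \sum_j `|G i j|.
Proof.
have PE (s : seq 'I_n) (g e : 'I_n -> R) :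
    `|\prod_(i <- s) (g i + e i) - \prod_(i <- s) g i| <=
    \prod_(i <- s) (`|g i| + `|e i|) - \prod_(i <- s) `|g i|.
  elim: s => [|a s IH]; first by rewrite !big_nil !subrr normr0.
  rewrite !big_cons.
  set p := \prod_(j <- s) (g j + e j) in IH *; set q := \prod_(j <- s) g j in IH *.
  set p' := \prod_(j <- s) (`|g j| + `|e j|) in IH *.
  set q' := \prod_(j <- s) `|g j| in IH *.
  have pp' : `|p| <= p'.
    rewrite /p /p' normr_prod; apply: ler_prod => i _.
    by rewrite normr_ge0 ler_normD.
  have -> : (g a + e a) * p - g a * q = g a * (p - q) + e a * p by ring.
  have -> : (`|g a| + `|e a|) * p' - `|g a| * q' = `|g a| * (p' - q') + `|e a| * p' by ring.
  apply: le_trans (ler_normD _ _) _; rewrite !normrM.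
  by apply: lerD; apply: ler_wpM2l.
have -> : \det (G + E) - \det G = \sum_(s : 'S_n) (-1) ^+ s *
    (\prod_i (G i (s i) + E i (s i)) - \prod_i G i (s i)).
  rewrite /determinant -sumrB; apply: eq_bigr => s _.
  by rewrite mulrBr; congr (_ * _ - _); apply: eq_bigr => i _; rewrite mxE.
apply: le_trans (ler_norm_sum _ _ _) _.
apply: (@le_trans _ _ (\sum_(f : {ffun 'I_n -> 'I_n})
   (\prod_i (`|G i (f i)| + `|E i (f i)|) - \prod_i `|G i (f i)|))); last first.
  by rewrite sumrB -(bigA_distr_bigA (fun i j => `|G i j| + `|E i j|)) -(bigA_distr_bigA (fun i j => `|G i j|)).
pose h (s : 'S_n) : {ffun 'I_n -> 'I_n} := [ffun i => s i].
rewrite [leRHS](bigID (fun f => f \in h @: [pred _ | true])) /= -[leLHS]addr0.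
apply: lerD; last first.
  apply: sumr_ge0 => f _; rewrite subr_ge0; apply: ler_prod => i _.
  by rewrite normr_ge0 lerDl normr_ge0.
rewrite big_imset /=; last first.
  by move=> s t _ _ st; apply/permP => i; move/ffunP/(_ i): st; rewrite !ffunE.
rewrite [leRHS](eq_bigl xpredT) //=; apply: ler_sum => s _.
rewrite normrM normrX normrN1 expr1n mul1r; apply: le_trans (PE _ _ _) _.
by apply: lerB; rewrite le_eqVlt; apply/orP; left; apply/eqP; apply: eq_bigr => i _; rewrite ffunE.
Qed.

(** * Partitions and Jacobi-Trudi determinants *)

(** Induction by one step of Gram-Schmidt: subtracting from the other rows their projections on the
    first row [r] preserves the determinant, splits off the factor |r|^2, and can only decrease the
    remaining diagonal entries. *)
Lemma gram_det_le (R : realFieldType) k m (A : 'M[R]_(k, m)) :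
  0 <= \det (A *m A^T) <= \prod_i (A *m A^T) i i.
Proof.
elim: k A => [|k IH] A; first by rewrite det_mx00 big_ord0 ler01 lexx.
have [r [A' ->]] : exists r (A' : 'M[R]_(k, m)), A = col_mx (r : 'M[R]_(1, m)) A'.
  by exists (usubmx (A : 'M[R]_(1 + k, m))), (dsubmx (A : 'M[R]_(1 + k, m))); rewrite vsubmxK.
have gramE (B : 'M[R]_(k, m)) : col_mx r B *m (col_mx r B)^T =
    block_mx (r *m r^T) (r *m B^T) (B *m r^T) (B *m B^T).
  by rewrite tr_col_mx mul_col_row.
set g := (r *m r^T) 0 0.
have rrE : r *m r^T = g%:M by rewrite [LHS]mx11_scalar.
have gE : g = \sum_j r 0 j ^+ 2.
  by rewrite /g mxE; apply: eq_bigr => j _; rewrite mxE expr2.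
have prodE (B : 'M[R]_(k, m)) : \prod_i (col_mx r B *m (col_mx r B)^T) i i =
    g * \prod_i (B *m B^T) i i.
  rewrite gramE (@big_split_ord _ _ _ 1 k) /= big_ord1; congr (_ * _).
    by rewrite block_mxEul.
  by apply: eq_bigr => i _; rewrite block_mxEdr.
rewrite prodE.
have P0 (B : 'M[R]_(k, m)) i : 0 <= (B *m B^T) i i.
  by rewrite mxE sumr_ge0// => j _; rewrite mxE -expr2 sqr_ge0.
have g0 : 0 <= g by rewrite gE sumr_ge0// => j _; rewrite sqr_ge0.
have [g0E|gN0] := eqVneq g 0.
  have r0 : r = 0.
    apply/rowP => j; rewrite mxE; apply/eqP; rewrite -sqrf_eq0; apply/eqP.
    have := psumr_eq0P (P := predT) (F := fun j => r 0 j ^+ 2) _ _.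
    by apply => // [i _|]; rewrite ?sqr_ge0// -gE.
  have -> : \det (col_mx r A' *m (col_mx r A')^T) = 0.
    by rewrite gramE r0 !mul0mx det_lblock det_mx11 mxE mul0r.
  by rewrite lexx mulr_ge0 // prodr_ge0.
pose v := A' *m r^T.
pose B := A' - v *m (g^-1 *: r).
have BrE : B *m r^T = 0.
  by rewrite mulmxBl -mulmxA -scalemxAl rrE scale_scalar_mx mulVf// mulmx1 subrr.
have detE : \det (col_mx r A' *m (col_mx r A')^T) = g * \det (B *m B^T).
  pose E : 'M[R]_(1 + k) := block_mx 1%:M 0 (- (g^-1 *: v)) 1%:M.
  have EA : E *m col_mx r A' = col_mx r B.
    rewrite mul_block_col !mul1mx mul0mx addr0 mulNmx -scalemxAl addrC /B.
    by rewrite -scalemxAr.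
  have dE : \det E = 1 by rewrite det_lblock !det1 mulr1.
  transitivity (\det (col_mx r B *m (col_mx r B)^T)).
    rewrite -EA trmx_mul mulmxA -(mulmxA E) !det_mulmx det_tr dE; ring.
  rewrite gramE BrE -[r *m B^T]trmxK trmx_mul trmxK BrE trmx0 det_ublock rrE.
  by rewrite det_scalar1.
rewrite detE; have /andP[d0 dle] := IH B.
rewrite mulr_ge0 //=; apply: ler_wpM2l => //.
apply: le_trans dle _; apply: ler_prod => i _; rewrite P0 /=.
have -> : B *m B^T = A' *m A'^T - g^-1 *: (v *m v^T).
  rewrite {2}/B linearB /= trmx_mul mulmxBr !mulmxA.
  rewrite linearZ /= -scalemxAr BrE scaler0 mul0mx subr0 mulmxBl; congr (_ - _).
  by rewrite -scalemxAr -scalemxAl -mulmxA /v trmx_mul trmxK.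
rewrite [leLHS]mxE gerDl mxE oppr_le0 mxE.
rewrite mulr_ge0 ?invr_ge0// mxE sumr_ge0// => j _.
by rewrite [v^T j i]mxE -expr2 sqr_ge0.
Qed.

Lemma Hadamard (R : realFieldType) n (A : 'M[R]_n) :
  (\det A) ^+ 2 <= \prod_i \sum_j A i j ^+ 2.
Proof.
have /andP[_] := gram_det_le A; rewrite det_mulmx det_tr -expr2.
move/le_trans; apply; rewrite le_eqVlt; apply/orP; left; apply/eqP.
by apply: eq_bigr => i _; rewrite mxE; apply: eq_bigr => j _; rewrite mxE expr2.
Qed.

(* [E k j] is the entry of column [j] (counted from 0) in a row with lambda_i - i = k. *)
Definition jacobi_trudi (R : comNzRingType) (E : int -> nat -> R) (lam : seq nat) n : R :=
  \det (\matrix_(i < n, j < n) E ((nth 0%N lam i)%:Z - i%:Z) j).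

(** The row of a zero part in position n starts with n zeros followed by 1, so a last row of this
    kind can be removed. Partitions of different lengths can thus share determinants of one size. *)
Lemma jacobi_trudi_pad (R : comNzRingType) (E : int -> nat -> R) lam n :
  (forall n j, (j <= n)%N -> E (- n%:Z) j = (j == n)%:R) ->
  (size lam <= n)%N -> jacobi_trudi E lam n = jacobi_trudi E lam (size lam).
Proof.
move=> HE; move/subnKC => <-; elim: (n - size lam)%N => [|d IH]; rewrite ?addn0//.
rewrite addnS -{}IH /jacobi_trudi; set N := (size lam + d)%N.
rewrite (expand_det_row _ ord_max) (bigD1 ord_max) //= big1 ?addr0; last first.
  move=> j jN; rewrite mxE nth_default ?leq_addr// sub0r HE; last by rewrite -ltnS.
  by case: eqP => [jE|]; rewrite ?mul0r//; move/eqP: jN; case; apply: val_inj.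
rewrite mxE nth_default ?leq_addr//= sub0r HE ?leqnn// eqxx mul1r /cofactor.
rewrite addnn -signr_odd odd_double expr0 mul1r; congr determinant.
by apply/matrixP => i j; rewrite !mxE !lift_max.
Qed.

(** [f i] is the position lambda_{n-i} + i of a particle, with parts numbered from 1. Strictly
    increasing positions below [n + L] encode the partitions with at most [n] parts, all at most
    [L]. *)
Definition padded_part n m (f : {ffun 'I_n -> 'I_m}) : seq nat :=
  [seq (f i - i)%N | i <- rev (enum 'I_n)].
Definition part_of n m (f : {ffun 'I_n -> 'I_m}) : seq nat :=
  [seq x <- padded_part f | (0 < x)%N].

Lemma nth_rev_enum n (k : nat) (i0 : 'I_n) (kn : (k < n)%N) :
  nth i0 (rev (enum 'I_n)) k = rev_ord (Ordinal kn).
Proof.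
rewrite nth_rev size_enum_ord //; apply: val_inj => /=.
by rewrite nth_enum_ord // ltn_subrL (leq_ltn_trans _ kn).
Qed.

Lemma nth_padded_part n m (f : {ffun 'I_n -> 'I_m}) (i : 'I_n) :
  nth 0%N (padded_part f) (rev_ord i) = (f i - i)%N.
Proof.
rewrite (nth_map i) ?size_rev ?size_enum_ord//.
rewrite (@nth_rev_enum n (rev_ord i) i (ltn_ord (rev_ord i))).
have -> : rev_ord (Ordinal (ltn_ord (rev_ord i))) = i.
  by apply: val_inj => /=; have := ltn_ord i; lia.
by [].
Qed.

Lemma increasing_ge n m (f : {ffun 'I_n -> 'I_m}) (i j : 'I_n) :
  increasing f -> (i <= j)%N -> (f i + (j - i) <= f j)%N.
Proof.
move=> /increasingP fI; case: j => j jn /= ij.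
elim: j jn ij => [|j IH] jn ij.
  by have -> : i = Ordinal jn; [apply: val_inj => /=; lia|rewrite /=; lia].
move: ij; rewrite leq_eqVlt => /orP[/eqP E|ij].
  by have -> : i = Ordinal jn; [apply: val_inj|rewrite /=; lia].
have jn' := ltnW jn.
have := IH jn' ij; have := fI (Ordinal jn') (Ordinal jn) (ltnSn _) => /=.
lia.
Qed.

Lemma increasing_ge_id n m (f : {ffun 'I_n -> 'I_m}) (i : 'I_n) :
  increasing f -> (i <= f i)%N.
Proof.
move=> fI; case: n f i fI => [|n] f i fI; first by case: i.
have := @increasing_ge _ _ f ord0 i fI (leq0n _); rewrite /=; lia.
Qed.

Lemma size_padded_part n m (f : {ffun 'I_n -> 'I_m}) : size (padded_part f) = n.
Proof. by rewrite size_map size_rev size_enum_ord. Qed.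

Lemma padded_part_sorted n m (f : {ffun 'I_n -> 'I_m}) :
  increasing f -> sorted geq (padded_part f).
Proof.
move=> fI; apply: (@path_sorted _ _ (n + m)).
apply/(pathP 0%N) => k; rewrite size_padded_part => kn.
pose i : 'I_n := rev_ord (Ordinal kn).
have ki : k = rev_ord i by rewrite /i rev_ordK.
case: k kn @i ki => [|k] kn i ki /=.
  by rewrite [X in nth _ _ X]ki nth_padded_part; have := ltn_ord (f i); lia.
have kn' : (k < n)%N by lia.
pose j : 'I_n := rev_ord (Ordinal kn').
have kj : k = rev_ord j by rewrite /j rev_ordK.
rewrite ki nth_padded_part kj nth_padded_part.
have ij : (i <= j)%N by rewrite /i /j /=; lia.
have := increasing_ge fI ij; have := increasing_ge_id i fI; lia.
Qed.

(** In a weakly decreasing sequence the zeros come last, and there the default value 0 of [nth]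
    takes their place. *)
Lemma nth_filter_pos (s : seq nat) k : sorted geq s ->
  nth 0%N [seq x <- s | (0 < x)%N] k = nth 0%N s k.
Proof.
elim: s k => [|a s IH] k //= as_; have ss := path_sorted as_.
case: ifP => [a0|/negbT]; first by case: k => //= k; apply: IH.
rewrite -leqNgt leqn0 => /eqP a0; rewrite a0 in as_ *.
have s0 : all (fun x => x == 0%N) s.
  have tr : transitive geq by move=> x y z /= xy yz; apply: leq_trans xy.
  move: as_; rewrite (path_sortedE tr) => /andP[+ _].
  by apply: sub_all => x /=; rewrite leqn0.
rewrite (eq_in_filter (a2 := pred0)) ?filter_pred0 ?nth_nil.
  case: k => //= k; apply/esym/eqP.
  have [ks|ks] := ltnP k (size s); last by rewrite nth_default.
  exact: (all_nthP 0%N s0).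
by move=> x /(allP s0) /eqP ->.
Qed.

Lemma nth_part_of n m (f : {ffun 'I_n -> 'I_m}) (i : 'I_n) : increasing f ->
  nth 0%N (part_of f) (rev_ord i) = (f i - i)%N.
Proof. by move=> fI; rewrite nth_filter_pos ?padded_part_sorted// nth_padded_part. Qed.

Lemma size_part_of n m (f : {ffun 'I_n -> 'I_m}) : (size (part_of f) <= n)%N.
Proof. by rewrite size_filter (leq_trans (count_size _ _))// size_padded_part. Qed.

Lemma part_of_is_partition n m (f : {ffun 'I_n -> 'I_m}) : increasing f ->
  is_partition (part_of f).
Proof.
move=> fI; rewrite /is_partition filter_all andbT sorted_filter//; last exact: padded_part_sorted.
by move=> x y z /= xy yz; apply: leq_trans xy.
Qed.

Lemma part_of_inj n m (f g : {ffun 'I_n -> 'I_m}) : increasing f -> increasing g ->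
  part_of f = part_of g -> f = g.
Proof.
move=> fI gI fg; apply/ffunP => i; apply: val_inj => /=.
have := nth_part_of i fI; have := nth_part_of i gI; rewrite fg.
have := increasing_ge_id i fI; have := increasing_ge_id i gI; lia.
Qed.

Lemma part_of_le n L (f : {ffun 'I_n -> 'I_(n + L)}) x : increasing f ->
  x \in part_of f -> (x <= L)%N.
Proof.
move=> fI; rewrite mem_filter => /andP[_ /mapP[i _ ->]].
case: n f i fI => [|n] f i fI; first by case: i.
have im : (i <= (@ord_max n))%N by rewrite /= -ltnS.
have := increasing_ge fI im; have := ltn_ord (f ord_max); rewrite /=; lia.
Qed.

Lemma sumn_size_pos (s : seq nat) : all (fun x => 0 < x)%N s -> (size s <= sumn s)%N.
Proof. by elim: s => //= a s IH /andP[a0 /IH]; lia. Qed.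

Lemma mem_leq_sumn (s : seq nat) x : x \in s -> (x <= sumn s)%N.
Proof. by elim: s => //= a s IH; rewrite inE => /orP[/eqP->|/IH]; lia. Qed.

Lemma nth_le_part1 (lam : seq nat) k : sorted geq lam -> (nth 0%N lam k <= part1 lam)%N.
Proof.
case: lam => [|a s] /=; first by rewrite nth_nil.
have tr : transitive geq by move=> x y z /= xy yz; apply: leq_trans xy.
rewrite (path_sortedE tr) => /andP[/(all_nthP 0%N) H _].
case: k => //= k; have [ks|ks] := ltnP k (size s); last by rewrite nth_default.
exact: H.
Qed.

Lemma part_of_ex n L (lam : seq nat) : is_partition lam -> (size lam <= n)%N ->
  (part1 lam <= L)%N ->
  exists f : {ffun 'I_n -> 'I_(n + L)}, increasing f /\ part_of f = lam.
Proof.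
move=> /andP[so po] sz p1.
have H (i : 'I_n) : (nth 0%N lam (rev_ord i) + i < n + L)%N.
  by have := nth_le_part1 (rev_ord i) so; have := ltn_ord i; lia.
pose f := [ffun i => Ordinal (H i)]; exists f; split.
  apply/increasingP => i j ij; rewrite !ffunE /=.
  have ge_tr : transitive geq by move=> x y z /= xy yz; apply: leq_trans xy.
  have : (nth 0%N lam (rev_ord i) <= nth 0%N lam (rev_ord j))%N; last by rewrite /=; lia.
  have [isz|isz] := ltnP (rev_ord i) (size lam); last by rewrite nth_default.
  have ge_refl : reflexive geq by move=> x /=.
  have := @sorted_leq_nth _ geq ge_tr ge_refl 0%N lam so (rev_ord j) (rev_ord i).
  rewrite !inE; apply => //; last by rewrite /=; lia.
  by apply: leq_ltn_trans isz => /=; lia.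
have plE : padded_part f = mkseq (nth 0%N lam) n.
  apply: (@eq_from_nth _ 0%N); rewrite size_padded_part ?size_mkseq// => k kn.
  have -> : k = rev_ord (rev_ord (Ordinal kn)) by rewrite rev_ordK.
  by rewrite nth_padded_part nth_mkseq ?ltn_ord// ffunE /= addnK.
rewrite /part_of plE -(subnKC sz) /mkseq iotaD map_cat filter_cat.
have -> : [seq nth 0%N lam i | i <- iota 0 (size lam)] = lam by rewrite -/(mkseq _ _) mkseq_nth.
rewrite (all_filterP po) (eq_in_filter (a2 := pred0)) ?filter_pred0 ?cats0// => x.
by move=> /mapP[k]; rewrite mem_iota => /andP[sk _] ->; rewrite nth_default.
Qed.

Lemma big_split_value (V : nmodType) (I : finType) (Q : pred I) (s : I -> nat) K
  (F : I -> V) : (forall i, Q i -> (s i < K)%N) ->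
  \sum_(i | Q i) F i = \sum_(k < K) \sum_(i | Q i && (s i == k)) F i.
Proof.
move=> H; under [RHS]eq_bigr do rewrite big_mkcondr /=.
rewrite [RHS]exchange_big /=; apply: eq_bigr => i /H si.
rewrite (bigD1 (Ordinal si)) //= eqxx big1 ?addr0// => k ki.
by case: eqP => // E; move/eqP: ki; case; apply: val_inj.
Qed.

(** A partition of [m] has at most [m] parts, so for [m <= n] the bound [n] on the length excludes
    none. The two index types are compared through the duplicate-free lists of partitions that they
    enumerate. *)
Lemma sum_partitions_of_box (R : realType) (F : seq nat -> R) n L m : (m <= n)%N ->
  sum_partitions_of m (fun lam => if (part1 lam <= L)%N then F lam else 0) =
  \sum_(f : {ffun 'I_n -> 'I_(n + L)} | increasing f && (sumn (part_of f) == m))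
    F (part_of f).
Proof.
move=> mn; rewrite (@big_split_value _ _ _ (fun f => size (part_of f)) m.+1); last first.
  move=> f /andP[fI /eqP <-]; rewrite ltnS; apply: sumn_size_pos.
  by have /andP[] := part_of_is_partition fI.
apply: eq_bigr => k _; rewrite -big_mkcondr /=.
set Q := (X in \sum_(t | X t) _ = _).
set Q' := (X in _ = \sum_(f | X f) _).
rewrite -[LHS]big_filter -[RHS]big_filter.
rewrite -[LHS](big_map (fun t : k.-tuple 'I_m.+1 => map val t) xpredT F).
rewrite -[RHS](big_map (@part_of n (n + L)) xpredT F).
apply: perm_big; apply: uniq_perm.
- rewrite map_inj_uniq ?filter_uniq ?index_enum_uniq// => s t st.
  by apply: val_inj => /=; apply: (inj_map val_inj).
- rewrite map_inj_in_uniq ?filter_uniq ?index_enum_uniq// => f g.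
  rewrite !mem_filter => /andP[/andP[/andP[fI _] _] _] /andP[/andP[/andP[gI _] _] _].
  exact: part_of_inj.
move=> lam; apply/mapP/mapP => -[].
  move=> t; rewrite mem_filter => /andP[/andP[/andP[tp ts] t1] _] ->.
  have [|f [fI fE]] := part_of_ex (n := n) tp _ t1.
    by rewrite size_map size_tuple (leq_trans _ mn)// -ltnS.
  exists f; rewrite ?mem_filter ?mem_index_enum ?andbT /Q' ?fE ?fI ?ts //=.
  by rewrite size_map size_tuple.
move=> f; rewrite mem_filter => /andP[/andP[/andP[fI fs] /eqP fk] _] ->.
have [/= so po] := andP (part_of_is_partition fI).
pose t := map (@inord m) (part_of f).
have sz : size t == k by rewrite size_map fk.
have tE : map val t = part_of f.
  rewrite -map_comp -[RHS]map_id; apply/eq_in_map => x /mem_leq_sumn.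
  by rewrite (eqP fs) -ltnS => xm /=; rewrite inordK.
exists (Tuple sz) => //=; rewrite mem_filter mem_index_enum andbT /Q /= tE fs part_of_is_partition//=.
case: (part_of f) (@part_of_le _ _ f ^~ fI) => //= a s; apply; exact: mem_head.
Qed.

(* [c = true] is the symplectic case and [c = false] the orthogonal one. *)
Definition folded_entry (A : comNzRingType) (c : bool) (al : int -> A) (k : int) (j : nat) : A :=
  al (k + j%:Z) -
  (-1) ^+ c * (~~ (c && (j == 0%N)))%:R * al (k - j%:Z - 2 + (c : nat)%:Z *+ 2).

(** Rows of the inverse Toeplitz matrix below the cut, corrected by their reflections and multiplied
    by the triangular Toeplitz matrix of [al]. The index [m] counts columns leftwards from the
    cut. *)
Definition lower_fold (A : comNzRingType) (c : bool) (al al' : int -> A) (p m : nat) : A :=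
  \sum_(k < p.+1) al (p%:Z - k%:Z) * (al' (k%:Z + 1 + m%:Z) +
     (-1) ^+ c * (0 < k + c)%N%:R * al' (m%:Z + 1 - (c : nat)%:Z *+ 2 - k%:Z)).
Definition upper_conv (A : comNzRingType) (be be' : int -> A) (m q : nat) : A :=
  \sum_(k < q.+1) be' (k%:Z + 1 + m%:Z) * be (q%:Z - k%:Z).

Definition unit_series (A : comNzRingType) (al : int -> A) :=
  (forall k, k < 0 -> al k = 0) /\ al 0 = 1.
Definition inverse_series (A : comNzRingType) (al al' : int -> A) :=
  forall n : nat, \sum_(i < n.+1) al i%:Z * al' (n%:Z - i%:Z) = (n == 0%N)%:R.

(** * Finite Toeplitz matrices and the folded Cauchy identity *)

Section folded_Cauchy.
Variables (A : comNzRingType) (c : bool) (al al' be be' : int -> A).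
Hypotheses (al1 : unit_series al) (al'1 : unit_series al').
Hypotheses (be1 : unit_series be) (be'1 : unit_series be').
Hypotheses (al_inv : inverse_series al al') (be_inv : inverse_series be' be).

Definition lowT m (a : int -> A) : 'M[A]_m := \matrix_(i, j) a (i%:Z - j%:Z).
Definition upT m (a : int -> A) : 'M[A]_m := \matrix_(i, j) a (j%:Z - i%:Z).

Lemma lowT_inv m (a a' : int -> A) : unit_series a -> unit_series a' ->
  inverse_series a a' -> lowT m a *m lowT m a' = 1%:M.
Proof.
move=> [a0 _] [a'0 _] inv; apply/matrixP => i j; rewrite !mxE.
have [ij|ji] := ltnP i j.
  rewrite -val_eqE /= ltn_eqF//= big1// => k _; rewrite !mxE.
  have [ki|ik] := leqP k i; first by rewrite [a' _]a'0 ?mulr0//; lia.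
  by rewrite a0 ?mul0r//; lia.
have -> : (i == j) = (i - j == 0)%N by rewrite -val_eqE /=; lia.
rewrite -inv.
pose F (k : nat) := a (i%:Z - k%:Z) * a' (k%:Z - j%:Z).
rewrite (eq_bigr (fun k : 'I_m => F k)) => [|k _]; last by rewrite !mxE.
rewrite -(big_mkord xpredT F) (big_cat_nat (n := j)) //=; last exact/ltnW/ltn_ord.
rewrite big_nat_cond big1 ?add0r => [|k /andP[/andP[_ kj] _]]; last first.
  by rewrite /F [a' _]a'0 ?mulr0//; lia.
rewrite (big_cat_nat (n := i.+1)) //=; last by apply: ltnW.
rewrite [X in _ + X]big_nat_cond [X in _ + X]big1 ?addr0; last first.
  by move=> k /andP[/andP[ik _] _]; rewrite /F a0 ?mul0r//; lia.
rewrite big_nat_rev /= -{1}[nat_of_ord j]add0n big_addn.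
have -> : (i.+1 - j)%N = (i - j).+1 by lia.
rewrite big_mkord; apply: eq_bigr => k _; rewrite /F.
by have := ltn_ord k; move=> kij; congr (a _ * a' _); lia.
Qed.

Lemma tr_lowT m a : (lowT m a)^T = upT m a.
Proof. by apply/matrixP => i j; rewrite !mxE. Qed.

Lemma upT_inv m (a a' : int -> A) : unit_series a -> unit_series a' ->
  inverse_series a' a -> upT m a *m upT m a' = 1%:M.
Proof. by move=> ? ? ?; rewrite -!tr_lowT -trmx_mul lowT_inv// trmx1. Qed.

Lemma det_lowT m a : unit_series a -> \det (lowT m a) = 1.
Proof.
move=> [a0 a1]; rewrite det_trig.
  by rewrite big1// => i _; rewrite mxE subrr.
by apply/is_trig_mxP => i j ij; rewrite mxE a0//; lia.
Qed.

Lemma det_upT m a : unit_series a -> \det (upT m a) = 1.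
Proof. by move=> ?; rewrite -tr_lowT det_tr det_lowT. Qed.

Variables (n L : nat).

(** Jacobi-Trudi columns are numbered from right to left, [r = n - 1 - j]; the exclusion
    [r + c != n] is then column [j = 0] of the symplectic case. *)
Definition foldB : 'M[A]_(n + L, n) := \matrix_(v, r)
  (al (v%:Z - r%:Z) - (-1) ^+ c * (r + c != n)%N%:R *
    al (v%:Z + r%:Z - n%:Z *+ 2 + (c : nat)%:Z *+ 2)).
Definition rowsA : 'M[A]_(n, n + L) := \matrix_(r, v) be (v%:Z - r%:Z).

(** The fold of column [r] is column [2 n - 2 c - r] of the same Toeplitz matrix, and that column
    lies at or beyond the cut [n] unless it is excluded. Folding is therefore right multiplication
    by the unitriangular matrix [S1]. *)
Let s : 'M[A]_(L, n) := \matrix_(p, r)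
  (- ((-1) ^+ c * (r + c != n)%N%:R * ((n + p + r + c * 2)%N == (n * 2)%N)%:R)).
Let S1 : 'M[A]_(n + L) := block_mx 1%:M 0 s 1%:M.
Let S1' : 'M[A]_(n + L) := block_mx 1%:M 0 (- s) 1%:M.

Lemma S1K : S1 *m S1' = 1%:M.
Proof.
by rewrite mulmx_block !mul1mx !mulmx1 !mul0mx !mulmx0 !addr0 ?add0r subrr -scalar_mx_block.
Qed.

Lemma foldBE : lsubmx (lowT (n + L) al *m S1) = foldB.
Proof.
apply/matrixP => v r; rewrite mxE mxE big_split_ord /=.
rewrite (bigD1 r) //= block_mxEul !mxE eqxx mulr1 big1 ?addr0 => [|k kr]; last first.
  by rewrite block_mxEul !mxE (negbTE kr) mulr0.
congr (_ + _).
under eq_bigr => p _ do rewrite block_mxEdl !mxE.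
have [rc|rc] := eqVneq (r + c)%N n.
  by rewrite big1 => [|p _]; rewrite /= !(mulr0, mul0r, oppr0).
rewrite mulr1.
have rn := ltn_ord r.
have [vL|vL] := ltnP (n * 2 - r - c * 2) (n + L).
  have pL : (n * 2 - r - c * 2 - n < L)%N by lia.
  rewrite (bigD1 (Ordinal pL)) //= big1 ?addr0 => [|p pp]; last first.
    case: eqP => E; last by rewrite !(mulr0, mul0r, oppr0).
    move/eqP: pp; case; apply: val_inj => /=; lia.
  have -> : (n + (n * 2 - r - c * 2 - n) + r + c * 2 == n * 2)%N by lia.
  rewrite mulr1 mulrN mulrC; congr (- (_ * al _)); lia.
rewrite big1 => [|p _].
  by rewrite al1.1 ?(mulr0,oppr0)//; have := ltn_ord v; lia.
case: eqP => E; last by rewrite !(mulr0, mul0r, oppr0).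
by have := ltn_ord p; lia.
Qed.

Lemma rowsAE : usubmx (upT (n + L) be) = rowsA.
Proof. by apply/matrixP => r v; rewrite !mxE. Qed.

Let Pm : 'M[A]_(L, n) := \matrix_(p, r) lower_fold c al al' p (rev_ord r).
Let Qm : 'M[A]_(n, L) := \matrix_(r, q) upper_conv be be' (rev_ord r) q.

(** The matrix [C], product of the upper Toeplitz, lower Toeplitz and fold factors, has determinant
    1 and [rowsA *m foldB] as its upper left block. Jacobi's formula passes to the lower right block
    of the inverse. The determinant of size [n] becomes one of size [L], in which [n] is only the
    range of a sum. *)
Lemma folded_Cauchy :
  \sum_(f : {ffun 'I_n -> 'I_(n + L)} | increasing f)
    \det (\matrix_(i, j) rowsA i (f j)) * \det (\matrix_(i, j) foldB (f i) j) =
  \det (\matrix_(p < L, q < L) ((p == q)%:R +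
    \sum_(m < n) lower_fold c al al' p m * upper_conv be be' m q)).
Proof.
rewrite -Cauchy_Binet.
set Tl := lowT (n + L) al; set Tu := upT (n + L) be.
set Tl' := lowT (n + L) al'; set Tu' := upT (n + L) be'.
pose C := Tu *m (Tl *m S1); pose D := (S1' *m Tl') *m Tu'.
have al_inv' m : lowT m al' *m lowT m al = 1%:M by apply: mulmx1C; apply: lowT_inv.
have be_inv' m : upT m be *m upT m be' = 1%:M by apply: upT_inv.
have TlS : (Tl *m S1) *m (S1' *m Tl') = 1%:M.
  by rewrite mulmxA -(mulmxA Tl) S1K mulmx1 lowT_inv.
have CD : C *m D = 1%:M.
  by rewrite /C /D mulmxA -(mulmxA Tu) TlS mulmx1 be_inv'.
have dC : \det C = 1.
  by rewrite /C !det_mulmx det_upT// det_lowT// det_lblock !det1 !mulr1.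
have -> : rowsA *m foldB = ulsubmx C.
  by rewrite -rowsAE -foldBE /C /ulsubmx mulmx_lsub mul_usub_mx.
have := @det_complementary_minor _ _ _ (ulsubmx C) (ursubmx C) (dlsubmx C) (drsubmx C)
  (ulsubmx D) (ursubmx D) (dlsubmx D) (drsubmx D).
rewrite !submxK CD dC mul1r => -> //.
have lowTb a : unit_series a -> lowT (n + L) a = block_mx (lowT n a) 0
    (\matrix_(p, r) a (n%:Z + p%:Z - r%:Z)) (lowT L a).
  move=> [a0 _]; apply/matrixP => i j; rewrite mxE; case: (split_ordP i) => i' ->;
    case: (split_ordP j) => j' ->; rewrite ?block_mxEul ?block_mxEur ?block_mxEdl ?block_mxEdr !mxE /=.
  - by [].
  - by rewrite a0//; have := ltn_ord i'; lia.
  - by congr a; lia.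
  - by congr a; lia.
have upTb a : unit_series a -> upT (n + L) a = block_mx (upT n a)
    (\matrix_(r, p) a (n%:Z + p%:Z - r%:Z)) 0 (upT L a).
  move=> a1; rewrite -tr_lowT lowTb// tr_block_mx !tr_lowT trmx0; congr block_mx.
  by apply/matrixP => i j; rewrite !mxE.
set b := (\matrix_(p < L, r < n) al' (n%:Z + p%:Z - r%:Z)).
set b' := (\matrix_(r < n, p < L) be' (n%:Z + p%:Z - r%:Z)).
have -> : drsubmx D = lowT L al' *m upT L be' + (b - s *m lowT n al') *m b'.
  rewrite /D /Tl' /Tu' lowTb// upTb// /S1' !mulmx_block block_mxKdr.
  by rewrite !(mul1mx, mulmx0, mul0mx, addr0, add0r, mulNmx) addrC [b - _]addrC.
(* The flanking factors have determinant 1 and cancel [lowT L al' *m upT L be'], leaving the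
   identity plus a product. *)
transitivity (\det (lowT L al *m (lowT L al' *m upT L be' + (b - s *m lowT n al') *m b') *m upT L be)).
  by rewrite !det_mulmx det_lowT// det_upT// mulr1 mul1r.
rewrite mulmxDr mulmxDl mulmxA lowT_inv// mul1mx (mulmx1C (be_inv' L)).
rewrite [in X in _ + X](mulmxA (lowT L al)) -[in X in _ + X]mulmxA.
have -> : lowT L al *m (b - s *m lowT n al') = Pm.
  apply/matrixP => p r; rewrite !mxE /lower_fold.
  have rn := ltn_ord r.
  pose F (k : nat) := al (p%:Z - k%:Z) * (al' (k%:Z + 1 + (rev_ord r)%:Z) +
     (-1) ^+ c * (0 < k + c)%N%:R * al' ((rev_ord r)%:Z + 1 - (c : nat)%:Z *+ 2 - k%:Z)).
  transitivity (\sum_(k < L) F k).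
    apply: eq_bigr => k _; rewrite !mxE /F; congr (_ * (al' _ + _)).
      by rewrite /=; lia.
    rewrite (eq_bigr (fun j : 'I_n => - ((-1) ^+ c * (j + c != n)%N%:R *
       ((n + k + j + c * 2)%N == (n * 2)%N)%:R * al' (j%:Z - r%:Z)))); last first.
      by move=> j _; rewrite !mxE mulNr.
    rewrite sumrN opprK.
    have [kc|kc] := posnP (k + c)%N.
      rewrite mulr0 mul0r big1// => j _; have jn := ltn_ord j.
      have [k0 c0] : k = 0%N :> nat /\ nat_of_bool c = 0%N by lia.
      have -> : (n + k + j + c * 2 == n * 2)%N = false by lia.
      by rewrite !(mulr0, mul0r).
    rewrite mulr1.
    have [kn|kn] := leqP (k + c * 2) n; last first.
      rewrite al'1.1 ?mulr0; last by rewrite /=; lia.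
      rewrite big1// => j _; have [E|_] := eqVneq (n + k + j + c * 2)%N (n * 2)%N; last by rewrite !(mulr0, mul0r, oppr0).
      by exfalso; lia.
    have jn : (n - (k + c * 2) < n)%N \/ (k + c * 2 = 0)%N by lia.
    case: jn => [jn|]; last by lia.
    rewrite (bigD1 (Ordinal jn)) //= big1 ?addr0 => [|j jj]; last first.
      have [E|_] := eqVneq (n + k + j + c * 2)%N (n * 2)%N; last by rewrite !(mulr0, mul0r, oppr0).
      by move/eqP: jj; case; apply: val_inj => /=; lia.
    have -> : (n + k + (n - (k + c * 2)) + c * 2 == n * 2)%N by lia.
    have -> : (n - (k + c * 2) + c != n)%N by lia.
    by rewrite !mulr1; congr (_ * al' _); lia.
  rewrite -(big_mkord xpredT F) (big_cat_nat (n := p.+1)) //=.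
  rewrite [X in _ + X]big_nat_cond [X in _ + X]big1 ?addr0 ?big_mkord//.
  by move=> k /andP[/andP[pk _] _]; rewrite /F al1.1 ?mul0r//; lia.
have -> : b' *m upT L be = Qm.
  apply/matrixP => r q; rewrite !mxE /upper_conv.
  have rn := ltn_ord r.
  pose F (k : nat) := be' (k%:Z + 1 + (rev_ord r)%:Z) * be (q%:Z - k%:Z).
  transitivity (\sum_(k < L) F k).
    by apply: eq_bigr => k _; rewrite !mxE /F; congr (be' _ * _); rewrite /=; lia.
  rewrite -(big_mkord xpredT F) (big_cat_nat (n := q.+1)) //=.
  rewrite [X in _ + X]big_nat_cond [X in _ + X]big1 ?addr0 ?big_mkord//.
  by move=> k /andP[/andP[pk _] _]; rewrite /F be1.1 ?mulr0//; lia.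
congr determinant; apply/matrixP => p q; rewrite !mxE; congr (_ + _).
rewrite [RHS](reindex_inj rev_ord_inj); apply: eq_bigr => r _; by rewrite !mxE.
Qed.

Lemma det_rowsA (f : {ffun 'I_n -> 'I_(n + L)}) : increasing f ->
  \det (\matrix_(i, j) rowsA i (f j)) =
  jacobi_trudi (fun k j => be (k + j%:Z)) (part_of f) n.
Proof.
move=> fI; rewrite -det_tr -(det_reindex (perm (@rev_ord_inj n))); congr determinant.
apply/matrixP => i j; rewrite !mxE !permE -[in RHS](rev_ordK i) nth_part_of//.
rewrite rev_ordK; have := increasing_ge_id (rev_ord i) fI.
by move=> H; congr be; move: H; rewrite /=; have := ltn_ord i; have := ltn_ord j; lia.
Qed.

Lemma det_foldB (f : {ffun 'I_n -> 'I_(n + L)}) : increasing f ->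
  \det (\matrix_(i, j) foldB (f i) j) = jacobi_trudi (folded_entry c al) (part_of f) n.
Proof.
move=> fI; rewrite -(det_reindex (perm (@rev_ord_inj n))); congr determinant.
apply/matrixP => i j; rewrite !mxE !permE -[in RHS](rev_ordK i) nth_part_of//.
rewrite rev_ordK /folded_entry; have := increasing_ge_id (rev_ord i) fI.
have ni := ltn_ord i; have nj := ltn_ord j => H.
have -> : ((rev_ord j + c)%N != n) = ~~ (c && (j == 0%N :> nat)) by rewrite /=; lia.
by congr (al _ - _ * _ * al _); move: H; rewrite /=; lia.
Qed.

End folded_Cauchy.

(** * Truncated partition sums *)

Section poly_norm.
Variable R : realType.
Implicit Types p q : {poly R}.

Definition poly_abs p : {poly R} := \poly_(i < size p) `|p`_i|.
Definition poly_norm p : R := (poly_abs p).[2].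

Lemma coef_poly_abs p i : (poly_abs p)`_i = `|p`_i|.
Proof. by rewrite coef_poly; case: ltnP => // H; rewrite nth_default// normr0. Qed.

Lemma poly_abs_le p (q : {poly R}) : (forall i, `|p`_i| <= q`_i) -> poly_norm p <= q.[2].
Proof.
move=> H; rewrite /poly_norm.
rewrite (horner_coef_wide _ (leq_maxl (size (poly_abs p)) (size q))).
rewrite (horner_coef_wide _ (leq_maxr (size (poly_abs p)) (size q))).
by apply: ler_sum => i _; apply: ler_wpM2r; rewrite ?exprn_ge0// coef_poly_abs.
Qed.

Lemma poly_norm_ge0 p : 0 <= poly_norm p.
Proof.
rewrite /poly_norm horner_coef sumr_ge0// => i _.
by rewrite coef_poly_abs mulr_ge0// exprn_ge0.
Qed.

Lemma poly_normD p q : poly_norm (p + q) <= poly_norm p + poly_norm q.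
Proof.
rewrite -hornerD; apply: poly_abs_le => i.
by rewrite !coefD !coef_poly_abs ler_normD.
Qed.

Lemma poly_normM p q : poly_norm (p * q) <= poly_norm p * poly_norm q.
Proof.
rewrite -hornerM; apply: poly_abs_le => i.
rewrite !coefM (le_trans (ler_norm_sum _ _ _))//; apply: ler_sum => j _.
by rewrite normrM !coef_poly_abs.
Qed.

Lemma poly_normN p : poly_norm (- p) = poly_norm p.
Proof. by congr horner; apply/polyP => i; rewrite !coef_poly_abs coefN normrN. Qed.

Lemma poly_norm_monomial (a : R) n : poly_norm (a *: 'X^n) = `|a| * 2 ^+ n.
Proof.
rewrite /poly_norm; have -> : poly_abs (a *: 'X^n) = `|a| *: 'X^n.
  apply/polyP => i; rewrite coef_poly_abs !coefZ coefXn normrM.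
  by case: eqP; rewrite ?normr1 ?normr0.
by rewrite hornerZ hornerXn.
Qed.

Lemma poly_normC (a : R) : poly_norm a%:P = `|a|.
Proof. by rewrite -alg_polyC -[1]/('X^0) poly_norm_monomial expr0 mulr1. Qed.

Lemma poly_norm0 : poly_norm 0 = 0.
Proof. by rewrite -[0]/(0%:P) poly_normC normr0. Qed.

Lemma poly_norm1 : poly_norm 1 = 1.
Proof. by rewrite -[1]/(1%:P) poly_normC normr1. Qed.

Lemma horner1_le_poly_norm p : `|p.[1]| <= poly_norm p.
Proof.
rewrite horner_coef (le_trans (ler_norm_sum _ _ _))//.
rewrite /poly_norm (horner_coef_wide _ (size_poly _ _)); apply: ler_sum => i _.
rewrite expr1n mulr1 coef_poly_abs ler_peMr//.
by rewrite exprn_ege1// ler1n.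
Qed.

(** A coefficient of index at least [N] enters [poly_norm] with weight at least 2^N but the value at
    1 with weight 1: this is the reason for a radius larger than 1. *)
Lemma poly_tail p N : `|\sum_(m < N) p`_m - p.[1]| <= poly_norm p / 2 ^+ N.
Proof.
have sz : (size p <= maxn N (size p))%N by apply: leq_maxr.
rewrite (horner_coef_wide _ sz) -(big_mkord xpredT (fun i => p`_i * 1 ^+ i)).
rewrite (big_cat_nat (n := N)) ?leq_maxl//= big_mkord.
rewrite (eq_bigr (fun i : 'I_N => p`_i * 1 ^+ i)); last by move=> i _; rewrite expr1n mulr1.
rewrite opprD addrA subrr add0r normrN.
rewrite ler_pdivlMr ?exprn_gt0// /poly_norm.
have sz' : (size (poly_abs p) <= maxn N (size p))%N by apply: leq_trans (size_poly _ _) sz.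
rewrite (horner_coef_wide _ sz') -(big_mkord xpredT (fun i => (poly_abs p)`_i * 2 ^+ i)).
rewrite [leRHS](big_cat_nat (n := N)) ?leq_maxl//=.
rewrite -[leLHS]add0r lerD//.
  by rewrite sumr_ge0// => i _; rewrite coef_poly_abs mulr_ge0// exprn_ge0.
apply: le_trans (ler_wpM2r _ (ler_norm_sum _ _ _)) _; first exact: exprn_ge0.
rewrite mulr_suml; apply: ler_sum_nat => i /andP[Ni _].
by rewrite expr1n mulr1 coef_poly_abs ler_wpM2l// ler_weXn2l// ler1n.
Qed.
End poly_norm.

Section plancherel_h.
Variable R : realType.
Implicit Types s t : R.

Lemma h_pl_neg s (k : int) : k < 0 -> h_pl s k = 0.
Proof. by case: k. Qed.

Lemma h_pl0 s : h_pl s 0 = 1.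
Proof. by rewrite /h_pl /= expr0 fact0 divr1. Qed.

Lemma h_pl_unit s : unit_series (h_pl s).
Proof. by split; [exact: h_pl_neg|exact: h_pl0]. Qed.

Lemma h_plD s t (n : nat) :
  \sum_(i < n.+1) h_pl s i%:Z * h_pl t (n%:Z - i%:Z) = h_pl (s + t) n%:Z.
Proof.
rewrite [s + t]addrC /h_pl exprDn mulr_suml; apply: eq_bigr => i _.
have -> : (n%:Z - i%:Z) = (n - i)%N by rewrite subzn// -ltnS.
have ni : (i <= n)%N by rewrite -ltnS.
rewrite -(bin_fact ni) !natrM -mulr_natr.
have f1 : (i`!%:R : R) != 0 by rewrite pnatr_eq0 -lt0n fact_gt0.
have f2 : ((n - i)`!%:R : R) != 0 by rewrite pnatr_eq0 -lt0n fact_gt0.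
have f3 : ('C(n, i)%:R : R) != 0 by rewrite pnatr_eq0 -lt0n bin_gt0.
by field; rewrite f1 f2 f3.
Qed.

Lemma h_pl_zero (n : nat) : h_pl (0 : R) n%:Z = (n == 0%N)%:R.
Proof. by case: n => [|n]; rewrite ?h_pl0// /h_pl /= expr0n mul0r. Qed.

Lemma h_pl_inverse s : inverse_series (h_pl s) (h_pl (- s)).
Proof. by move=> n; rewrite h_plD subrr h_pl_zero. Qed.

Lemma h_pl_inverse' s : inverse_series (h_pl (- s)) (h_pl s).
Proof. by move=> n; rewrite h_plD addNr h_pl_zero. Qed.

Lemma exp_term_le (x : R) n : 0 <= x -> x ^+ n / n`!%:R <= expR x.
Proof.
move=> x0; case: n => [|n].
  by rewrite expr0 fact0 divr1 (le_trans _ (expR_ge1Dx x))// lerDl.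
by apply: le_trans (expR_ge1Dxn n x0); rewrite lerDr.
Qed.

Lemma h_pl_bound s (r : R) (n : nat) : 0 <= r ->
  `|h_pl s n%:Z| * r ^+ n <= expR (`|s| * r).
Proof.
move=> r0; apply: le_trans (exp_term_le n (mulr_ge0 (normr_ge0 s) r0)).
by rewrite /h_pl normrM normrX normfV normr_nat exprMn mulrAC.
Qed.

Lemma h_pl_le s (r : R) (n : nat) : 0 < r ->
  `|h_pl s n%:Z| <= expR (`|s| * r) * r^-1 ^+ n.
Proof.
move=> r0; rewrite exprVn -ler_pdivrMr ?invr_gt0 ?exprn_gt0// invrK.
exact/h_pl_bound/ltW.
Qed.

Lemma h_pl_norm_le s (k : int) : `|h_pl s k| <= expR `|s|.
Proof.
case: k => k; last by rewrite h_pl_neg// normr0 expR_ge0.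
by have := h_pl_le s k ltr01; rewrite mulr1 invr1 expr1n mulr1.
Qed.

(** The variable grades the Schur factor by the size of the partition, so that a coefficient
    collects the partitions of one size. *)
Definition hX t (k : int) : {poly R} := h_pl t k *: 'X^`|k|.

Lemma hX_unit t : unit_series (hX t).
Proof.
by split=> [k k0|]; rewrite /hX; [rewrite h_pl_neg// scale0r|rewrite h_pl0 scale1r expr0].
Qed.

Lemma hX_inverse t : inverse_series (hX (- t)) (hX t).
Proof.
move=> n; transitivity ((\sum_(i < n.+1) h_pl (- t) i%:Z * h_pl t (n%:Z - i%:Z)) *: 'X^n : {poly R}).
  rewrite scaler_suml; apply: eq_bigr => i _.
  have ni : (i <= n)%N by rewrite -ltnS.
  rewrite /hX -scalerAl -scalerAr scalerA -exprD; congr (_ *: 'X^_).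
  by rewrite subzn//= subnKC.
by rewrite h_pl_inverse'; case: n => [|n]; rewrite ?scale0r// scale1r.
Qed.

Lemma hX1 t k : (hX t k).[1] = h_pl t k.
Proof. by rewrite /hX hornerZ hornerXn expr1n mulr1. Qed.

(** Homogeneity: in the term of each permutation the row and column shifts cancel and the indices
    add up to the size of the partition. *)
Lemma jacobi_trudi_hX t lam n : (size lam <= n)%N ->
  jacobi_trudi (fun k j => hX t (k + j%:Z)) lam n =
  jacobi_trudi (fun k j => h_pl t (k + j%:Z)) lam n *: 'X^(sumn lam).
Proof.
move=> sz; rewrite /jacobi_trudi /determinant scaler_suml; apply: eq_bigr => s _.
pose k (i : 'I_n) := (nth 0%N lam i)%:Z - i%:Z + (s i)%:Z.
rewrite (eq_bigr (fun i => h_pl t (k i) *: 'X^`|k i|)); last by move=> i _; rewrite mxE.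
rewrite scaler_prod prodrXr.
rewrite [in RHS](eq_bigr (fun i => h_pl t (k i))) => [|i _]; last by rewrite mxE.
(* With a negative index the exponent [|k i|] would be wrong, but then the coefficient is zero. *)
have [/forallP kpos|/forallPn[i]] := boolP [forall i, 0 <= k i]; last first.
  rewrite -ltNge => ki; rewrite (bigD1 i)//= h_pl_neg// mul0r mulr0 !scale0r.
  by rewrite mulr0.
have -> : (\sum_(i < n) `|k i|)%N = sumn lam.
  have -> : sumn lam = (\sum_(i < n) nth 0%N lam i)%N.
    rewrite -(big_mkord xpredT (fun i => nth 0%N lam i)) (big_cat_nat (n := size lam)) //=.
    rewrite [X in (_ + X)%N]big_nat_cond [X in (_ + X)%N]big1 ?addn0; last first.
      by move=> i /andP[/andP[si _] _]; rewrite nth_default.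
    by rewrite sumnE (big_nth 0%N).
  apply/eqP; rewrite -(eqr_nat int) !natr_sum.
  have -> : \sum_(i < n) (`|k i|%N%:R : int) = \sum_(i < n) k i.
    by apply: eq_bigr => i _; rewrite natz gez0_abs.
  rewrite /k big_split sumrB /=.
  have -> : \sum_(i < n) (s i)%:Z = \sum_(i < n) (i : nat)%:Z.
    by rewrite [RHS](reindex_inj (@perm_inj _ s)).
  by rewrite subrK; apply/eqP/eq_bigr => i _; rewrite natz.
by rewrite !mulr_sign; case: ifP => _; rewrite ?scaleNr.
Qed.
End plancherel_h.

(** * Weights of partitions in a box, graded by size *)

Definition weight (R : realType) (c : bool) (theta : R) (lam : seq nat) : R :=
  if c then w_sp theta lam else w_o theta lam.

(** In the symplectic determinant the two terms of column 0 coincide. Counting them once, as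
    [folded_entry] does, absorbs the factor 1/2. *)
Lemma weightE (R : realType) c (theta : R) lam n : (size lam <= n)%N ->
  weight c theta lam = jacobi_trudi (folded_entry c (h_pl (2 * theta))) lam n *
    jacobi_trudi (fun k j => h_pl theta (k + j%:Z)) lam n.
Proof.
move=> sz; rewrite !jacobi_trudi_pad//; first last.
- move=> m j jm; rewrite /folded_entry.
  have -> : h_pl (2 * theta) (- m%:Z + j%:Z) = (j == m)%:R.
    have [->|jm'] := eqVneq j m; first by rewrite addNr h_pl0.
    by rewrite h_pl_neg//; lia.
  have [/andP[-> /eqP ->]|H] := boolP (c && (j == 0%N)); first by rewrite mulr0 mul0r subr0.
  by rewrite [X in _ * X]h_pl_neg ?mulr0 ?subr0//; case: c H => /=; lia.
- move=> m j jm.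
  have [->|jm'] := eqVneq j m; first by rewrite addNr h_pl0.
  by rewrite h_pl_neg//; lia.
have -> : jacobi_trudi (fun k j => h_pl theta (k + j%:Z)) lam (size lam) = schur (h_pl theta) lam.
  by rewrite /jacobi_trudi /schur /lidx.
case: c => /=; rewrite /w_sp /w_o; congr (_ * _).
  case: lam sz => [|a s] sz; first by rewrite /jacobi_trudi det_mx00.
  rewrite /sympl; set lam := a :: s.
  have -> : \matrix_(i < size lam, j < size lam) (h_pl (2 * theta) (lidx lam i j) +
      h_pl (2 * theta) (lidx lam i (- j%:Z))) =
    (\matrix_(i < size lam, j < size lam)
      folded_entry true (h_pl (2 * theta)) ((nth 0%N lam i)%:Z - i%:Z) j) *m
    diag_mx (\row_j (if j == 0%N :> nat then 2 else 1)).
    apply/matrixP => i j; rewrite mul_mx_diag !mxE /folded_entry /lidx expr1.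
    have [j0|j0] := eqVneq (j : nat) 0%N; rewrite /= ?j0.
      by rewrite mulr0 mul0r [X in _ = X * _]subr0 mulr_natr mulr2n; congr (_ + h_pl _ _); lia.
    rewrite !mulr1 mulN1r opprK; congr (_ + h_pl _ _); lia.
  rewrite det_mulmx det_diag big_ord_recl mxE /= big1 ?mulr1; last by move=> i _; rewrite mxE.
  by rewrite mulrCA mulVf ?mulr1// pnatr_eq0.
rewrite /orthog /jacobi_trudi; congr determinant; apply/matrixP => i j.
rewrite !mxE /folded_entry /lidx expr0 !mul1r; congr (_ - h_pl _ _); lia.
Qed.

Section section_bounds.
Variables (R : realType) (c : bool) (theta : R).

Definition foldP (p m : nat) : R :=
  lower_fold c (h_pl (2 * theta)) (h_pl (- (2 * theta))) p m.
Definition convQ (m q : nat) : R := upper_conv (h_pl theta) (h_pl (- theta)) m q.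
Definition convQX (m q : nat) : {poly R} := upper_conv (hX theta) (hX (- theta)) m q.
Definition section_entry (n p q : nat) : R := \sum_(m < n) foldP p m * convQ m q.

Lemma convQX1 m q : (convQX m q).[1] = convQ m q.
Proof. by rewrite horner_sum; apply: eq_bigr => k _; rewrite hornerM !hX1. Qed.

Lemma lower_fold_polyC p m :
  lower_fold c (fun k => (h_pl (2 * theta) k)%:P) (fun k => (h_pl (- (2 * theta)) k)%:P) p m
  = (foldP p m)%:P.
Proof.
rewrite /foldP /lower_fold rmorph_sum; apply: eq_bigr => k _ /=.
by rewrite !(polyCM, polyCD, polyC_exp, polyCN, polyC_natr).
Qed.

(** Pays for the [k + 1] equally bounded terms of a convolution by weakening the ratio from 1/4 to
    1/2. *)
Lemma half_pow_le k : (k.+1)%:R * (4^-1 : R) ^+ k <= 2^-1 ^+ k.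
Proof.
have -> : (4^-1 : R) = 2^-1 * 2^-1 by rewrite -invfM -natrM.
rewrite exprMn mulrA ler_piMl ?exprn_ge0// -ler_pdivlMr ?exprn_gt0 ?invr_gt0//.
by rewrite div1r -exprVn invrK -natrX ler_nat ltn_expl.
Qed.

(** The reflected coefficient has index [m + 1 - 2 c - k], which may be small although [k] is large;
    conceding the growth [4 ^+ m] restores the decay in [k]. *)
Lemma foldP_bound : exists2 C : R, 0 <= C & forall p m,
  `|foldP p m| <= C * 2^-1 ^+ p * 4 ^+ m.
Proof.
pose K := expR (`|2 * theta| * 4) : R.
have K0 : 0 <= K by apply: expR_ge0.
have hK s (k : nat) : `|s| = `|2 * theta| -> `|h_pl s k| <= K * 4^-1 ^+ k.
  by move=> sE; rewrite /K -sE; apply: h_pl_le.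
exists (K ^+ 2 * 5) => [|p m]; first by rewrite mulr_ge0// exprn_ge0.
have main (k : 'I_p.+1) : `|h_pl (2 * theta) (p%:Z - k%:Z) *
     (h_pl (- (2 * theta)) (k%:Z + 1 + m%:Z) + (-1) ^+ c * (0 < k + c)%N%:R *
     h_pl (- (2 * theta)) (m%:Z + 1 - (c : nat)%:Z *+ 2 - k%:Z))| <=
     K ^+ 2 * 5 * 4^-1 ^+ p * 4 ^+ m.
  have kp : (k <= p)%N by rewrite -ltnS.
  rewrite subzn// normrM.
  apply: (@le_trans _ _ (K * 4^-1 ^+ (p - k) * (K * 4^-1 ^+ k + K * 4^-1 ^+ k * 4 ^+ m.+1))).
    apply: ler_pM => //; first exact: hK.
    apply: le_trans (ler_normD _ _) _; apply: lerD.
      have -> : (k%:Z + 1 + m%:Z) = (k + m.+1)%N by lia.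
      apply: le_trans (hK _ _ (normrN _)) _; apply: ler_wpM2l => //.
      rewrite exprD ler_piMr ?exprn_ge0// exprn_ile1 ?invr_ge0 ?invf_le1// ler1n //.
    rewrite !normrM normrX normrN1 expr1n mul1r normr_nat.
    have [km|km] := leqP (k + c * 2) m.+1; last first.
      rewrite [h_pl _ _]h_pl_neg; last by lia.
      by rewrite normr0 mulr0 !mulr_ge0// exprn_ge0.
    have -> : (m%:Z + 1 - (c : nat)%:Z *+ 2 - k%:Z) = (m.+1 - (k + c * 2))%N by lia.
    apply: (@le_trans _ _ K).
      rewrite -[leRHS]mul1r; apply: ler_pM => //; first by rewrite lern1 leq_b1.
      apply: le_trans (hK _ _ (normrN _)) _; rewrite ler_piMr//.
      by rewrite exprn_ile1 ?invr_ge0 ?invf_le1// ler1n.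
    rewrite -mulrA ler_peMr//.
    have -> : m.+1 = (k + (m.+1 - k))%N by lia.
    rewrite [4 ^+ _]exprD mulrA -exprMn mulVf ?pnatr_eq0// expr1n mul1r.
    by rewrite exprn_ege1// ler1n.
  have -> : K * 4^-1 ^+ (p - k) * (K * 4^-1 ^+ k + K * 4^-1 ^+ k * 4 ^+ m.+1) =
      K ^+ 2 * 4^-1 ^+ p * (1 + 4 ^+ m.+1).
    have -> : 4^-1 ^+ p = 4^-1 ^+ (p - k) * 4^-1 ^+ k :> R by rewrite -exprD subnK.
    by ring.
  have -> : K ^+ 2 * 5 * 4^-1 ^+ p * 4 ^+ m = K ^+ 2 * 4^-1 ^+ p * (5 * 4 ^+ m) by ring.
  apply: ler_wpM2l; first by rewrite mulr_ge0// exprn_ge0// invr_ge0.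
  have : (1 : R) <= 4 ^+ m by rewrite exprn_ege1// ler1n.
  by rewrite exprS; lra.
apply: le_trans (ler_norm_sum _ _ _) _.
apply: le_trans (ler_sum _ (fun k _ => main k)) _.
rewrite sumr_const card_ord -[leLHS]mulr_natl.
have -> : p.+1%:R * (K ^+ 2 * 5 * 4^-1 ^+ p * 4 ^+ m) =
  K ^+ 2 * 5 * (p.+1%:R * 4^-1 ^+ p) * 4 ^+ m by ring.
apply: ler_wpM2r; first exact: exprn_ge0.
by apply: ler_wpM2l; [rewrite mulr_ge0// exprn_ge0|exact: half_pow_le].
Qed.

(** Radius 32 loses a factor 2 per degree to [poly_norm] and leaves 16, enough to beat the growth
    [4 ^+ m] of [foldP_bound]. *)
Lemma convQX_bound : exists2 C : R, 0 <= C & forall m q,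
  poly_norm (convQX m q) <= C * 2^-1 ^+ q * 16^-1 ^+ m.
Proof.
pose K := expR (`|theta| * 32) : R.
have K0 : 0 <= K by apply: expR_ge0.
have hK s (k : nat) : `|s| = `|theta| -> poly_norm (hX s k) <= K * 16^-1 ^+ k.
  move=> sE; rewrite /hX poly_norm_monomial /=.
  have -> : (16^-1 : R) = 32^-1 * 2 by field.
  rewrite exprMn mulrA; apply: ler_wpM2r; first exact: exprn_ge0.
  by rewrite /K -sE; apply: h_pl_le.
exists (K ^+ 2) => [|m q]; first exact: exprn_ge0.
have main (k : 'I_q.+1) : poly_norm (hX (- theta) (k%:Z + 1 + m%:Z) * hX theta (q%:Z - k%:Z))
     <= K ^+ 2 * 4^-1 ^+ q * 16^-1 ^+ m.
  have kp : (k <= q)%N by rewrite -ltnS.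
  rewrite subzn//; apply: le_trans (poly_normM _ _) _.
  have -> : (k%:Z + 1 + m%:Z) = (k + m.+1)%N by lia.
  apply: (@le_trans _ _ (K * 16^-1 ^+ (k + m.+1) * (K * 16^-1 ^+ (q - k)))).
    by apply: ler_pM; rewrite ?poly_norm_ge0//; apply: hK; rewrite ?normrN.
  have -> : K * 16^-1 ^+ (k + m.+1) * (K * 16^-1 ^+ (q - k)) =
    K ^+ 2 * 16^-1 ^+ q * 16^-1 ^+ m * 16^-1.
    have -> : 16^-1 ^+ q = 16^-1 ^+ (q - k) * 16^-1 ^+ k :> R by rewrite -exprD subnK.
    by rewrite exprD exprS; ring.
  apply: (@le_trans _ _ (K ^+ 2 * 16^-1 ^+ q * 16^-1 ^+ m)).
    rewrite ler_piMr//; last by rewrite invf_le1// ler1n.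
    by rewrite !mulr_ge0// exprn_ge0.
  apply: ler_wpM2r; first by rewrite exprn_ge0.
  apply: ler_wpM2l; first by rewrite exprn_ge0.
  by apply: lerXn2r; rewrite ?nnegrE// lef_pV2 ?posrE// ler_nat.
apply: le_trans (norm_sum_le (poly_norm0 R) (@poly_normD R) _ _ _) _.
apply: le_trans (ler_sum _ (fun k _ => main k)) _.
rewrite sumr_const card_ord -[leLHS]mulr_natl.
have -> : q.+1%:R * (K ^+ 2 * 4^-1 ^+ q * 16^-1 ^+ m) =
  K ^+ 2 * (q.+1%:R * 4^-1 ^+ q) * 16^-1 ^+ m by ring.
apply: ler_wpM2r; first by rewrite exprn_ge0.
by apply: ler_wpM2l; [rewrite exprn_ge0|exact: half_pow_le].
Qed.

Lemma foldP_convQX_bound : exists2 C : R, 0 <= C & forall p m q,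
  `|foldP p m| * poly_norm (convQX m q) <= C * 2^-1 ^+ p * 2^-1 ^+ q * 2^-1 ^+ m.
Proof.
have [C1 C10 H1] := foldP_bound; have [C2 C20 H2] := convQX_bound.
exists (C1 * C2) => [|p m q]; first by rewrite mulr_ge0.
apply: (@le_trans _ _ (C1 * 2^-1 ^+ p * 4 ^+ m * (C2 * 2^-1 ^+ q * 16^-1 ^+ m))).
  by apply: ler_pM; rewrite ?poly_norm_ge0.
have -> : C1 * 2^-1 ^+ p * 4 ^+ m * (C2 * 2^-1 ^+ q * 16^-1 ^+ m) =
  C1 * C2 * 2^-1 ^+ p * 2^-1 ^+ q * (4 * 16^-1) ^+ m by rewrite exprMn; ring.
apply: ler_wpM2l; first by rewrite !mulr_ge0// exprn_ge0.
by apply: lerXn2r; rewrite ?nnegrE ?mulr_ge0//; lra.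
Qed.

Lemma foldP_convQ_bound : exists2 C : R, 0 <= C & forall p m q,
  `|foldP p m * convQ m q| <= C * 2^-1 ^+ p * 2^-1 ^+ q * 2^-1 ^+ m.
Proof.
have [C C0 H] := foldP_convQX_bound; exists C => // p m q.
apply: le_trans (H p m q); rewrite normrM; apply: ler_wpM2l => //.
by rewrite -convQX1 horner1_le_poly_norm.
Qed.

Lemma half_geo_le n : \sum_(m < n) (2^-1 : R) ^+ m <= 2.
Proof.
have -> : \sum_(m < n) (2^-1 : R) ^+ m = 2 - 2 * 2^-1 ^+ n.
  elim: n => [|n IH]; first by rewrite big_ord0 expr0; lra.
  by rewrite big_ord_recr /= IH exprS; lra.
by rewrite gerBl mulr_ge0// exprn_ge0.
Qed.

Lemma prod_half_le (C : R) n : 0 <= C ->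
  \prod_(i < n) (1 + C * 2^-1 ^+ i) <= expR (C * 2).
Proof.
move=> C0; apply: (@le_trans _ _ (\prod_(i < n) expR (C * 2^-1 ^+ i))).
  apply: ler_prod => i _; rewrite expR_ge1Dx andbT.
  by rewrite addr_ge0// mulr_ge0// exprn_ge0.
rewrite -expR_sum ler_expR -mulr_sumr.
by apply: ler_wpM2l => //; exact: half_geo_le.
Qed.

(** Only the Schur factor carries the variable; the folded factor enters through constant
    polynomials. *)
Definition section_poly n L : {poly R} :=
  \det (\matrix_(p < L, q < L) ((p == q)%:R + \sum_(m < n) (foldP p m)%:P * convQX m q)).

Lemma section_poly1 n L : (section_poly n L).[1] =
  \det (\matrix_(p < L, q < L) ((p == q)%:R + section_entry n p q)).
Proof.
rewrite -horner_evalE /section_poly -det_map_mx; congr determinant.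
apply/matrixP => p q; rewrite !mxE /= ?horner_evalE hornerD horner_sum; congr (_ + _).
  by case: eqP; rewrite ?hornerC.
by apply: eq_bigr => m _; rewrite hornerM hornerC convQX1.
Qed.

Lemma section_polyE n L : section_poly n L =
  \sum_(f : {ffun 'I_n -> 'I_(n + L)} | increasing f)
     weight c theta (part_of f) *: 'X^(sumn (part_of f)).
Proof.
have aU s : unit_series (fun k => (h_pl s k)%:P : {poly R}).
  by split=> [k k0|]; [rewrite h_pl_neg|rewrite h_pl0].
have aI : inverse_series (fun k => (h_pl (2 * theta) k)%:P : {poly R})
    (fun k => (h_pl (- (2 * theta)) k)%:P).
  move=> n'; transitivity ((n' == 0%N)%:R%:P : {poly R}); last by rewrite rmorph_nat.
  rewrite -(h_pl_inverse (2 * theta)) rmorph_sum; apply: eq_bigr => i _ /=.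
  by rewrite -polyCM.
have := folded_Cauchy c (aU _) (aU _) (hX_unit theta) (hX_unit (- theta)) aI
  (hX_inverse theta) n L.
under eq_bigr => f fI.
  rewrite (det_rowsA _ fI) (det_foldB c _ fI) jacobi_trudi_hX ?size_part_of//.
  have -> : jacobi_trudi (folded_entry c (fun k => (h_pl (2 * theta) k)%:P)) (part_of f) n =
      (jacobi_trudi (folded_entry c (h_pl (2 * theta))) (part_of f) n)%:P.
    rewrite /jacobi_trudi -(det_map_mx polyC); congr determinant; apply/matrixP => i j.
    by rewrite !mxE /= /folded_entry !(polyCM, polyCB, polyC_exp, polyCN, polyC_natr).
  rewrite -scalerAl [_ * _%:P]mulrC mul_polyC scalerA mulrC -weightE ?size_part_of//.
  over.
move=> ->; congr determinant; apply/matrixP => p q; rewrite !mxE; congr (_ + _).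
by apply: eq_bigr => m _; rewrite lower_fold_polyC.
Qed.

(** The norms of row [p] add up to at most 1 + 4 C 2^-p, and the product of these bounds stays
    bounded for all [n] and [L]. *)
Lemma section_poly_norm : exists M : R, forall n L, poly_norm (section_poly n L) <= M.
Proof.
have [C C0 H] := foldP_convQX_bound.
exists (expR (C * 4 * 2)) => n L.
apply: le_trans (norm_det_le (poly_norm0 R) (@poly_norm_ge0 R) (@poly_normD R)
  (@poly_normM R) _ (@poly_normN R) _) _; first by rewrite poly_norm1.
apply: le_trans (prod_half_le L _); last by rewrite mulr_ge0.
apply: ler_prod => p _; apply/andP; split.
  by rewrite sumr_ge0// => q _; rewrite poly_norm_ge0.
apply: (@le_trans _ _ (\sum_(q < L) ((p == q)%:R + C * 2 * 2^-1 ^+ p * 2^-1 ^+ q))).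
  apply: ler_sum => q _; rewrite mxE; apply: le_trans (poly_normD _ _) _.
  apply: lerD; first by case: eqP; rewrite ?poly_norm0 ?poly_norm1.
  apply: le_trans (norm_sum_le (poly_norm0 R) (@poly_normD R) _ _ _) _.
  apply: (@le_trans _ _ (\sum_(m < n) C * 2^-1 ^+ p * 2^-1 ^+ q * 2^-1 ^+ m)).
    apply: ler_sum => m _; apply: le_trans (poly_normM _ _) _.
    by rewrite poly_normC H.
  rewrite -mulr_sumr.
  have -> : C * 2 * 2^-1 ^+ p * 2^-1 ^+ q = C * 2^-1 ^+ p * 2^-1 ^+ q * 2 :> R by ring.
  by apply: ler_wpM2l; [rewrite !mulr_ge0// exprn_ge0|exact: half_geo_le].
rewrite big_split /= (bigD1 p)//= eqxx big1 ?addr0 => [|q qp]; last first.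
  by rewrite eq_sym (negbTE qp).
rewrite lerD2l -mulr_sumr.
have -> : C * 4 * 2^-1 ^+ p = C * 2 * 2^-1 ^+ p * 2 :> R by ring.
by apply: ler_wpM2l; [rewrite !mulr_ge0// exprn_ge0|exact: half_geo_le].
Qed.

Lemma sum_partitions_box n L N : (N <= n)%N ->
  \sum_(m < N) sum_partitions_of m
    (fun lam => if (part1 lam <= L)%N then weight c theta lam else 0) =
  \sum_(m < N) (section_poly n L)`_m.
Proof.
move=> Nn; apply: eq_bigr => m _.
have mn : (m <= n)%N by apply: ltnW; apply: leq_trans Nn.
rewrite (sum_partitions_of_box _ _ mn) section_polyE coef_sum big_mkcondr /=.
by apply: eq_bigr => f _; rewrite coefZ coefXn eq_sym; case: eqP; rewrite ?mulr1 ?mulr0.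
Qed.

(** The determinant is the value at 1 of [section_poly] and sums over the whole box, the other sum
    only over sizes below [N]. The norm bound makes the discrepancy geometric in [N], whatever the
    box. *)
Lemma sum_partitions_approx : exists M : R, forall n L N, (N <= n)%N ->
  `|\sum_(m < N) sum_partitions_of m
      (fun lam => if (part1 lam <= L)%N then weight c theta lam else 0) -
    \det (\matrix_(p < L, q < L) ((p == q)%:R + section_entry n p q))| <= M / 2 ^+ N.
Proof.
have [M HM] := section_poly_norm; exists M => n L N Nn.
rewrite (sum_partitions_box _ Nn) -section_poly1.
apply: le_trans (poly_tail _ _) _; apply: ler_wpM2r; last exact: HM.
by rewrite invr_ge0 exprn_ge0.
Qed.
End section_bounds.

(** * Absolutely summable families *)

Section unordered_sums.
Variable R : realType.

Section one_type.
Variable T : choiceType.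
Implicit Types (f g u v : T -> R).

Definition esr u : \bar R := (\esum_(i in [set: T]) (u i)%:E)%E.
Definition abs_summable f := (esr (fun i => `|f i|) < +oo%E)%O.
(** Meaningful for absolutely summable families only: [fine] sends an infinite sum to 0. *)
Definition tsum f : R :=
  fine (esr (fun i => Num.max (f i) 0)) - fine (esr (fun i => Num.max (- f i) 0)).

Lemma esr_ge0 u : (forall i, 0 <= u i) -> (0 <= esr u)%E.
Proof. by move=> u0; apply: esum_ge0 => i _; rewrite lee_fin. Qed.

Lemma le_esr u v : (forall i, u i <= v i) -> (esr u <= esr v)%E.
Proof. by move=> uv; apply: le_esum => i _; rewrite lee_fin. Qed.

Lemma esr_fin u : (forall i, 0 <= u i) -> (esr u < +oo)%E -> (esr u \is a fin_num)%E.
Proof. by move=> u0 uy; rewrite ge0_fin_numE// esr_ge0. Qed.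

Lemma esrD u v : (forall i, 0 <= u i) -> (forall i, 0 <= v i) ->
  esr (fun i => u i + v i) = (esr u + esr v)%E.
Proof.
by move=> u0 v0; rewrite /esr -esumD// => i _; rewrite lee_fin.
Qed.

Lemma eq_esr u v : u =1 v -> esr u = esr v.
Proof. by move=> uv; apply: eq_esum => i _; rewrite uv. Qed.

Lemma esr0 : esr (fun _ => 0) = 0%E.
Proof. by rewrite /esr esum1. Qed.

Lemma abs_summable_le f g : (forall i, `|f i| <= g i) -> abs_summable g -> abs_summable f.
Proof.
move=> fg; apply: le_lt_trans; apply: le_esr => i.
by rewrite (le_trans (fg i))// ler_norm.
Qed.

Lemma abs_summable0 : abs_summable (fun _ => 0).
Proof. by rewrite /abs_summable (eq_esr (v := fun=> 0)) ?esr0// => i; rewrite normr0. Qed.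

Lemma abs_summable_pos f : abs_summable f -> (esr (fun i => Num.max (f i) 0) < +oo%E)%O.
Proof.
apply: le_lt_trans; apply: le_esr => i.
by rewrite ge_max ler_norm normr_ge0.
Qed.

Lemma abs_summableN f : abs_summable f -> abs_summable (fun i => - f i).
Proof. by apply: le_lt_trans; apply: le_esr => i; rewrite normrN. Qed.

Lemma abs_summable_norm f : abs_summable f -> abs_summable (fun i => `|f i|).
Proof. by apply: le_lt_trans; apply: le_esr => i; rewrite normr_id. Qed.

Lemma abs_summableD f g : abs_summable f -> abs_summable g ->
  abs_summable (fun i => f i + g i).
Proof.
move=> sf sg; apply: (@le_lt_trans _ _ (esr (fun i => `|f i| + `|g i|))).
  by apply: le_esr => i; apply: ler_normD.
by rewrite esrD// lte_add_pinfty.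
Qed.

(** Any splitting into nonnegative summable parts gives the same value, since max (u - v) 0 + v =
    max (v - u) 0 + u. Additivity and scaling are derived from this. *)
Lemma tsum_diff u v : (forall i, 0 <= u i) -> (forall i, 0 <= v i) ->
  (esr u < +oo)%E -> (esr v < +oo)%E ->
  tsum (fun i => u i - v i) = fine (esr u) - fine (esr v).
Proof.
move=> u0 v0 uy vy; rewrite /tsum.
set p := esr (fun i => Num.max (u i - v i) 0).
set n := esr (fun i => Num.max (- (u i - v i)) 0).
have pf : p \is a fin_num.
  apply: esr_fin => [i|]; first by rewrite le_max lexx orbT.
  by apply: le_lt_trans uy; apply: le_esr => i; rewrite ge_max u0 gerBl v0.
have nf : n \is a fin_num.
  apply: esr_fin => [i|]; first by rewrite le_max lexx orbT.
  by apply: le_lt_trans vy; apply: le_esr => i; rewrite ge_max v0 opprB gerBl u0.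
have uf := esr_fin u0 uy; have vf := esr_fin v0 vy.
have : (p + esr v = n + esr u)%E.
  rewrite -!esrD//; first last.
  - by move=> i; rewrite le_max lexx orbT.
  - by move=> i; rewrite le_max lexx orbT.
  apply: eq_esr => i; rewrite opprB.
  by case: (lerP (u i - v i) 0) => H1; case: (lerP (v i - u i) 0) => H2; lra.
move/(congr1 fine); rewrite !fineD//; lra.
Qed.

Lemma tsum_ge0E f : (forall i, 0 <= f i) -> abs_summable f -> tsum f = fine (esr f).
Proof.
move=> f0 sf.
have fy : (esr f < +oo)%E by apply: le_lt_trans sf; apply: le_esr => i; apply: ler_norm.
rewrite -[RHS]subr0 -[X in _ - X]/(fine 0%E) -esr0 -tsum_diff// ?esr0//.
by congr tsum; apply/funext => i; rewrite subr0.
Qed.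

Lemma tsum_ge0 f : (forall i, 0 <= f i) -> abs_summable f -> 0 <= tsum f.
Proof. by move=> f0 sf; rewrite tsum_ge0E// fine_ge0// esr_ge0. Qed.

Lemma max0_sub_max0N (x : R) : Num.max x 0 - Num.max (- x) 0 = x.
Proof. by case: (lerP x 0) => H1; case: (lerP (- x) 0) => H2; lra. Qed.

Lemma max0_ge0 (x : R) : 0 <= Num.max x 0.
Proof. by rewrite le_max lexx orbT. Qed.

Lemma tsumD f g : abs_summable f -> abs_summable g ->
  tsum (fun i => f i + g i) = tsum f + tsum g.
Proof.
move=> sf sg; rewrite {2 3}/tsum.
have sfp := abs_summable_pos sf; have sfn := abs_summable_pos (abs_summableN sf).
have sgp := abs_summable_pos sg; have sgn := abs_summable_pos (abs_summableN sg).
have -> : (fun i => f i + g i) = (fun i => (Num.max (f i) 0 + Num.max (g i) 0) -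
   (Num.max (- f i) 0 + Num.max (- g i) 0)).
  by apply/funext => i; rewrite -{1}(max0_sub_max0N (f i)) -{1}(max0_sub_max0N (g i)); ring.
have p0 (h : T -> R) i : 0 <= Num.max (h i) 0 by apply: max0_ge0.
have n0 (h : T -> R) i : 0 <= Num.max (- h i) 0 by apply: max0_ge0.
rewrite tsum_diff ?esrD ?lte_add_pinfty//; try by move=> i; rewrite addr_ge0.
rewrite !fineD ?esr_fin//; ring.
Qed.

Lemma tsumN f : tsum (fun i => - f i) = - tsum f.
Proof. by rewrite /tsum opprB; congr (_ - fine (esr _)); apply/funext => i; rewrite opprK. Qed.

Lemma tsumB f g : abs_summable f -> abs_summable g ->
  tsum (fun i => f i - g i) = tsum f - tsum g.
Proof. by move=> sf sg; rewrite tsumD ?tsumN//; exact: abs_summableN. Qed.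

Lemma tsum0 : tsum (fun _ => 0) = 0.
Proof. by rewrite tsum_ge0E ?esr0//; exact: abs_summable0. Qed.

Lemma le_tsum f g : abs_summable f -> abs_summable g -> (forall i, f i <= g i) ->
  tsum f <= tsum g.
Proof.
move=> sf sg fg; rewrite -subr_ge0 -tsumB//; apply: tsum_ge0 => [i|].
  by rewrite subr_ge0.
by apply: abs_summableD => //; apply: abs_summableN.
Qed.

Lemma tsum_norm_le f g : (forall i, `|f i| <= g i) -> abs_summable g -> `|tsum f| <= tsum g.
Proof.
move=> fg sg; have sf := abs_summable_le fg sg.
rewrite ler_norml -tsumN; apply/andP; split; apply: le_tsum => //.
- exact: abs_summableN.
- by move=> i; have := fg i; rewrite ler_norml => /andP[].
- by move=> i; have := fg i; rewrite ler_norml => /andP[].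
Qed.

Lemma esrZ (a : R) u : 0 <= a -> (forall i, 0 <= u i) -> (esr u < +oo)%E ->
  (esr (fun i => (a * u i)%R) <= a%:E * esr u)%E.
Proof.
move=> a0 u0 uy; apply: ge_ereal_sup => _ [X [finX _] <-].
under eq_fsbigr do rewrite EFinM.
rewrite -ge0_mule_fsumr; last by move=> i; rewrite lee_fin.
apply: lee_wpmul2l; first by rewrite lee_fin.
by apply: ereal_sup_ubound; exists X.
Qed.

Lemma abs_summableZ (a : R) f : abs_summable f -> abs_summable (fun i => a * f i).
Proof.
move=> sf; rewrite /abs_summable.
rewrite (eq_esr (v := fun i => `|a| * `|f i|)); last by move=> i; rewrite normrM.
apply: le_lt_trans (esrZ _ _ _) _ => //.
have := esr_fin (fun i => normr_ge0 (f i)) sf.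
by case: (esr _) => // r _; rewrite -EFinM ltry.
Qed.

(** For a positive factor the inequality of [esrZ], applied to [b] and to its inverse, already gives
    equality; signs are treated afterwards. *)
Lemma tsumZ (a : R) f : abs_summable f -> tsum (fun i => a * f i) = a * tsum f.
Proof.
have ge0case b h : 0 <= b -> (forall i, 0 <= h i) -> abs_summable h ->
    tsum (fun i => b * h i) <= b * tsum h.
  move=> b0 h0 sh; rewrite !tsum_ge0E//; last 2 first.
    by move=> i; rewrite mulr_ge0.
    exact: abs_summableZ.
  have hy : (esr h < +oo)%E by apply: le_lt_trans sh; apply: le_esr => i; apply: ler_norm.
  rewrite -lee_fin EFinM !fineK ?esr_fin//; first exact: esrZ.
    by move=> i; rewrite mulr_ge0.
  apply: le_lt_trans (abs_summableZ b sh); apply: le_esr => i; exact: ler_norm.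
have gt0case b h : 0 < b -> (forall i, 0 <= h i) -> abs_summable h ->
    tsum (fun i => b * h i) = b * tsum h.
  move=> b0 h0 sh; apply/eqP; rewrite eq_le ge0case ?(ltW b0)//=.
  have := ge0case b^-1 (fun i => b * h i).
  have -> : (fun i => b^-1 * (b * h i)) = h.
    by apply/funext => i; rewrite mulrA mulVf ?mul1r// gt_eqF.
  rewrite ler_pdivlMl// => -> //; last exact: abs_summableZ.
  - by rewrite invr_ge0 ltW.
  - by move=> i; rewrite mulr_ge0// ltW.
have gt0case' b h : 0 < b -> abs_summable h -> tsum (fun i => b * h i) = b * tsum h.
  move=> b0 sh.
  have sp : abs_summable (fun i => Num.max (h i) 0).
    apply: abs_summable_le (abs_summable_norm sh) => i.
    by rewrite ger0_norm ?max0_ge0// ge_max ler_norm normr_ge0.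
  have sn : abs_summable (fun i => Num.max (- h i) 0).
    apply: abs_summable_le (abs_summable_norm sh) => i.
    by rewrite ger0_norm ?max0_ge0// ge_max -normrN ler_norm normr_ge0.
  have hE : h = (fun i => Num.max (h i) 0 - Num.max (- h i) 0).
    by apply/funext => i; rewrite max0_sub_max0N.
  rewrite [in RHS]hE tsumB// mulrBr -!gt0case//; try by move=> i; exact: max0_ge0.
  rewrite -tsumB ?abs_summableZ//; congr tsum; apply/funext => i.
  by rewrite -mulrBr max0_sub_max0N.
move=> sf; have [a0|a0|a0] := ltgtP a 0.
- rewrite -[RHS]opprK -mulNr -gt0case' ?oppr_gt0// -tsumN; congr tsum.
  by apply/funext => i; rewrite mulNr opprK.
- exact: gt0case'.
- rewrite a0 mul0r -[RHS]tsum0; congr tsum; apply/funext => i; exact: mul0r.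
Qed.

Lemma tsum_seq (s : seq T) f : uniq s -> (forall i, i \notin s -> f i = 0) ->
  abs_summable f /\ tsum f = \sum_(i <- s) f i.
Proof.
move=> us fs.
have E u : (forall i, 0 <= u i) -> (forall i, i \notin s -> u i = 0) ->
    esr u = (\sum_(i <- s) u i)%:E.
  move=> u0 us0.
  transitivity (\esum_(i in [set` s]) (u i)%:E)%E.
    rewrite [RHS]esum_mkcond; apply: eq_esum => i _; case: ifPn => // H.
    by rewrite us0//; apply: contra H => H; rewrite inE.
  rewrite esum_fset//; last by move=> i _; rewrite lee_fin.
  by rewrite -fsbig_seq// sumEFin.
split.
  rewrite /abs_summable E ?ltry// => i /fs ->; exact: normr0.
rewrite /tsum !E /=; try (by move=> i; exact: max0_ge0);
  try by move=> i /fs ->; rewrite ?oppr0 maxxx.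
by rewrite -sumrB; apply: eq_bigr => i _; rewrite max0_sub_max0N.
Qed.

Lemma abs_summable_bounded f : abs_summable f -> exists B, forall i, `|f i| <= B.
Proof.
move=> sf; exists (fine (esr (fun i => `|f i|))) => i.
rewrite -lee_fin fineK; last exact: esr_fin.
apply: esum_ge; exists [set i]; first by split.
by rewrite fsbig_set1.
Qed.

End one_type.

Lemma esr_reindex (T T' : choiceType) (e : T -> T') (u : T' -> R) : bijective e ->
  esr (fun i => u (e i)) = esr u.
Proof.
move=> eb; rewrite /esr [RHS](@reindex_esum _ _ _ setT setT e)//.
by rewrite setTT_bijective.
Qed.

Lemma tsum_reindex (T T' : choiceType) (e : T -> T') (f : T' -> R) : bijective e ->
  tsum (fun i => f (e i)) = tsum f.
Proof.
move=> eb; rewrite /tsum (esr_reindex (fun i => Num.max (f i) 0) eb).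
by rewrite (esr_reindex (fun i => Num.max (- f i) 0) eb).
Qed.

Lemma abs_summable_reindex (T T' : choiceType) (e : T -> T') (f : T' -> R) : bijective e ->
  abs_summable f -> abs_summable (fun i => f (e i)).
Proof. by move=> eb; rewrite /abs_summable (esr_reindex (fun i => `|f i|) eb). Qed.

Section Fubini.
Variables T1 T2 : choiceType.
Implicit Types F : T1 -> T2 -> R.

Definition abs_summable2 F :=
  (\esum_(i in [set: T1]) \esum_(j in [set: T2]) (`|F i j|%R)%:E < +oo)%E.

Lemma esum_swap (F : T1 -> T2 -> \bar R) : (forall i j, 0 <= F i j)%E ->
  (\esum_(i in [set: T1]) \esum_(j in [set: T2]) F i j =
   \esum_(j in [set: T2]) \esum_(i in [set: T1]) F i j)%E.
Proof.
move=> F0; rewrite !esum_esum//.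
rewrite [RHS](@reindex_esum _ _ _ (setT `*`` (fun=> setT)) (setT `*`` (fun=> setT))
  (fun p : T1 * T2 => (p.2, p.1)))//.
split=> //.
- by move=> [a b] [c d] _ _ [-> ->].
- by move=> [a b] _; exists (b, a).
Qed.

Lemma abs_summable2_row F i : abs_summable2 F -> abs_summable (F i).
Proof.
apply: le_lt_trans; apply: esum_ge; exists [set i]; first by split.
by rewrite fsbig_set1.
Qed.

Lemma abs_summable2P F (g : T1 -> R) : (forall i, abs_summable (F i)) ->
  (forall i, tsum (fun j => `|F i j|) <= g i) -> abs_summable g -> abs_summable2 F.
Proof.
move=> sF Fg; apply: le_lt_trans; apply: le_esum => i _.
have H := abs_summable_norm (sF i).
have -> : (\esum_(j in [set: T2]) (`|F i j|%R)%:E)%E = (tsum (fun j => `|F i j|))%:E.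
  by rewrite tsum_ge0E// fineK//; apply: esr_fin => //; exact: sF.
by rewrite lee_fin (le_trans (Fg i))// ler_norm.
Qed.

Lemma abs_summable2_tsum_norm F : abs_summable2 F ->
  abs_summable (fun i => tsum (fun j => `|F i j|)).
Proof.
move=> sF; apply: (le_lt_trans _ (sF)); apply: le_esum => i _.
have sFi := abs_summable2_row i sF; have H := abs_summable_norm sFi.
by rewrite ger0_norm ?tsum_ge0// tsum_ge0E// fineK//; apply: esr_fin.
Qed.

Lemma abs_summable2_tsum F : abs_summable2 F -> abs_summable (fun i => tsum (F i)).
Proof.
move=> sF; apply: abs_summable_le (abs_summable2_tsum_norm sF) => i.
by apply: tsum_norm_le => //; apply: abs_summable_norm; exact: abs_summable2_row.
Qed.

Lemma abs_summable2_le F G : (forall i j, `|F i j| <= `|G i j|) ->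
  abs_summable2 G -> abs_summable2 F.
Proof.
move=> FG; apply: le_lt_trans; apply: le_esum => i _; apply: le_esum => j _.
by rewrite lee_fin.
Qed.
End Fubini.

Lemma abs_summable2_swap (T1 T2 : choiceType) (F : T1 -> T2 -> R) :
  abs_summable2 F -> abs_summable2 (fun j i => F i j).
Proof. by rewrite /abs_summable2 esum_swap. Qed.

Lemma tsum_swap (T1 T2 : choiceType) (F : T1 -> T2 -> R) : abs_summable2 F ->
  tsum (fun i => tsum (fun j => F i j)) = tsum (fun j => tsum (fun i => F i j)).
Proof.
move=> sF.
have ge0case (G : T1 -> T2 -> R) : (forall i j, 0 <= G i j) -> abs_summable2 G ->
    tsum (fun i => tsum (fun j => G i j)) = tsum (fun j => tsum (fun i => G i j)).
  move=> G0 sG; have sG' := abs_summable2_swap sG.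
  have rowE i := abs_summable2_row i sG; have colE j := abs_summable2_row j sG'.
  rewrite !tsum_ge0E; [|by move=> j; rewrite tsum_ge0|exact: abs_summable2_tsum
   |by move=> j; rewrite tsum_ge0|exact: abs_summable2_tsum].
  congr fine; rewrite /esr.
  have finG (T T' : choiceType) (H : T -> T' -> R) : (forall i j, 0 <= H i j) ->
      (forall i, abs_summable (H i)) ->
      (\esum_(i in [set: T]) (tsum (fun j => H i j))%:E =
       \esum_(i in [set: T]) \esum_(j in [set: T']) (H i j)%:E)%E.
    move=> H0 sH; apply: eq_esum => i _; rewrite tsum_ge0E// fineK// esr_fin//.
    by apply: le_lt_trans (sH i); apply: le_esr => j; exact: ler_norm.
  rewrite finG// finG//; apply: esum_swap => i j; by rewrite lee_fin.
pose P i j := Num.max (F i j) 0; pose N i j := Num.max (- F i j) 0.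
have P0 i j : 0 <= P i j by apply: max0_ge0.
have N0 i j : 0 <= N i j by apply: max0_ge0.
have sP : abs_summable2 P.
  apply: abs_summable2_le sF => i j.
  by rewrite ger0_norm// ge_max ler_norm normr_ge0.
have sN : abs_summable2 N.
  apply: abs_summable2_le sF => i j.
  by rewrite ger0_norm// ge_max -normrN ler_norm normr_ge0.
have FE i j : F i j = P i j - N i j by rewrite max0_sub_max0N.
have sP' := abs_summable2_swap sP; have sN' := abs_summable2_swap sN.
have -> : (fun i => tsum (fun j => F i j)) = (fun i => tsum (P i) - tsum (N i)).
  apply/funext => i; rewrite -tsumB; [|exact: abs_summable2_row|exact: abs_summable2_row].
  by congr tsum; apply/funext => j.
have -> : (fun j => tsum (fun i => F i j)) = (fun j => tsum (P^~ j) - tsum (N^~ j)).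
  apply/funext => j; rewrite -tsumB;
    [|exact: (abs_summable2_row j sP')|exact: (abs_summable2_row j sN')].
  by congr tsum; apply/funext => i.
rewrite (tsumB (abs_summable2_tsum sP) (abs_summable2_tsum sN)).
rewrite (tsumB (abs_summable2_tsum sP') (abs_summable2_tsum sN')).
by congr (_ - _); [exact: (ge0case P)|exact: (ge0case N)].
Qed.

End unordered_sums.

Section nat_int_sums.
Variable R : realType.

Lemma abs_summable_nat (f : nat -> R) (M : R) :
  (forall N, \sum_(k < N) `|f k| <= M) -> abs_summable f.
Proof.
move=> H; rewrite /abs_summable /esr -nneseries_esumT; last first.
  by move=> n; rewrite lee_fin.
apply: (@le_lt_trans _ _ M%:E); last exact: ltry.
apply: lime_le; first by apply: is_cvg_nneseries => n _ _; rewrite lee_fin.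
by apply: nearW => n; rewrite big_mkord sumEFin lee_fin.
Qed.

Lemma abs_summable_half (C : R) : abs_summable (fun m => C * 2^-1 ^+ m).
Proof.
apply: abs_summableZ; apply: (@abs_summable_nat _ 2) => N.
rewrite (eq_bigr (fun m : 'I_N => 2^-1 ^+ m)); first exact: half_geo_le.
by move=> m _; rewrite ger0_norm// exprn_ge0.
Qed.

Lemma tsum_nat_ge0_le (f : nat -> R) (M : R) : (forall n, 0 <= f n) ->
  (forall N, \sum_(k < N) f k <= M) -> tsum f <= M.
Proof.
move=> f0 H; have sf : abs_summable f.
  by apply: (@abs_summable_nat _ M) => N; under eq_bigr do rewrite ger0_norm//.
rewrite tsum_ge0E// -lee_fin fineK; last first.
  by apply: esr_fin => //; apply: le_lt_trans sf; apply: le_esr => i; exact: ler_norm.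
rewrite /esr -nneseries_esumT; last by move=> n; rewrite lee_fin.
apply: lime_le; first by apply: is_cvg_nneseries => n _ _; rewrite lee_fin.
by apply: nearW => n; rewrite big_mkord sumEFin lee_fin.
Qed.

Lemma tsum_half_le (C : R) : 0 <= C -> tsum (fun m => C * 2^-1 ^+ m) <= C * 2.
Proof.
move=> C0; apply: tsum_nat_ge0_le => [n|N]; first by rewrite mulr_ge0// exprn_ge0.
by rewrite -mulr_sumr; apply: ler_wpM2l => //; exact: half_geo_le.
Qed.

Lemma abs_summable_half_bound (f : nat -> R) (C : R) :
  (forall m, `|f m| <= C * 2^-1 ^+ m) -> abs_summable f.
Proof. by move=> H; apply: abs_summable_le H (abs_summable_half C). Qed.

Lemma tsum_half_bound (f : nat -> R) (C : R) : 0 <= C ->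
  (forall m, `|f m| <= C * 2^-1 ^+ m) -> `|tsum f| <= C * 2.
Proof.
move=> C0 H; apply: le_trans (tsum_half_le C0).
exact: tsum_norm_le (abs_summable_half C).
Qed.

Lemma tsum_inj (T T' : choiceType) (e : T -> T') (f : T' -> R) : injective e ->
  (forall i, (forall x, e x <> i) -> f i = 0) ->
  abs_summable (fun x => f (e x)) -> abs_summable f /\ tsum f = tsum (fun x => f (e x)).
Proof.
move=> ei f0.
have E u : (forall i, (forall x, e x <> i) -> u i = 0) -> esr u = esr (fun x => u (e x)).
  move=> u0; rewrite /esr -(esum_image setT e (fun i => (u i)%:E)); last first.
    by move=> x y _ _; apply: ei.
  rewrite [RHS]esum_mkcond; apply: eq_esum => i _; case: ifPn => // H.
  rewrite u0// => x xi; move/negP: H; apply; rewrite inE; by exists x.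
rewrite /abs_summable /tsum => sf; rewrite !E//.
- by move=> i /f0 ->; rewrite oppr0 maxxx.
- by move=> i /f0 ->; rewrite maxxx.
- by move=> i /f0 ->; rewrite normr0.
Qed.

Lemma abs_summable_comp (T T' : choiceType) (e : T -> T') (f : T' -> R) : injective e ->
  abs_summable f -> abs_summable (fun x => f (e x)).
Proof.
move=> ei; apply: le_lt_trans.
rewrite /esr -(esum_image setT e (fun i => (`|f i|)%:E)); last by move=> x y _ _; apply: ei.
by rewrite esum_mkcond; apply: le_esum => i _; case: ifP => _ //; rewrite lee_fin.
Qed.

Lemma tsum_nat_tail (f : nat -> R) (C : R) n : 0 <= C ->
  (forall m, `|f m| <= C * 2^-1 ^+ m) ->
  `|tsum f - \sum_(m < n) f m| <= C * 2 * 2^-1 ^+ n.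
Proof.
move=> C0 H.
have sf := abs_summable_half_bound H.
pose f1 m := if (m < n)%N then f m else 0.
have [s1 t1] : abs_summable f1 /\ tsum f1 = \sum_(m <- iota 0 n) f1 m.
  apply: tsum_seq; first exact: iota_uniq.
  by move=> i; rewrite mem_iota /f1 add0n /= => /negbTE ->.
have -> : \sum_(m < n) f m = tsum f1.
  rewrite t1; have <- : index_iota 0 n = iota 0 n by rewrite /index_iota subn0.
  rewrite big_mkord.
  by apply: eq_bigr => i _; rewrite /f1 ltn_ord.
rewrite -tsumB//.
have [||s2 ->] := @tsum_inj nat nat (addn n) (fun i => f i - f1 i) (@addnI n).
- move=> i Hi; rewrite /f1; case: ltnP => ni; first by rewrite subrr.
  by case: (Hi (i - n)%N); rewrite subnKC.
- apply: (@abs_summable_half_bound _ (C * 2^-1 ^+ n)) => m.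
  by rewrite /f1 ltnNge leq_addr subr0 -mulrA -exprD.
apply: le_trans (@tsum_half_bound _ (C * 2^-1 ^+ n) _ _) _.
- by rewrite mulr_ge0// exprn_ge0.
- by move=> m; rewrite /f1 ltnNge leq_addr subr0 -mulrA -exprD.
- by rewrite mulrAC.
Qed.

Lemma tsum_sum (T : choiceType) n (F : 'I_n -> T -> R) : (forall k, abs_summable (F k)) ->
  abs_summable (fun i => \sum_(k < n) F k i) /\
  tsum (fun i => \sum_(k < n) F k i) = \sum_(k < n) tsum (F k).
Proof.
elim: n F => [|n IH] F sF.
  have -> : (fun i => \sum_(k < 0) F k i) = (fun _ : T => 0) by apply/funext => i; rewrite big_ord0.
  by rewrite big_ord0 tsum0; split=> //; exact: abs_summable0.
have -> : (fun i => \sum_(k < n.+1) F k i) =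
    (fun i => \sum_(k < n) F (widen_ord (leqnSn n) k) i + F ord_max i).
  by apply/funext => i; rewrite big_ord_recr.
have [s t] := IH (fun k => F (widen_ord (leqnSn n) k)) (fun k => sF _).
by rewrite tsumD// t big_ord_recr; split=> //; exact: abs_summableD.
Qed.

(** * Convolution of two-sided sequences *)

Section convolution.
Implicit Types f g h : int -> R.

Definition conv f g (n : int) : R := tsum (fun k : int => f (n - k) * g k).
Definition refl f (n : int) : R := f (- n).
Definition delta (j n : int) : R := (n == j)%:R.

Lemma subr_bij (n : int) : bijective (fun k : int => n - k).
Proof. by exists (fun k => n - k) => k; rewrite subKr. Qed.

Lemma shift_bij (n : int) : bijective (fun k : int => k + n).
Proof. by exists (fun k => k - n) => k; rewrite ?addrK ?subrK. Qed.

Lemma oppr_bij : bijective (fun k : int => - k).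
Proof. by exists (fun k => - k) => k; rewrite opprK. Qed.

Lemma abs_summable_refl f : abs_summable f -> abs_summable (refl f).
Proof. exact: (@abs_summable_reindex R _ _ (fun k : int => - k) f oppr_bij). Qed.

Lemma abs_summable_mul_bounded (T : choiceType) (f g : T -> R) B : (forall n, `|f n| <= B) -> abs_summable g ->
  abs_summable (fun k => f k * g k).
Proof.
move=> fB sg; apply: (@abs_summable_le _ _ _ (fun k => B * `|g k|)) => [k|].
  by rewrite normrM ler_wpM2r.
exact/abs_summableZ/abs_summable_norm.
Qed.

Lemma conv_summable2 f g : abs_summable f -> abs_summable g ->
  abs_summable2 (fun n k => f (n - k) * g k).
Proof.
move=> sf sg; apply: (@abs_summable2_swap _ _ _ (fun k n => f (n - k) * g k)).
apply: (@abs_summable2P _ _ _ _ (fun k => tsum (fun n => `|f n|) * `|g k|)).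
- move=> k; rewrite /=.
  have -> : (fun j => f (j - k) * g k) = (fun j => g k * f (j - k)).
    by apply/funext => j; rewrite mulrC.
  by apply: abs_summableZ; exact: (abs_summable_reindex (shift_bij (- k)) sf).
- move=> k; have -> : (fun j => `|f (j - k) * g k|) = (fun j => `|g k| * `|f (j - k)|).
    by apply/funext => j; rewrite normrM mulrC.
  have s1 := abs_summable_norm (abs_summable_reindex (shift_bij (- k)) sf).
  by rewrite tsumZ// mulrC (tsum_reindex (fun j => `|f j|) (shift_bij (- k))).
- exact/abs_summableZ/abs_summable_norm.
Qed.

Lemma conv_term_summable f g n : abs_summable f -> abs_summable g ->
  abs_summable (fun k => f (n - k) * g k).
Proof. by move=> sf sg; exact: (abs_summable2_row n (conv_summable2 sf sg)). Qed.

Lemma abs_summable_conv f g : abs_summable f -> abs_summable g -> abs_summable (conv f g).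
Proof. by move=> sf sg; exact: (abs_summable2_tsum (conv_summable2 sf sg)). Qed.

Lemma convC f g : conv f g = conv g f.
Proof.
apply/funext => n; rewrite /conv -(tsum_reindex _ (subr_bij n)).
by congr tsum; apply/funext => k; rewrite subKr mulrC.
Qed.

Lemma convA f g h : abs_summable f -> abs_summable g -> abs_summable h ->
  conv (conv f g) h = conv f (conv g h).
Proof.
move=> sf sg sh; apply/funext => n; rewrite /conv.
have [B HB] := abs_summable_bounded sf.
transitivity (tsum (fun k => tsum (fun m => f (n - m) * (g (m - k) * h k)))).
  congr tsum; apply/funext => k; rewrite mulrC -tsumZ; last exact: conv_term_summable.
  rewrite -(tsum_reindex _ (shift_bij (- k))); congr tsum; apply/funext => m.
  by rewrite opprB addrA subrK; ring.
rewrite -tsum_swap.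
  congr tsum; apply/funext => m; rewrite -tsumZ//; exact: conv_term_summable.
apply: (@abs_summable2P _ _ _ _ (fun m => B * tsum (fun k => `|g (m - k) * h k|))).
- by move=> m; apply: abs_summableZ; exact: conv_term_summable.
- move=> m; have s1 := abs_summable_norm (conv_term_summable m sg sh).
  have -> : (fun j => `|f (n - m) * (g (m - j) * h j)|) =
    (fun j => `|f (n - m)| * `|g (m - j) * h j|) by apply/funext => j; rewrite normrM.
  by rewrite tsumZ// ler_wpM2r ?tsum_ge0.
- by apply: abs_summableZ; exact: (abs_summable2_tsum_norm (conv_summable2 sg sh)).
Qed.

Lemma conv_delta f j n : conv f (delta j) n = f (n - j).
Proof.
rewrite /conv; have [|i|_ ->] := @tsum_seq R int [:: j] (fun k => f (n - k) * delta j k).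
- by [].
- by rewrite inE /delta => /negbTE ->; rewrite mulr0.
- by rewrite big_seq1 /delta eqxx mulr1.
Qed.

Lemma abs_summable_delta j : abs_summable (delta j).
Proof.
by have [|i|s _] := @tsum_seq R int [:: j] (delta j); rewrite ?inE /delta => // /negbTE ->.
Qed.

Lemma convDr f g h : abs_summable f -> abs_summable g -> abs_summable h ->
  conv f (fun k => g k + h k) = (fun n => conv f g n + conv f h n).
Proof.
move=> sf sg sh; apply/funext => n; rewrite /conv -tsumD; try exact: conv_term_summable.
by congr tsum; apply/funext => k; rewrite mulrDr.
Qed.

Lemma conv_refl f g n : conv (refl f) (refl g) n = conv f g (- n).
Proof.
rewrite /conv -(tsum_reindex _ oppr_bij); congr tsum; apply/funext => k.
by rewrite /refl opprK; congr (f _ * _); ring.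
Qed.

Lemma abs_summable_int_nat f : (forall k, k < 0 -> f k = 0) ->
  abs_summable (fun n : nat => f n%:Z) ->
  abs_summable f /\ tsum f = tsum (fun n : nat => f n%:Z).
Proof.
move=> f0; apply: tsum_inj => [m n []//|i Hi].
by apply: f0; case: i Hi => // n /(_ n).
Qed.
End convolution.

Lemma abs_summable_h s : abs_summable (h_pl s : int -> R).
Proof.
apply: (abs_summable_int_nat _ _).1; first exact: h_pl_neg.
apply: (@abs_summable_half_bound _ (expR (`|s| * 2))) => m.
exact: h_pl_le.
Qed.

Lemma conv_h s t : conv (h_pl s) (h_pl t) = h_pl (s + t) :> (int -> R).
Proof.
apply/funext => n; rewrite convC /conv.
have [n0|n0] := ltP n 0.
  rewrite h_pl_neg//; rewrite -[RHS](tsum0 R int); congr tsum; apply/funext => k.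
  have [k0|k0] := ltP k 0; first by rewrite [h_pl s k]h_pl_neg// mulr0.
  by rewrite h_pl_neg ?mul0r//; lia.
case: n n0 => // n _; rewrite -h_plD.
have [||_ ->] := @tsum_seq R int [seq k%:Z | k <- iota 0 n.+1]
    (fun k => h_pl t (n%:Z - k) * h_pl s k).
- by rewrite map_inj_uniq ?iota_uniq// => ? ? [].
- move=> k kn; have [k0|k0] := ltP k 0; first by rewrite [h_pl s k]h_pl_neg// mulr0.
  rewrite h_pl_neg ?mul0r//; case: k k0 kn => // k _ kn; rewrite subr_lt0 ltz_nat.
  rewrite ltnNge; apply/negP => kn'; move/negP: kn; apply.
  by apply/mapP; exists k => //; rewrite mem_iota add0n ltnS.
rewrite big_map; have <- : index_iota 0 n.+1 = iota 0 n.+1 by rewrite /index_iota subn0.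
rewrite big_mkord.
by apply: eq_bigr => k _; rewrite mulrC.
Qed.

Lemma h_zero : h_pl 0 = delta 0 :> (int -> R).
Proof.
apply/funext => -[n|n]; rewrite /delta; first by rewrite h_pl_zero.
by rewrite h_pl_neg.
Qed.

(* Laurent coefficients of [exp (s z + t / z)]. *)
Definition exp_coef2 s t : int -> R := conv (h_pl s) (refl (h_pl t)).

Lemma abs_summable_exp2 s t : abs_summable (exp_coef2 s t).
Proof. exact: abs_summable_conv (abs_summable_h _) (abs_summable_refl (abs_summable_h _)). Qed.

Lemma conv_exp2 s t s' t' :
  conv (exp_coef2 s t) (exp_coef2 s' t') = exp_coef2 (s + s') (t + t').
Proof.
have sh x := abs_summable_h x; have sr x := abs_summable_refl (sh x).
rewrite /exp_coef2 convA//; last by exact: abs_summable_conv.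
rewrite -(convA (sr t))// (convC (refl (h_pl t))) (convA (sh s'))//.
rewrite -convA ?conv_h//; last exact: abs_summable_conv.
congr conv; apply/funext => n; rewrite conv_refl conv_h//.
Qed.

Lemma exp2_refl s t n : exp_coef2 s t (- n) = exp_coef2 t s n.
Proof.
have rr : refl (refl (h_pl t)) = h_pl t by apply/funext => k; rewrite /refl opprK.
by rewrite /exp_coef2 -conv_refl rr convC.
Qed.

Lemma exp2_l s : exp_coef2 s 0 = h_pl s.
Proof.
rewrite /exp_coef2 h_zero; have -> : refl (delta 0) = delta 0.
  by apply/funext => n; rewrite /refl /delta oppr_eq0.
by apply/funext => n; rewrite conv_delta subr0.
Qed.

Lemma exp2_r t : exp_coef2 0 t = refl (h_pl t).
Proof. by apply/funext => n; rewrite -[n in LHS]opprK exp2_refl exp2_l. Qed.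

(** A Cauchy estimate on the circle of radius [r]. The reflected factor lives on nonpositive
    indices, and [1 <= r] keeps its contribution bounded by its plain l^1 norm. For negative [n] the
    bound grows. *)
Lemma exp2_bound s t r : 1 <= r -> exists2 C : R, 0 <= C &
  forall n : int, `|exp_coef2 s t n| <= C * r ^ (- n).
Proof.
move=> r1; have r0 : 0 < r by apply: lt_le_trans r1.
pose S := tsum (fun k => `|h_pl t k|).
have S0 : 0 <= S by apply: tsum_ge0 => //; exact/abs_summable_norm/abs_summable_h.
exists (expR (`|s| * r) * S) => [|n]; first by rewrite mulr_ge0// expR_ge0.
have sE : S = tsum (fun k => `|refl (h_pl t) k|).
  by rewrite /S -(tsum_reindex _ oppr_bij).
have s1 := abs_summable_norm (abs_summable_refl (abs_summable_h t)).
have -> : expR (`|s| * r) * S * r ^ (- n) = (expR (`|s| * r) * r ^ (- n)) * S by ring.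
rewrite sE -tsumZ//.
apply: tsum_norm_le; last exact: abs_summableZ.
move=> k; rewrite normrM.
have [k0|k0] := ltP 0 k.
  by rewrite /refl [h_pl t _]h_pl_neg ?oppr_lt0// normr0 !mulr0.
apply: ler_wpM2r => //.
have [nk|nk] := ltP (n - k) 0.
  by rewrite h_pl_neg// normr0 mulr_ge0// ?expR_ge0// exprz_ge0// ltW.
have [m mE] : exists m : nat, n - k = m%:Z by case: (n - k) nk => // m _; exists m.
rewrite mE; apply: le_trans (h_pl_le _ _ r0) _.
apply: ler_wpM2l; first exact: expR_ge0.
rewrite exprVn exprnN; apply: ler_weXz2l => //.
by lia.
Qed.

End nat_int_sums.

(** * The Borodin-Okounkov formula *)

Lemma inj_shift (z : int) : injective (fun q : nat => q%:Z + z).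
Proof. by move=> m n /addIr []. Qed.

Lemma tsum_shift (R : realType) (H : int -> R) (z : int) : abs_summable H -> (forall q, q < z -> H q = 0) ->
  tsum H = tsum (fun q : nat => H (q%:Z + z)).
Proof.
move=> sH H0; apply: (tsum_inj (@inj_shift z) _ _).2.
  move=> i Hi; have [/H0//|zi] := ltP i z.
  by case: (Hi `|i - z|%N); lia.
exact: abs_summable_comp (@inj_shift z) sH.
Qed.

(** The values of [y] below the cut are numbered by [m]. The hypothesis says that folding the
    convolution of [al'] with [y] gives column [j] of the Toeplitz matrix of [al']. Moving the part
    above the cut to the other side leaves a triangular Toeplitz system for [y (r + c)], which the
    outer sum against [al] inverts. *)
Lemma lower_fold_apply (R : realType) (c : bool) (al al' y : int -> R) (j : nat) :
  unit_series al -> unit_series al' -> inverse_series al al' ->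
  abs_summable al' -> abs_summable y ->
  (forall k : nat, conv al' y (k%:Z + (c : nat)%:Z) +
     (-1) ^+ c * (0 < k + c)%N%:R * conv al' y (- (k%:Z + (c : nat)%:Z)) = al' (k%:Z - j%:Z)) ->
  forall p : nat,
  abs_summable (fun m : nat => lower_fold c al al' p m * y ((c : nat)%:Z - 1 - m%:Z)) /\
  tsum (fun m : nat => lower_fold c al al' p m * y ((c : nat)%:Z - 1 - m%:Z)) =
    (p == j)%:R - y (p%:Z + (c : nat)%:Z).
Proof.
move=> [al0 al1] [al'0 al'1] al_inv s_al' s_y W_fold p.
have [cz czE] : exists cz : nat, cz = c by exists c.
rewrite -czE in W_fold *.
have inj1 (z : int) : injective (fun m : nat => z - m%:Z).
  by move=> m n /addrI /oppr_inj [].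
have s1 : abs_summable (fun m : nat => y (cz%:Z - 1 - m%:Z)) by apply: abs_summable_comp (@inj1 _) s_y.
have [B HB] := abs_summable_bounded s_al'.
pose U (k m : nat) := al' (k%:Z + 1 + m%:Z) * y (cz%:Z - 1 - m%:Z).
pose V (k m : nat) := al' (m%:Z + 1 - cz%:Z *+ 2 - k%:Z) * y (cz%:Z - 1 - m%:Z).
have sU k : abs_summable (U k) by exact: (abs_summable_mul_bounded (fun m => HB _) s1).
have sV k : abs_summable (V k) by exact: (abs_summable_mul_bounded (fun m => HB _) s1).
pose T (k : 'I_p.+1) (m : nat) := al (p%:Z - k%:Z) * (U k m + (-1) ^+ c * (0 < k + cz)%N%:R * V k m).
have sT k : abs_summable (T k).
  by apply: abs_summableZ; apply: abs_summableD => //; exact: abs_summableZ.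
have E1 : (fun m : nat => lower_fold c al al' p m * y (cz%:Z - 1 - m%:Z)) = (fun m => \sum_(k < p.+1) T k m).
  apply/funext => m; rewrite /lower_fold mulr_suml; apply: eq_bigr => k _.
  by rewrite /T /U /V -czE; ring.
have [s2 t2] := tsum_sum sT.
rewrite E1; split=> //; rewrite t2.
(* The convolution splits at the cut: [U] is the part below, and above it only the terms [r <= k]
   survive because [al'] vanishes on negative indices. *)
have UE k : tsum (U k) = conv al' y (k%:Z + cz%:Z) - \sum_(r < k.+1) al' (k%:Z - r%:Z) * y (r%:Z + cz%:Z).
  pose H (q : int) := al' (k%:Z + cz%:Z - q) * y q.
  have sH : abs_summable H by exact: (conv_term_summable _ s_al' s_y).
  have -> : conv al' y (k%:Z + cz%:Z) = tsum H by [].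
  pose H1 (q : int) := if q < cz%:Z then H q else 0.
  pose H2 (q : int) := if q < cz%:Z then 0 else H q.
  have sH1 : abs_summable H1.
    apply: abs_summable_le (abs_summable_norm sH) => q.
    by rewrite /H1; case: ifP; rewrite ?normr0.
  have sH2 : abs_summable H2.
    apply: abs_summable_le (abs_summable_norm sH) => q.
    by rewrite /H2; case: ifP; rewrite ?normr0.
  have -> : tsum H = tsum H1 + tsum H2.
    rewrite -tsumD//; congr tsum; apply/funext => q.
    by rewrite /H1 /H2; case: ifP; rewrite ?addr0 ?add0r.
  have -> : tsum H2 = \sum_(r < k.+1) al' (k%:Z - r%:Z) * y (r%:Z + cz%:Z).
    rewrite (tsum_shift (z := cz%:Z))//; last by move=> q qc; rewrite /H2 qc.
    have [||_ ->] := @tsum_seq R nat (iota 0 k.+1) (fun q : nat => H2 (q%:Z + cz%:Z)).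
    - exact: iota_uniq.
    - move=> q; rewrite mem_iota add0n /= -leqNgt => qk.
      rewrite /H2; case: ifP => // _; rewrite /H [al' _]al'0 ?mul0r//; lia.
    have <- : index_iota 0 k.+1 = iota 0 k.+1 by rewrite /index_iota subn0.
    rewrite big_mkord; apply: eq_bigr => r _.
    rewrite /H2; have -> : (r%:Z + cz < cz) = false by lia.
    by rewrite /H; congr (al' _ * _); lia.
  rewrite addrK.
  have inj2 := inj1 (cz%:Z - 1).
  have [||_ ->] := @tsum_inj R nat int (fun m : nat => cz%:Z - 1 - m%:Z) H1 inj2.
  - move=> q Hq; rewrite /H1; case: ifP => // qc.
    by case: (Hq (absz (cz%:Z - 1 - q)%R)); lia.
  - exact: abs_summable_comp inj2 sH1.
  congr tsum; apply/funext => m; rewrite /H1.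
  have -> : cz%:Z - 1 - m%:Z < cz%:Z by lia.
  by rewrite /U /H; congr (al' _ * _); lia.
(* At the reflected point nothing above the cut contributes: the index of [al'] is negative
   there. *)
have VE k : (0 < k + cz)%N -> tsum (V k) = conv al' y (- (k%:Z + cz%:Z)).
  move=> k0.
  pose H (q : int) := al' (- (k%:Z + cz%:Z) - q) * y q.
  have sH : abs_summable H by exact: (conv_term_summable _ s_al' s_y).
  have -> : conv al' y (- (k%:Z + cz%:Z)) = tsum H by [].
  have inj2 := inj1 (cz%:Z - 1).
  have [||_ ->] := @tsum_inj R nat int (fun m : nat => cz%:Z - 1 - m%:Z) H inj2.
  - move=> q Hq; have [qc|qc] := ltP q cz%:Z.
      by case: (Hq (absz (cz%:Z - 1 - q)%R)); lia.
    by rewrite /H [al' _]al'0 ?mul0r//; lia.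
  - exact: abs_summable_comp inj2 sH.
  by congr tsum; apply/funext => m; rewrite /V /H; congr (al' _ * _); lia.
have TE (k : 'I_p.+1) : tsum (T k) = al (p%:Z - k%:Z) * (al' (k%:Z - j%:Z) -
    \sum_(r < k.+1) al' (k%:Z - r%:Z) * y (r%:Z + cz%:Z)).
  rewrite /T tsumZ; last by apply: abs_summableD => //; exact: abs_summableZ.
  congr (_ * _); rewrite tsumD//; last exact: abs_summableZ.
  rewrite tsumZ// UE -W_fold addrAC; congr (_ + _ - _).
  have [_|k0] := posnP (k + cz)%N; first by rewrite !mulr0 !mul0r. by rewrite VE// czE.
under eq_bigr do rewrite TE mulrBr.
rewrite sumrB.
have inv (n : nat) (z : nat) : (z <= n)%N ->
    \sum_(z <= k < n.+1) al (n%:Z - k%:Z) * al' (k%:Z - z%:Z) = (n == z)%:R.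
  move=> zn; rewrite big_nat_rev -{1}[z]add0n big_addn big_mkord.
  have -> : (n.+1 - z = (n - z).+1)%N by lia.
  rewrite (eq_bigr (fun i : 'I_(n - z).+1 => al i%:Z * al' ((n - z)%N%:Z - i%:Z))).
    by rewrite al_inv; congr (_ %:R); lia.
  by move=> i _; have := ltn_ord i => iz; congr (al _ * al' _); lia.
congr (_ - _).
  pose Fk (k : nat) := al (p%:Z - k%:Z) * al' (k%:Z - j%:Z).
  rewrite -(big_mkord xpredT Fk).
  have [jp|pj] := leqP j p.
    rewrite (big_cat_nat (n := j)) //=; last by rewrite leqW.
    rewrite big_nat_cond big1 ?add0r; first exact: inv.
    by move=> k /andP[/andP[_ kj] _]; rewrite /Fk [al' _]al'0 ?mulr0//; lia.
  have -> : (p == j) = false by lia.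
  rewrite big_nat_cond big1// => k /andP[/andP[_ kj] _].
  by rewrite /Fk [al' _]al'0 ?mulr0//; lia.
transitivity (\sum_(k < p.+1) \sum_(r < p.+1) if (r <= k)%N then
     al (p%:Z - k%:Z) * al' (k%:Z - r%:Z) * y (r%:Z + cz%:Z) else 0).
  apply: eq_bigr => k _; rewrite mulr_sumr.
  rewrite -(big_mkord xpredT (fun r => al (p%:Z - k%:Z) * (al' (k%:Z - r%:Z) * y (r%:Z + cz%:Z)))).
  rewrite -(big_mkord xpredT (fun r => if (r <= k)%N then al (p%:Z - k%:Z) * al' (k%:Z - r%:Z) * y (r%:Z + cz%:Z) else 0)).
  rewrite [RHS](big_cat_nat (n := k.+1)) //=.
  rewrite [X in _ = _ + X]big_nat_cond [X in _ = _ + X]big1 ?addr0; last first.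
    by move=> r /andP[/andP[kr _] _]; rewrite leqNgt kr.
  by apply: eq_big_nat => r /andP[_ rk]; rewrite -ltnS rk mulrA.
rewrite exchange_big /= (bigD1 ord_max) //= [X in _ + X]big1 ?addr0.
  rewrite -big_mkcond /= (bigD1 ord_max) //= big1 ?addr0.
    by rewrite !subrr al1 al'1 !mul1r.
  by move=> k /andP[pk]; case/negP; apply/eqP/val_inj => /=; have := ltn_ord k; lia.
move=> r rp; have rp' : (r < p)%N.
  have := ltn_ord r; rewrite ltnS leq_eqVlt => /orP[/eqP E|//].
  by move/eqP: rp; case; apply: val_inj.
pose Fk (k : nat) := if (r <= k)%N then al (p%:Z - k%:Z) * al' (k%:Z - r%:Z) * y (r%:Z + cz%:Z) else 0.
rewrite -(big_mkord xpredT Fk) (big_cat_nat (n := r)) //=; last by rewrite leqW// ltnW.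
rewrite big_nat_cond big1 ?add0r; last first.
  by move=> k /andP[/andP[_ kr] _]; rewrite /Fk leqNgt kr.
rewrite (eq_big_nat _ _ (F2 := fun k => al (p%:Z - k%:Z) * al' (k%:Z - r%:Z) * y (r%:Z + cz%:Z))).
  rewrite -mulr_suml inv 1?ltnW//.
  have -> : (p == r :> nat) = false by lia.
  by rewrite mul0r.
by move=> k /andP[rk _]; rewrite /Fk rk.
Qed.

Section Borodin_Okounkov.
Local Opaque tsum.
Variables (R : realType) (c : bool) (theta : R).

Let sg : R := (-1) ^+ c.
Let h2 : int -> R := h_pl (2 * theta).
Let h2' : int -> R := h_pl (- (2 * theta)).
Let h1 : int -> R := h_pl theta.
Let h1' : int -> R := h_pl (- theta).

(* The Bessel function J_n(2 theta). *)
Definition bessel (n : int) : R := exp_coef2 theta (- theta) n.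

(** The first sum is the discrete Bessel kernel, the second its reflection. At the edge they become
    the two integrals of [Akernel], the sign being -(-1)^c. *)
Definition fold_kernel (q j : nat) : R :=
  tsum (fun m : nat => bessel (q%:Z + 1 + m%:Z) * bessel (j%:Z + 1 + m%:Z)) -
  (-1) ^+ c * tsum (fun m : nat => bessel (q%:Z + (c : nat)%:Z - 1 - m%:Z) *
                                   bessel (j%:Z + (c : nat)%:Z + 1 + m%:Z)).

Definition full_entry (p q : nat) : R := tsum (fun m : nat => foldP c theta p m * convQ theta m q).

Local Ltac zlia := repeat match goal with
  | H : forall _, _ |- _ => clear H
  | H : @eq (int -> Real.sort R) _ _ |- _ => clear H
  | H : @eq (nat -> Real.sort R) _ _ |- _ => clear H
  | H : @eq (Real.sort R) _ _ |- _ => clear H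
  | H : abs_summable _ |- _ => clear H
  | H : abs_summable2 _ |- _ => clear H
  end; lia.

Section column.
Variable j : nat.
Let J : int := j%:Z + (c : nat)%:Z.
Let cz : int := (c : nat)%:Z.

(** Convolving [bessel] with [g] gives the unit vector at [J]. The correction [a] is determined
    below the cut by the requirement that [f = g + a] vanish there, and above it by the parity
    [a (- k) = - sg * a k]. The column [y] is thus both [bessel] convolved with a sequence supported
    above the cut and the unit vector plus a term invisible to the fold. *)
Let g (k : int) : R := bessel (J - k).
Let a (k : int) : R := if k < cz then - g k else sg * (k != 0)%:R * g (- k).
Let f (k : int) : R := if k < cz then 0 else g k + sg * (k != 0)%:R * g (- k).
Let y : int -> R := conv bessel f.

Let s_h t : abs_summable (h_pl t : int -> R) := abs_summable_h t.
Let s_b : abs_summable bessel := abs_summable_exp2 _ _.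

Let fE : f = (fun k => g k + a k).
Proof. by apply/funext => k; rewrite /f /a; case: ifP => _; rewrite ?subrr. Qed.

Let s_g : abs_summable g.
Proof. exact: (abs_summable_reindex (subr_bij J) s_b). Qed.

Let s_a : abs_summable a.
Proof.
apply: (@abs_summable_le _ _ _ (fun k => `|g k| + `|g (- k)|)).
  move=> k; rewrite /a; case: ifP => _; first by rewrite normrN lerDl.
  rewrite !normrM normrX normrN1 expr1n mul1r normr_nat.
  by case: (k != 0); rewrite ?mul1r ?mul0r ?lerDr// addr_ge0.
apply: abs_summableD; apply: abs_summable_norm => //.
exact: (abs_summable_reindex oppr_bij s_g).
Qed.

Let s_f : abs_summable f.
Proof. by rewrite fE; apply: abs_summableD. Qed.

Let s_y : abs_summable y.
Proof. exact: (abs_summable_conv s_b s_f). Qed.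

Let gE : g = conv (exp_coef2 (- theta) theta) (delta R J).
Proof. by apply/funext => k; rewrite conv_delta /g /bessel -exp2_refl opprB. Qed.

Let sgsg : sg * sg = 1.
Proof. by rewrite /sg -expr2 sqrr_sign. Qed.

Let c_cases : (sg = -1 /\ cz = 1) \/ (sg = 1 /\ cz = 0).
Proof. by rewrite /sg /cz; case: (c); [left|right]; rewrite ?expr1 ?expr0. Qed.

Let a_anti k : a (- k) = - sg * a k.
Proof.
rewrite /a; case: c_cases => -[-> ->].
  rewrite [- -1]opprK mul1r.
  have [->|k0] := eqVneq k 0; first by rewrite oppr0 ltr01.
  have [k1|k1] := ltP k 1.
    have -> : (- k < 1) = false by zlia.
    by rewrite oppr_eq0 k0 opprK mulr1 mulN1r.
  have -> : - k < 1 by zlia.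
  by rewrite mulr1 mulN1r.
rewrite !mul1r !mulN1r.
have [->|k0] := eqVneq k 0; first by rewrite oppr0 ltxx eqxx mul0r oppr0.
have [k1|k1] := ltP k 0.
  have -> : (- k < 0) = false by zlia.
  by rewrite oppr_eq0 k0 !opprK mul1r.
have -> : - k < 0 by zlia.
by rewrite mul1r.
Qed.

Let y_shift : y = (fun k => delta R J k + conv bessel a k).
Proof.
rewrite /y fE convDr//; apply/funext => k; congr (_ + _).
have s1 := abs_summable_exp2 (- theta) theta; have s2 := abs_summable_delta R J.
rewrite gE -(convA s_b s1 s2) /bessel conv_exp2 subrr addNr exp2_l h_zero.
by rewrite conv_delta /delta subr_eq0.
Qed.

Let W : int -> R := conv h2' y.

Let WE : W = (fun k => h2' (k - J) + conv (exp_coef2 (- theta) (- theta)) a k).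
Proof.
have e1 : h2' = exp_coef2 (- (2 * theta)) 0 by rewrite exp2_l.
have e2 : conv h2' bessel = exp_coef2 (- theta) (- theta).
  rewrite e1 /bessel conv_exp2 add0r.
  by have -> : - (2 * theta) + theta = - theta by ring.
have s1 := abs_summable_exp2 (- theta) (- theta).
have s2 := abs_summable_exp2 (- theta) theta; have s3 := abs_summable_delta R J.
rewrite /W /y -(convA (s_h _) s_b s_f) e2 fE (convDr s1 s_g s_a).
apply/funext => k; congr (_ + _).
rewrite gE -(convA s1 s2 s3) conv_exp2 addNr conv_delta e1.
by have -> : - theta - theta = - (2 * theta) by ring.
Qed.

(** The series e^{-theta (z + 1/z)} is invariant under z -> 1/z, so convolution with it preserves
    the parity of [a]. *)
Let Ea_anti k : conv (exp_coef2 (- theta) (- theta)) a (- k) =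
  - sg * conv (exp_coef2 (- theta) (- theta)) a k.
Proof.
rewrite /conv -tsumZ; last by apply: conv_term_summable => //; exact: abs_summable_exp2.
rewrite -(tsum_reindex _ oppr_bij); congr tsum; apply/funext => m.
have -> : - k - - m = - (k - m) by ring.
by rewrite exp2_refl a_anti; ring.
Qed.

(** Parity makes the fold cancel the contribution of [a], and the reflected value of [h2'] has
    negative index. When k + c = 0 there is no reflected term, but parity forces the contribution of
    [a] at 0 to vanish. *)
Let W_fold (k : nat) : W (k%:Z + cz) + sg * (0 < k + c)%N%:R * W (- (k%:Z + cz)) =
  h2' (k%:Z - j%:Z).
Proof.
rewrite WE /= Ea_anti.
have -> : k%:Z + cz - J = k%:Z - j%:Z by rewrite /cz /J; zlia.
have [k0|k0] := posnP (k + c).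
  have [kE cE] : k = 0%N /\ nat_of_bool c = 0%N by zlia.
  rewrite mulr0 mul0r addr0.
  have := Ea_anti 0; rewrite oppr0 /cz kE cE addr0 /sg.
  have -> : c = false by case: (c) cE.
  rewrite expr0 mulN1r; set E := conv _ _ _; lra.
rewrite [h2' (- _ - _)]h_pl_neg; last by rewrite /cz /J; zlia.
rewrite add0r mulr1; set E := conv _ _ _.
have -> : sg * (- sg * E) = - (sg * sg) * E by ring.
by rewrite sgsg mulN1r addrK.
Qed.

Let G : int -> R := conv (refl h1) y.

Let GE : G = conv h1 f.
Proof.
rewrite /G /y -(convA (abs_summable_refl (s_h theta)) s_b s_f).
by rewrite -exp2_r /bessel conv_exp2 add0r subrr exp2_l.
Qed.

(** The reflected [h1] turns [bessel] into the one-sided [h1], which cannot move the support of [f]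
    below the cut. *)
Let G_supp k : k < cz -> G k = 0.
Proof.
move=> kc; rewrite GE /conv -[RHS](tsum0 R int); congr tsum; apply/funext => m.
have [mc|mc] := ltP m cz; first by rewrite /f mc mulr0.
by rewrite [h1 _]h_pl_neg ?mul0r//; zlia.
Qed.

Let hG : conv (refl h1') G = y.
Proof.
rewrite /G -(convA (abs_summable_refl (s_h (- theta))) (abs_summable_refl (s_h theta)) s_y).
rewrite -!exp2_r conv_exp2 addr0 addNr exp2_l h_zero convC.
by apply/funext => k; rewrite conv_delta subr0.
Qed.

Let s_G : abs_summable G.
Proof. exact: (abs_summable_conv (abs_summable_refl (s_h theta)) s_y). Qed.

Lemma nat_y_summable : abs_summable (fun q : nat => y (q%:Z + cz)).
Proof. exact: abs_summable_comp (@inj_shift cz) s_y. Qed.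

(* [u = c - 1 - m] is the row index below the cut. *)
Lemma convQ_y (m : nat) : abs_summable (fun q : nat => convQ theta m q * y (q%:Z + cz)) /\
  tsum (fun q : nat => convQ theta m q * y (q%:Z + cz)) = y (cz - 1 - m%:Z).
Proof.
pose F (k q : nat) := if (k <= q)%N then h1' (k%:Z + 1 + m%:Z) * (h1 (q%:Z - k%:Z) * y (q%:Z + cz)) else 0.
have sy := nat_y_summable.
have sF : abs_summable2 F.
  apply: abs_summable2_swap.
  have [B HB] := abs_summable_bounded (s_h (- theta)).
  have B0 : 0 <= B by apply: le_trans (HB 0).
  have [B2 HB2] := abs_summable_bounded (s_h theta).
  have key q k : `|F k q| <= `|h1' (k%:Z + 1 + m%:Z)| * (B2 * `|y (q%:Z + cz)|).
    rewrite /F; case: ifP => _; last first.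
      by rewrite normr0 !mulr_ge0//; apply: le_trans (HB2 0).
    by rewrite !normrM ler_wpM2l// ler_wpM2r.
  have sh : abs_summable (fun k : nat => h1' (k%:Z + 1 + m%:Z)).
    apply: (@abs_summable_half_bound _ _ (expR (`|- theta| * 2))) => k.
    have -> : k%:Z + 1 + m%:Z = (k + m.+1)%N by zlia.
    have r2 : (0 : R) < 2 by [].
    apply: le_trans (h_pl_le _ _ r2) _.
    apply: ler_wpM2l; first exact: expR_ge0.
    by apply: ler_wiXn2l; rewrite ?invr_ge0// ?invf_le1// ?ler1n// leq_addr.
  have shn := abs_summable_norm sh.
  apply: (@abs_summable2P _ _ _ _ (fun q => tsum (fun k : nat => `|h1' (k%:Z + 1 + m%:Z)|) * (B2 * `|y (q%:Z + cz)|))).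
  - move=> q; apply: (@abs_summable_le _ _ _ (fun k : nat => (B2 * `|y (q%:Z + cz)|) * `|h1' (k%:Z + 1 + m%:Z)|)).
      by move=> k; apply: le_trans (key q k) _; rewrite mulrC.
    exact: abs_summableZ.
  - move=> q; rewrite mulrC -tsumZ//; apply: le_trans (ler_norm _) _.
    apply: tsum_norm_le; last exact: abs_summableZ.
    by move=> k; rewrite normr_id; apply: le_trans (key q k) _; rewrite mulrC.
  - apply: abs_summableZ; apply: abs_summableZ; exact: abs_summable_norm.
have E1 : (fun q : nat => convQ theta m q * y (q%:Z + cz)) = (fun q => tsum (F^~ q)).
  apply/funext => q.
  have [||_ ->] := @tsum_seq R nat (iota 0 q.+1) (F^~ q).
  - exact: iota_uniq.
  - by move=> k; rewrite mem_iota add0n /= ltnS /F => /negbTE ->.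
  have <- : index_iota 0 q.+1 = iota 0 q.+1 by rewrite /index_iota subn0.
  rewrite big_mkord /convQ /upper_conv mulr_suml; apply: eq_bigr => k _.
  by rewrite /F -ltnS ltn_ord mulrA.
rewrite E1; split; first exact: (abs_summable2_tsum (abs_summable2_swap sF)).
rewrite -(tsum_swap sF).
transitivity (tsum (fun k : nat => h1' (k%:Z + 1 + m%:Z) * G (k%:Z + cz))).
  congr tsum; apply/funext => k.
  pose H (q : int) := refl h1 (k%:Z + cz - q) * y q.
  have sH : abs_summable H by exact: (conv_term_summable _ (abs_summable_refl (s_h theta)) s_y).
  have H0 (q : int) : q < k%:Z + cz -> H q = 0.
    by move=> qk; rewrite /H /refl [h1 _]h_pl_neg ?mul0r//; zlia.
  have -> : G (k%:Z + cz) = tsum (fun q : nat => H (q%:Z + (k%:Z + cz))).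
    exact: tsum_shift.
  have sHn : abs_summable (fun q : nat => H (q%:Z + (k%:Z + cz))).
    exact: abs_summable_comp (@inj_shift _) sH.
  rewrite -tsumZ//.
  have FkE : (fun x => F k (k + x)%N) =
      (fun q : nat => h1' (k%:Z + 1 + m%:Z) * H (q%:Z + (k%:Z + cz))).
    apply/funext => q; rewrite /F leq_addr /H /refl.
    by rewrite PoszD; congr (_ * (h1 _ * y _)); ring.
  have [||_ ->] := @tsum_inj R nat nat (addn k) (F k) (@addnI k).
  - move=> i Hi; rewrite /F leqNgt; case: ltnP => // ki.
    by case: (Hi (i - k)%N); rewrite subnKC.
  - by rewrite FkE; exact: abs_summableZ.
  by rewrite FkE.
rewrite -[in RHS]hG /conv.
pose H (q : int) := refl h1' (cz - 1 - m%:Z - q) * G q.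
rewrite -/H (tsum_shift (z := cz)); last 2 first.
- exact: (conv_term_summable _ (abs_summable_refl (s_h (- theta))) s_G).
- by move=> q /G_supp; rewrite /H => ->; rewrite mulr0.
congr tsum; apply/funext => k; rewrite /H /refl; congr (h1' _ * _); zlia.
Qed.

Lemma foldP_y (p : nat) :
  abs_summable (fun m : nat => foldP c theta p m * y (cz - 1 - m%:Z)) /\
  tsum (fun m : nat => foldP c theta p m * y (cz - 1 - m%:Z)) =
    (p == j)%:R - y (p%:Z + cz).
Proof.
exact: (lower_fold_apply (h_pl_unit _) (h_pl_unit _) (h_pl_inverse _) (s_h _) s_y W_fold).
Qed.

(** In the convolution of [bessel] with [a], the indices below the cut give the discrete Bessel sum
    and those from 1 on its reflection. *)
Lemma y_kernel (q : nat) : y (q%:Z + cz) = (q == j)%:R - fold_kernel q j.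
Proof.
rewrite y_shift /delta /J -/cz (inj_eq (@addIr _ cz)) eqz_nat; congr (_ + _).
set n := q%:Z + cz.
pose H (k : int) := bessel (n - k) * a k.
have sH : abs_summable H by exact: (conv_term_summable _ s_b s_a).
pose H1 (k : int) := if k < cz then H k else 0.
pose H2 (k : int) := if k < cz then 0 else H k.
have sH1 : abs_summable H1.
  apply: abs_summable_le (abs_summable_norm sH) => k.
  by rewrite /H1; case: ifP; rewrite ?normr0.
have sH2 : abs_summable H2.
  apply: abs_summable_le (abs_summable_norm sH) => k.
  by rewrite /H2; case: ifP; rewrite ?normr0.
have -> : conv bessel a n = tsum H1 + tsum H2.
  rewrite -tsumD//; congr tsum; apply/funext => k.
  by rewrite /H1 /H2; case: ifP; rewrite ?addr0 ?add0r.
have inj2 : injective (fun m : nat => cz - 1 - m%:Z) by move=> k l /addrI /oppr_inj [].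
rewrite /fold_kernel opprB addrC; congr (_ + _).
  (* Both cases start at 1: the symplectic cut is 1, and the orthogonal [a] vanishes at 0. *)
  have H20 k : k < 1 -> H2 k = 0.
    move=> k1; rewrite /H2; case: ifP => // kc; rewrite /H /a kc.
    have -> : (k != 0) = false by move: kc; case: c_cases => -[_ ->]; zlia.
    by rewrite mulr0 mul0r mulr0.
  rewrite (tsum_shift sH2 H20).
  have [B HB] := abs_summable_bounded s_b.
  have inj3 : injective (fun m : nat => j%:Z + cz + 1 + m%:Z) by move=> k l /addrI [].
  have s3 : abs_summable (fun m : nat => bessel (j%:Z + cz + 1 + m%:Z)).
    exact: abs_summable_comp inj3 s_b.
  rewrite -tsumZ; last exact: (abs_summable_mul_bounded (fun m => HB _) s3).
  congr tsum; apply/funext => m; rewrite /H2.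
  have -> : (m%:Z + 1 < cz) = false by case: c_cases => -[_ ->]; zlia.
  rewrite /H /a; have -> : (m%:Z + 1 < cz) = false by case: c_cases => -[_ ->]; zlia.
  have -> : (m%:Z + 1 != 0) by zlia.
  rewrite mulr1 /g /n mulrCA; congr (_ * (bessel _ * bessel _)); rewrite /J /cz; zlia.
have H10 i : (forall m : nat, cz - 1 - m%:Z <> i) -> H1 i = 0.
  move=> Hi; rewrite /H1; case: ifP => // ic.
  by case: (Hi (absz (cz - 1 - i)%R)); zlia.
have [||_ ->] := @tsum_inj R nat int (fun m : nat => cz - 1 - m%:Z) H1 inj2.
- exact: H10.
- exact: abs_summable_comp inj2 sH1.
rewrite -tsumN; congr tsum; apply/funext => m; rewrite /H1 /H /a.
have -> : cz - 1 - m%:Z < cz by zlia.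
rewrite mulrN /g /n; congr (- (bessel _ * bessel _)); rewrite /J /cz; zlia.
Qed.

(** [convQ] recovers the values of [y] below the cut from those above it, and [foldP] sends these to
    the unit vector minus [y]. Adding [y] leaves the unit vector. *)
Lemma full_inverse (p : nat) :
  abs_summable (fun q : nat => full_entry p q * y (q%:Z + cz)) /\
  tsum (fun q : nat => full_entry p q * y (q%:Z + cz)) + y (p%:Z + cz) = (p == j)%:R.
Proof.
have [C C0 HC] := foldP_convQ_bound c theta.
have [B HB] := abs_summable_bounded s_y.
have B0 : 0 <= B by apply: le_trans (HB 0).
have sFQ q : abs_summable (fun m : nat => foldP c theta p m * convQ theta m q).
  apply: (@abs_summable_half_bound _ _ (C * 2^-1 ^+ p * 2^-1 ^+ q)) => m.
  exact: HC.
pose F (q m : nat) := foldP c theta p m * convQ theta m q * y (q%:Z + cz).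
have FB q m : `|F q m| <= B * (C * 2^-1 ^+ p) * 2^-1 ^+ q * 2^-1 ^+ m.
  rewrite /F normrM mulrC -!mulrA; apply: ler_pM => //.
  by rewrite !mulrA.
have Cp0 q : 0 <= B * (C * 2^-1 ^+ p) * 2^-1 ^+ q by rewrite !mulr_ge0// exprn_ge0.
have sF : abs_summable2 F.
  apply: (@abs_summable2P _ _ _ _ (fun q => B * (C * 2^-1 ^+ p) * 2 * 2^-1 ^+ q)).
  - by move=> q; apply: (@abs_summable_half_bound _ _ (B * (C * 2^-1 ^+ p) * 2^-1 ^+ q)) => m.
  - move=> q; have -> : B * (C * 2^-1 ^+ p) * 2 * 2^-1 ^+ q = B * (C * 2^-1 ^+ p) * 2^-1 ^+ q * 2 by ring.
    apply: le_trans (ler_norm _) _; apply: tsum_half_bound => // m.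
    by rewrite normr_id.
  - exact: abs_summable_half.
have E : (fun q : nat => full_entry p q * y (q%:Z + cz)) = (fun q => tsum (F q)).
  apply/funext => q; rewrite mulrC /full_entry -tsumZ//; congr tsum.
  by apply/funext => m; rewrite /F mulrC.
rewrite E; split; first exact: abs_summable2_tsum.
rewrite (tsum_swap sF).
have [_ t1] := foldP_y p.
have -> : (fun m => tsum (fun q => F q m)) =
    (fun m : nat => foldP c theta p m * y (cz - 1 - m%:Z)).
  apply/funext => m; have [s2 <-] := convQ_y m.
  by rewrite -tsumZ//; congr tsum; apply/funext => q; rewrite /F mulrA.
by rewrite t1 subrK.
Qed.
End column.

(** In the second sum the first Bessel index decreases and its bound grows like 2^m, so the second
    factor is estimated at radius 4. *)
Lemma fold_kernel_bound : exists2 C : R, 0 <= C & forall q j,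
  `|fold_kernel q j| <= C * 2^-1 ^+ q * 2^-1 ^+ j.
Proof.
have [|C2 C20 H2] := exp2_bound theta (- theta) (r := 2); first by rewrite ler1n.
have [|C4 C40 H4] := exp2_bound theta (- theta) (r := 4); first by rewrite ler1n.
have b2 (n : nat) : `|bessel n%:Z| <= C2 * 2^-1 ^+ n.
  by apply: le_trans (H2 _) _; rewrite exprVn exprnN.
have b4 (n : nat) : `|bessel n%:Z| <= C4 * 4^-1 ^+ n.
  by apply: le_trans (H4 _) _; rewrite exprVn exprnN.
have half1 n : (2^-1 : R) ^+ n <= 1 by rewrite exprn_ile1// invf_le1// ler1n.
have quarter n : (4^-1 : R) ^+ n = 2^-1 ^+ n * 2^-1 ^+ n.
  by rewrite -exprMn; congr (_ ^+ _); field.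
exists (C2 * C2 * 2 + C2 * C4 * 2 * 2) => [|q j]; first by rewrite !addr_ge0// !mulr_ge0.
apply: le_trans (ler_normB _ _) _; rewrite mulrDl mulrDl; apply: lerD.
  have -> : C2 * C2 * 2 * 2^-1 ^+ q * 2^-1 ^+ j = C2 * C2 * 2^-1 ^+ q * 2^-1 ^+ j * 2 :> R by ring.
  apply: tsum_half_bound => [|m]; first by rewrite !mulr_ge0// exprn_ge0.
  have -> : q%:Z + 1 + m%:Z = (q + m.+1)%N by lia.
  have -> : j%:Z + 1 + m%:Z = (j + m.+1)%N by lia.
  rewrite normrM; apply: le_trans (ler_pM _ _ (b2 _) (b2 _)) _ => //.
  rewrite !exprD.
  have -> : C2 * (2^-1 ^+ q * 2^-1 ^+ m.+1) * (C2 * (2^-1 ^+ j * 2^-1 ^+ m.+1)) =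
    C2 * C2 * 2^-1 ^+ q * 2^-1 ^+ j * 2^-1 ^+ m * (2^-1 * 2^-1 ^+ m.+1) by rewrite !exprS; ring.
  rewrite ler_piMr//; first by rewrite !mulr_ge0// exprn_ge0.
  by rewrite mulr_ile1// ?exprn_ge0// ?invf_le1// ler1n.
rewrite normrM normrX normrN1 expr1n mul1r.
have -> : C2 * C4 * 2 * 2 * 2^-1 ^+ q * 2^-1 ^+ j = C2 * C4 * 2 * 2^-1 ^+ q * 2^-1 ^+ j * 2 :> R by ring.
apply: tsum_half_bound => [|m]; first by rewrite !mulr_ge0// exprn_ge0.
have -> : j%:Z + (c : nat)%:Z + 1 + m%:Z = (j + c + m.+1)%N by lia.
have h2q : `|bessel (q%:Z + (c : nat)%:Z - 1 - m%:Z)| <= C2 * (2 * 2^-1 ^+ q * 2 ^+ m).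
  apply: le_trans (H2 _) _; apply: ler_wpM2l => //.
  have -> : 2 * 2^-1 ^+ q * 2 ^+ m = (2 : R) ^ (m%:Z + 1 - q%:Z).
    by rewrite !expfzDr ?pnatr_eq0// -exprnN -exprVn -!exprnP expr1; ring.
  by apply: ler_weXz2l; rewrite ?ler1n//; case: (c); lia.
rewrite normrM; apply: le_trans (ler_pM _ _ h2q (b4 _)) _ => //.
rewrite !exprD !quarter.
have -> : C2 * (2 * 2^-1 ^+ q * 2 ^+ m) * (C4 * (2^-1 ^+ j * 2^-1 ^+ j *
    (2^-1 ^+ c * 2^-1 ^+ c) * (2^-1 ^+ m.+1 * 2^-1 ^+ m.+1))) =
  C2 * C4 * 2 * 2^-1 ^+ q * 2^-1 ^+ j * (2^-1 ^+ m * ((2 * 2^-1) ^+ m * (2^-1 * 2^-1 *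
   (2^-1 ^+ j * (2^-1 ^+ c * 2^-1 ^+ c))))) by rewrite exprMn !exprS; ring.
apply: ler_wpM2l; first by rewrite !mulr_ge0// exprn_ge0.
rewrite mulfV ?pnatr_eq0// expr1n mul1r ler_piMr ?exprn_ge0//.
have hle : (2^-1 : R) <= 1 by rewrite invf_le1// ler1n.
by rewrite !mulr_ile1// ?mulr_ge0// ?exprn_ge0// ?mulr_ile1// ?exprn_ge0.
Qed.

Definition fredholm_entry (q j : nat) : R := (q == j)%:R - fold_kernel q j.

Lemma full_inverse_kernel (p j : nat) :
  abs_summable (fun q : nat => full_entry p q * fredholm_entry q j) /\
  tsum (fun q : nat => full_entry p q * fredholm_entry q j) + fredholm_entry p j = (p == j)%:R.
Proof.
have [s t] := full_inverse j p.
by move: s t; rewrite y_kernel; under eq_fun do rewrite y_kernel.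
Qed.

End Borodin_Okounkov.

(** * Finite sections and their limits *)

Section det_limits.
Variable R : realType.

(** Expanded, the difference is a polynomial with nonnegative coefficients in the [a i] and
    [b i]. *)
Lemma prod_perturb (I : eqType) (s : seq I) (a b A B : I -> R) :
  (forall i, 0 <= a i <= A i) -> (forall i, 0 <= b i <= B i) ->
  \prod_(i <- s) (a i + b i) - \prod_(i <- s) a i <=
  \prod_(i <- s) (A i + B i) - \prod_(i <- s) A i.
Proof.
move=> aA bB; elim: s => [|i s IH]; first by rewrite !big_nil.
rewrite !big_cons.
have /andP[a0 aA'] := aA i; have /andP[b0 bB'] := bB i.
have p0 : 0 <= \prod_(j <- s) (a j + b j) - \prod_(j <- s) a j.
  rewrite subr_ge0; apply: ler_prod => j _.
  by have /andP[-> _] := aA j; rewrite lerDl; have /andP[-> _] := bB j.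
have p1 : 0 <= \prod_(j <- s) (a j + b j).
  by apply: prodr_ge0 => j _; rewrite addr_ge0//; [case/andP: (aA j)|case/andP: (bB j)].
have p2 : \prod_(j <- s) (a j + b j) <= \prod_(j <- s) (A j + B j).
  apply: ler_prod => j _; have /andP[? ?] := aA j; have /andP[? ?] := bB j.
  by rewrite addr_ge0//= lerD.
have -> : (a i + b i) * \prod_(j <- s) (a j + b j) - a i * \prod_(j <- s) a j =
  a i * (\prod_(j <- s) (a j + b j) - \prod_(j <- s) a j) + b i * \prod_(j <- s) (a j + b j) by ring.
have -> : (A i + B i) * \prod_(j <- s) (A j + B j) - A i * \prod_(j <- s) A j =
  A i * (\prod_(j <- s) (A j + B j) - \prod_(j <- s) A j) + B i * \prod_(j <- s) (A j + B j) by ring.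
by apply: lerD; apply: ler_pM.
Qed.

(** Because [1 <= g i], an additive row error is also a relative one: g + e <= g (1 + e) <= g e^e.
    Only the sum of the errors then matters. *)
Lemma det_perturbation_expR n (G E : 'M[R]_n) (g e : 'I_n -> R) :
  (forall i, \sum_j `|G i j| <= g i) -> (forall i, 1 <= g i) ->
  (forall i, \sum_j `|E i j| <= e i) ->
  `|\det (G + E) - \det G| <= (\prod_i g i) * (expR (\sum_i e i) - 1).
Proof.
move=> Gg g1 Ee; apply: le_trans (det_perturbation G E) _.
under eq_bigr do rewrite big_split /=.
have G0 i : 0 <= \sum_j `|G i j| by apply: sumr_ge0.
have E0 i : 0 <= \sum_j `|E i j| by apply: sumr_ge0.
have e0 i : 0 <= e i by apply: le_trans (E0 i) _.
apply: le_trans (prod_perturb _ (A := g) (B := e) _ _) _.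
- by move=> i; rewrite G0 Gg.
- by move=> i; rewrite E0 Ee.
rewrite mulrBr mulr1 lerD2r expR_sum -big_split /=.
apply: ler_prod => i _; have gi0 : 0 <= g i by apply: le_trans (g1 i).
rewrite addr_ge0//=; apply: (@le_trans _ _ (g i * (1 + e i))).
  by rewrite mulrDr mulr1 lerD2l ler_peMl.
by rewrite ler_wpM2l// expR_ge1Dx.
Qed.

Lemma expR_sub1_le (x X : R) : 0 <= x -> x <= X -> expR x - 1 <= x * expR X.
Proof.
move=> x0 xX; apply: (@le_trans _ _ (x * expR x)); last first.
  by rewrite ler_wpM2l// ler_expR.
have := expR_ge1Dx (- x); rewrite expRN.
have := expR_gt0 x; set y := expR x => y0 H.
have : y * (1 - x) <= y * y^-1 by rewrite ler_wpM2l// ltW.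
by rewrite mulfV ?gt_eqF//; lra.
Qed.

Lemma sum_half_le (C : R) n (F : 'I_n -> R) : 0 <= C -> (forall i, F i <= C * 2^-1 ^+ i) ->
  \sum_i F i <= C * 2.
Proof.
move=> C0 H; apply: le_trans (ler_sum _ (fun i _ => H i)) _.
by rewrite -mulr_sumr ler_wpM2l// half_geo_le.
Qed.

Lemma sum_half_shift_le (C : R) k n (F : 'I_n -> R) : 0 <= C ->
  (forall i, F i <= C * 2^-1 ^+ (k + i)) -> \sum_i F i <= C * 2 * 2^-1 ^+ k.
Proof.
move=> C0 H.
have := @sum_half_le (C * 2^-1 ^+ k) n F; rewrite mulrAC; apply.
  by rewrite mulr_ge0// exprn_ge0.
by move=> i; rewrite -mulrA -exprD.
Qed.

Variables (c : bool) (theta : R).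
Let X := full_entry c theta.
Let Y := fredholm_entry c theta.

Definition toeplitz_det L : R := \det (\matrix_(p < L, q < L) ((p == q)%:R + X p q)).
Definition tail_det L k : R := \det (\matrix_(i < k, j < k) Y (L + i) (L + j)).

Lemma full_entry_bound : exists2 C : R, 0 <= C & forall p q, `|X p q| <= C * 2^-1 ^+ p * 2^-1 ^+ q.
Proof.
have [C C0 H] := foldP_convQ_bound c theta.
exists (C * 2) => [|p q]; first by rewrite mulr_ge0.
have -> : C * 2 * 2^-1 ^+ p * 2^-1 ^+ q = C * 2^-1 ^+ p * 2^-1 ^+ q * 2 :> R by ring.
by apply: tsum_half_bound => //; rewrite !mulr_ge0// exprn_ge0.
Qed.

Let h0 n : 0 <= (2^-1 : R) ^+ n. Proof. exact: exprn_ge0. Qed.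
Let h1 n : (2^-1 : R) ^+ n <= 1. Proof. by rewrite exprn_ile1// invf_le1// ler1n. Qed.

Lemma row_sum_id (C : R) L (p : 'I_L) (F : nat -> nat -> R) : 0 <= C ->
  (forall p q, `|F p q| <= C * 2^-1 ^+ p * 2^-1 ^+ q) ->
  \sum_(q < L) `|(p == q)%:R + F p q| <= 1 + C * 2 * 2^-1 ^+ p.
Proof.
move=> C0 H; apply: le_trans (ler_sum _ (fun q _ => ler_normD _ _)) _.
rewrite big_split /=; apply: lerD.
  rewrite (bigD1 p)//= eqxx normr1 big1 ?addr0// => q qp.
  by rewrite eq_sym (negbTE qp) normr0.
rewrite mulrAC; apply: sum_half_le; first by rewrite mulr_ge0.
by move=> q; exact: H.
Qed.

(** The reference matrix [G] is the section of size [N] extended by the identity. The first [N] rows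
    lose only their tails; row i from [N] on is entirely error, of size O(2^-i). *)
Lemma toeplitz_det_cauchy : exists2 M : R, 0 <= M & forall N k,
  `|toeplitz_det (N + k) - toeplitz_det N| <= M * 2^-1 ^+ N.
Proof.
have [C C0 H] := full_entry_bound.
exists (expR (C * 2 * 2) * (C * 8 * expR (C * 8))) => [|N k].
  by rewrite !mulr_ge0 ?expR_ge0.
pose G : 'M[R]_(N + k) := block_mx (\matrix_(p < N, q < N) ((p == q)%:R + X p q)) 0 0 1%:M.
pose F : 'M[R]_(N + k) := \matrix_(p, q) ((p == q)%:R + X p q).
pose e (i : 'I_(N + k)) : R := C * 2 * 2^-1 ^+ (maxn i N).
pose g (i : 'I_(N + k)) : R := 1 + C * 2 * 2^-1 ^+ i.
have dG : \det G = toeplitz_det N by rewrite /G det_lblock det1 mulr1.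
have := @det_perturbation_expR _ G (F - G) g (fun i => C * 2 * 2^-1 ^+ N * 2^-1 ^+ i + (if (i < N)%N then 0 else C * 2 * 2^-1 ^+ i)).
rewrite dG [G + _]addrC subrK -/(toeplitz_det (N + k)) => D.
apply: le_trans (D _ _ _) _.
- move=> i; rewrite /g; case: (split_ordP i) => i' ->.
    rewrite big_split_ord /= [X in _ + X]big1 ?addr0; last first.
      by move=> q _; rewrite block_mxEur mxE normr0.
    under eq_bigr do rewrite block_mxEul mxE.
    exact: row_sum_id.
  rewrite big_split_ord /= big1 ?add0r; last first.
    by move=> q _; rewrite block_mxEdl mxE normr0.
  rewrite (bigD1 i')//= block_mxEdr mxE eqxx normr1 big1 ?addr0.
    by rewrite lerDl !mulr_ge0.
  by move=> q qi; rewrite block_mxEdr mxE eq_sym (negbTE qi) normr0.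
- by move=> i; rewrite /g lerDl !mulr_ge0.
- move=> i; case: (split_ordP i) => i' ->.
    rewrite big_split_ord /= big1 ?add0r; last first.
      by move=> q _; rewrite mxE [(- G) _ _]mxE block_mxEul !mxE subrr normr0.
    rewrite addr0.
    have -> : C * 2 * 2^-1 ^+ N * 2^-1 ^+ i' = C * 2^-1 ^+ i' * 2 * 2^-1 ^+ N :> R by ring.
    apply: sum_half_shift_le; first by rewrite mulr_ge0.
    move=> q; rewrite mxE [(- G) _ _]mxE block_mxEur !mxE subr0 eq_lrshift add0r; exact: H.
  apply: (@le_trans _ _ (C * 2 * 2^-1 ^+ (N + i'))); last by rewrite lerDr !mulr_ge0.
  rewrite mulrAC; apply: sum_half_le; first by rewrite mulr_ge0.
  move=> q; rewrite mxE [(- G) _ _]mxE; case: (split_ordP q) => q' ->.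
    rewrite block_mxEdl !mxE subr0 eq_rlshift add0r; exact: H.
  rewrite block_mxEdr !mxE eq_rshift [_ + X _ _]addrC addrK; exact: H.
rewrite -[leRHS]mulrA; apply: ler_pM.
- by apply: prodr_ge0 => i _; rewrite /g addr_ge0// !mulr_ge0.
- by rewrite subr_ge0 -expR0 ler_expR sumr_ge0// => i _; case: ifP; rewrite ?addr_ge0// !mulr_ge0.
- by apply: (@prod_half_le _ (C * 2)); rewrite mulr_ge0.
have S : \sum_(i < N + k) (C * 2 * 2^-1 ^+ N * 2^-1 ^+ i + (if (i < N)%N then 0 else C * 2 * 2^-1 ^+ i)) <= C * 8 * 2^-1 ^+ N.
  rewrite big_split /=.
  have -> : C * 8 * 2^-1 ^+ N = C * 2 * 2^-1 ^+ N * 2 + C * 2 * 2 * 2^-1 ^+ N :> R by ring.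
  apply: lerD; first by apply: sum_half_le; rewrite ?mulr_ge0.
  rewrite big_split_ord /= big1 ?add0r; last by move=> i _; rewrite ltn_ord.
  apply: sum_half_shift_le; first by rewrite mulr_ge0.
  by move=> i; rewrite ltnNge leq_addr.
apply: (@le_trans _ _ (expR (C * 8 * 2^-1 ^+ N) - 1)); first by rewrite lerD2r ler_expR.
apply: le_trans (expR_sub1_le (X := C * 8) _ _) _; first by rewrite !mulr_ge0.
  by rewrite ler_piMr// mulr_ge0.
by rewrite mulrAC.
Qed.

Lemma section_det_approx : exists2 M : R, 0 <= M & forall n L,
  `|\det (\matrix_(p < L, q < L) ((p == q)%:R + section_entry c theta n p q)) - toeplitz_det L|
   <= M * 2^-1 ^+ n.
Proof.
have [C C0 H] := full_entry_bound.
have [C1 C10 H1] := foldP_convQ_bound c theta.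
exists (expR (C * 2 * 2) * (C1 * 8 * expR (C1 * 8))) => [|n L].
  by rewrite !mulr_ge0 ?expR_ge0.
pose G : 'M[R]_L := \matrix_(p < L, q < L) ((p == q)%:R + X p q).
pose F : 'M[R]_L := \matrix_(p < L, q < L) ((p == q)%:R + section_entry c theta n p q).
have := @det_perturbation_expR _ G (F - G) (fun i => 1 + C * 2 * 2^-1 ^+ i)
   (fun i => C1 * 4 * 2^-1 ^+ n * 2^-1 ^+ i).
rewrite [G + _]addrC subrK -/(toeplitz_det L) => D.
apply: le_trans (D _ _ _) _.
- move=> i; under eq_bigr do rewrite mxE.
  exact: row_sum_id.
- by move=> i; rewrite lerDl !mulr_ge0.
- move=> i.
  have -> : C1 * 4 * 2^-1 ^+ n * 2^-1 ^+ i = C1 * 2 * 2^-1 ^+ n * 2^-1 ^+ i * 2 :> R by ring.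
  apply: sum_half_le => [|j]; first by rewrite !mulr_ge0.
  rewrite !mxE opprD addrACA subrr add0r -normrN opprB.
  have -> : C1 * 2 * 2^-1 ^+ n * 2^-1 ^+ i * 2^-1 ^+ j = C1 * 2^-1 ^+ i * 2^-1 ^+ j * 2 * 2^-1 ^+ n :> R by ring.
  by apply: tsum_nat_tail; rewrite ?mulr_ge0.
rewrite -[leRHS]mulrA; apply: ler_pM.
- by apply: prodr_ge0 => i _; rewrite addr_ge0// !mulr_ge0.
- by rewrite subr_ge0 -expR0 ler_expR sumr_ge0// => i _; rewrite !mulr_ge0.
- by apply: (@prod_half_le _ (C * 2)); rewrite mulr_ge0.
apply: (@le_trans _ _ (expR (C1 * 8 * 2^-1 ^+ n) - 1)).
  rewrite lerD2r ler_expR.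
  have -> : C1 * 8 * 2^-1 ^+ n = C1 * 4 * 2^-1 ^+ n * 2 :> R by ring.
  by apply: sum_half_le; rewrite ?mulr_ge0.
apply: le_trans (expR_sub1_le (X := C1 * 8) _ _) _; first by rewrite !mulr_ge0.
  by rewrite ler_piMr// mulr_ge0.
by rewrite mulrAC.
Qed.

(** Uniformity in the size [k] is what later excludes the limit 0 for [toeplitz_det]. *)
Lemma tail_det_bound : exists M : R, forall L k, `|tail_det L k| <= M.
Proof.
have [C C0 H] := fold_kernel_bound c theta.
exists (expR (C * 2 * 2)) => L k.
have nM (x y : R) : `|x * y| <= `|x| * `|y| by rewrite normrM.
have n1 : `|1 : R| <= 1 by rewrite normr1.
have := @norm_det_le R R (fun x => `|x|) (normr0 R) (@normr_ge0 _ _) (@ler_normD _ _)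
  nM n1 (@normrN _ _) k (\matrix_(i < k, j < k) Y (L + i) (L + j)).
move=> /le_trans; apply; apply: le_trans (prod_half_le k _); last by rewrite mulr_ge0.
apply: ler_prod => i _; rewrite sumr_ge0//=.
apply: (@le_trans _ _ (\sum_(j < k) `|(i == j)%:R + - fold_kernel c theta (L + i) (L + j)|)).
  apply: ler_sum => j _; rewrite mxE /Y /fredholm_entry eqn_add2l.
  by rewrite -val_eqE.
apply: (@row_sum_id _ _ _ (fun i j => - fold_kernel c theta (L + i) (L + j))) => // p q.
rewrite normrN; apply: le_trans (H _ _) _; rewrite -!mulrA ler_wpM2l//.
by apply: ler_pM => //; rewrite exprD ler_piMl.
Qed.

(** The complementary minor argument for sections: [Z] consists of unit columns followed by columns
    of [Y], and multiplying the section of 1 + [X] by it gives a nearly block triangular matrix. The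
    only error is the truncation of the product of [X] and [Y] at [N = L + k]. *)
Lemma Borodin_Okounkov_approx : exists2 M : R, 0 <= M & forall L k,
  `|toeplitz_det (L + k) * tail_det L k - toeplitz_det L| <= M * 2^-1 ^+ (L + k).
Proof.
have [C C0 H] := full_entry_bound.
have [C1 C10 H1] := fold_kernel_bound c theta.
pose B := C * C1.
have B0 : 0 <= B by rewrite mulr_ge0.
exists (expR (C * 2 * 2) * (B * 8 * expR (B * 8))) => [|L k].
  by rewrite !mulr_ge0 ?expR_ge0.
set N := (L + k)%N.
pose Z : 'M[R]_N := block_mx 1%:M (\matrix_(i < L, j < k) Y i (L + j)) 0
   (\matrix_(i < k, j < k) Y (L + i) (L + j)).
pose F : 'M[R]_N := \matrix_(p, q) ((p == q)%:R + X p q).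
pose G : 'M[R]_N := block_mx (\matrix_(p < L, q < L) ((p == q)%:R + X p q)) 0
   (\matrix_(p < k, q < L) X (L + p) q) 1%:M.
have dG : \det G = toeplitz_det L by rewrite /G det_lblock det1 mulr1.
have dFZ : \det (F *m Z) = toeplitz_det N * tail_det L k.
  by rewrite det_mulmx /Z det_ublock det1 mul1r.
have ZY (q : 'I_N) (j : 'I_k) : Z q (rshift L j) = Y q (L + j).
  by case: (split_ordP q) => q' ->; rewrite ?block_mxEur ?block_mxEdr mxE.
have ZI (q : 'I_N) (j : 'I_L) : Z q (lshift k j) = (q == lshift k j)%:R.
  case: (split_ordP q) => q' ->; rewrite ?block_mxEul ?block_mxEdl mxE.
    by rewrite eq_lshift.
  by rewrite eq_rlshift.
have E1 (p : 'I_N) (j : 'I_L) : (F *m Z) p (lshift k j) = G p (lshift k j).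
  rewrite mxE (bigD1 (lshift k j))//= ZI eqxx mulr1 big1 ?addr0; last first.
    by move=> q qj; rewrite ZI (negbTE qj) mulr0.
  rewrite mxE; case: (split_ordP p) => p' ->; rewrite ?block_mxEul ?block_mxEdl mxE.
    by rewrite eq_lshift.
  by rewrite eq_rlshift add0r.
have E2 (p : 'I_N) (j : 'I_k) : `|(F *m Z - G) p (rshift L j)| <= B * 2 * 2^-1 ^+ N * 2^-1 ^+ (L + j) * 2^-1 ^+ p.
  have [s t] := full_inverse_kernel c theta p (L + j).
  have GE : G p (rshift L j) = (p == (L + j)%N :> nat)%:R.
    case: (split_ordP p) => p' ->; rewrite ?block_mxEur ?block_mxEdr mxE /=.
      by have -> : (p' == L + j :> nat)%N = false by have := ltn_ord p'; lia.
    by rewrite eqn_add2l -val_eqE.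
  have FZE : (F *m Z) p (rshift L j) = Y p (L + j) + \sum_(q < N) X p q * Y q (L + j).
    rewrite mxE; under eq_bigr do rewrite ZY mxE mulrDl.
    rewrite big_split /= (bigD1 p)//= eqxx mul1r big1 ?addr0// => q qp.
    by rewrite eq_sym (negbTE qp) mul0r.
  rewrite mxE [(- G) _ _]mxE GE FZE -t opprD addrACA.
  rewrite [X in `|X|](_ : _ = - (tsum (fun q : nat => X p q * Y q (L + j)) - \sum_(q < N) X p q * Y q (L + j))); last by rewrite /Y /X; ring.
  rewrite normrN.
  pose f q := X p q * - fold_kernel c theta q (L + j).
  have fB q : `|f q| <= B * 2^-1 ^+ (L + j) * 2^-1 ^+ p * 2^-1 ^+ q.
    rewrite /f normrM normrN; apply: le_trans (ler_pM _ _ (H _ _) (H1 _ _)) _ => //.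
    have -> : C * 2^-1 ^+ p * 2^-1 ^+ q * (C1 * 2^-1 ^+ q * 2^-1 ^+ (L + j)) =
      B * 2^-1 ^+ (L + j) * 2^-1 ^+ p * 2^-1 ^+ q * 2^-1 ^+ q by rewrite /B; ring.
    by rewrite ler_piMr// !mulr_ge0.
  have XYE q : X p q * Y q (L + j) = (q == L + j)%N%:R * X p q + f q.
    by rewrite /f /Y /fredholm_entry; ring.
  have sf : abs_summable f by exact: abs_summable_half_bound fB.
  have [||s1 t1] := @tsum_seq R nat [:: (L + j)%N] (fun q => (q == L + j)%N%:R * X p q).
  - by [].
  - by move=> q; rewrite inE => /negbTE ->; rewrite mul0r.
  (* The diagonal part of [Y] sits at [q = L + j], below [N], so it contributes equally to the
     series and to the truncated sum. *)
  have -> : tsum (fun q => X p q * Y q (L + j)) - \sum_(q < N) X p q * Y q (L + j) =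
      tsum f - \sum_(q < N) f q.
    under eq_bigr do rewrite XYE.
    under eq_fun do rewrite XYE.
    rewrite tsumD// t1 big_seq1 eqxx mul1r big_split /= opprD addrACA.
    rewrite [X in _ - X](_ : _ = X p (L + j)) ?subrr ?add0r//.
    rewrite (bigD1 (rshift L j))//= eqxx mul1r big1 ?addr0// => q qj.
    case: eqP => E; last by rewrite mul0r.
    by move/eqP: qj; case; apply: val_inj.
  have -> : B * 2 * 2^-1 ^+ N * 2^-1 ^+ (L + j) * 2^-1 ^+ p =
    B * 2^-1 ^+ (L + j) * 2^-1 ^+ p * 2 * 2^-1 ^+ N by ring.
  by apply: tsum_nat_tail; rewrite ?mulr_ge0.
(* Transposed, so that rows are columns of the product: the first [L] carry no error, and the last
   [k] columns of [G] are unit vectors. *)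
have := @det_perturbation_expR _ G^T (F *m Z - G)^T (fun i => 1 + C * 2 * 2^-1 ^+ i)
   (fun i => B * 4 * 2^-1 ^+ N * 2^-1 ^+ i).
rewrite -linearD /= [G + _]addrC subrK !det_tr dFZ dG => D.
apply: le_trans (D _ _ _) _.
- move=> i; under eq_bigr do rewrite mxE.
  case: (split_ordP i) => i' ->.
    apply: le_trans (@row_sum_id C N (lshift k i') (fun q p => X p q) C0 _); last first.
      by move=> p q; rewrite mulrAC.
    rewrite le_eqVlt; apply/orP; left; apply/eqP; apply: eq_bigr => p _; congr (`|_|).
    rewrite -E1 mxE (bigD1 (lshift k i'))//= ZI eqxx mulr1 big1 ?addr0; last first.
      by move=> q qj; rewrite ZI (negbTE qj) mulr0.
    by rewrite mxE eq_sym.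
  rewrite big_split_ord /= big1 ?add0r; last first.
    by move=> q _; rewrite block_mxEur mxE normr0.
  rewrite (bigD1 i')//= block_mxEdr mxE eqxx normr1 big1 ?addr0.
    by rewrite lerDl !mulr_ge0.
  by move=> q qi; rewrite block_mxEdr mxE (negbTE qi) normr0.
- by move=> i; rewrite lerDl !mulr_ge0.
- move=> i; under eq_bigr do rewrite mxE.
  case: (split_ordP i) => i' ->.
    rewrite big1 ?mulr_ge0// => p _.
    by rewrite mxE [(- G) _ _]mxE E1 subrr normr0.
  have -> : B * 4 * 2^-1 ^+ N * 2^-1 ^+ (rshift L i') = B * 2 * 2^-1 ^+ N * 2^-1 ^+ (L + i') * 2 :> R by rewrite /=; ring.
  by apply: sum_half_le => [|p]; [rewrite !mulr_ge0|exact: E2].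
rewrite -[leRHS]mulrA; apply: ler_pM.
- by apply: prodr_ge0 => i _; rewrite addr_ge0// !mulr_ge0.
- by rewrite subr_ge0 -expR0 ler_expR sumr_ge0// => i _; rewrite !mulr_ge0.
- by apply: (@prod_half_le _ (C * 2)); rewrite mulr_ge0.
apply: (@le_trans _ _ (expR (B * 8 * 2^-1 ^+ N) - 1)).
  rewrite lerD2r ler_expR.
  have -> : B * 8 * 2^-1 ^+ N = B * 4 * 2^-1 ^+ N * 2 :> R by ring.
  by apply: sum_half_le; rewrite ?mulr_ge0.
apply: le_trans (expR_sub1_le (X := B * 8) _ _) _; first by rewrite !mulr_ge0.
  by rewrite ler_piMr// mulr_ge0.
by rewrite mulrAC.
Qed.
End det_limits.

(** * Probabilities as limits of finite determinants *)

Section probabilities.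
Variable R : realType.

Lemma cvg_dist_le (T : Type) (F : set_system T) {FF : Filter F} (f v : T -> R) (l : R) :
  (\forall t \near F, `|f t - l| <= v t) -> v @ F --> 0 -> f @ F --> l.
Proof.
move=> fv v0.
 apply: (squeeze_cvgr (f := fun t => l - v t) (h := fun t => l + v t)).
- apply: filterS fv => t; rewrite ler_distl => /andP[H1 H2]; apply/andP; split; lra.
- by rewrite -[X in _ --> X]subr0; apply: cvgB => //; exact: cvg_cst.
- by rewrite -[X in _ --> X]addr0; apply: cvgD => //; exact: cvg_cst.
Qed.

Lemma cvg_half (M : R) : (fun n => M * 2^-1 ^+ n) @ \oo --> 0.
Proof.
rewrite -[X in _ --> X](mulr0 M); apply: cvgM; first exact: cvg_cst.
by apply: cvg_expr; rewrite ger0_norm// invf_lt1// ltr1n.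
Qed.

Lemma sum_partitions_of_eq (F G : seq nat -> R) m :
  (forall lam, is_partition lam -> sumn lam = m -> F lam = G lam) ->
  sum_partitions_of m F = sum_partitions_of m G.
Proof.
move=> FG; apply: eq_bigr => k _; apply: eq_bigr => t /andP[tp /eqP ts].
exact: FG.
Qed.

Lemma part1_le_sumn lam : (part1 lam <= sumn lam)%N.
Proof. by case: lam => //= a s; exact: leq_addr. Qed.

Variables (c : bool) (theta : R).
Let D := toeplitz_det c theta.
Let S L N := \sum_(m < N) sum_partitions_of m
    (fun lam => if (part1 lam <= L)%N then weight c theta lam else 0).

Lemma toeplitz_det0 : D 0%N = 1.
Proof. by rewrite /D /toeplitz_det det_mx00. Qed.

(** For the limit to be nonzero, the case L = 0 of [Borodin_Okounkov_approx] suffices: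
    [toeplitz_det] times a bounded factor tends to 1. *)
Lemma toeplitz_det_cvg : exists2 Z : R, Z != 0 & D @ \oo --> Z.
Proof.
have [M M0 HM] := toeplitz_det_cauchy c theta.
pose d k := D k.+1 - D k.
have dB k : `|d k| <= M * 2^-1 ^+ k by rewrite /d -addn1; exact: HM.
have DE n : D n = 1 + \sum_(k < n) d k.
  elim: n => [|n IH]; first by rewrite big_ord0 addr0 toeplitz_det0.
  by rewrite big_ord_recr /= addrA -IH /d addrCA subrr addr0.
have DZ : D @ \oo --> 1 + tsum d.
  apply: (cvg_dist_le _ (cvg_half (M * 2))); apply: nearW => n.
  rewrite DE opprD addrACA subrr add0r -normrN opprB.
  exact: tsum_nat_tail.
exists (1 + tsum d) => //; apply/negP => /eqP Z0; rewrite Z0 in DZ.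
have [M1 M10 HBO] := Borodin_Okounkov_approx c theta.
have [M2 HM2] := tail_det_bound c theta.
have cv1 : (fun k => D k * tail_det c theta 0 k) @ \oo --> (1 : R).
  apply: (cvg_dist_le _ (cvg_half M1)); apply: nearW => k.
  by have := HBO 0%N k; rewrite add0n -[toeplitz_det c theta 0]/(D 0%N) toeplitz_det0.
have cv0 : (fun k => D k * tail_det c theta 0 k) @ \oo --> (0 : R).
  apply: (cvg_dist_le (v := fun k => `|D k| * M2)).
    by apply: nearW => k; rewrite subr0 normrM ler_wpM2l.
  rewrite -[X in _ --> X](mul0r M2); apply: cvgM; last exact: cvg_cst.
  by rewrite -[X in _ --> X](normr0 R); apply: cvg_norm.
have E : (1 : R) = 0 by exact: (cvg_unique (@Rhausdorff R) cv1 cv0).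
by move/eqP: E; rewrite oner_eq0.
Qed.

Lemma section_cvg (L : nat) :
  S L @ \oo --> D L.
Proof.
have [M HM] := sum_partitions_approx c theta.
have [M1 M10 HM1] := section_det_approx c theta.
apply: (cvg_dist_le _ (cvg_half (M + M1))); apply: nearW => N.
have := HM N L N (leqnn N); have := HM1 N L.
set E := \det _ => H1 H2.
have -> : S L N - D L = (S L N - E) + (E - D L) by rewrite addrA subrK.
by apply: le_trans (ler_normD _ _) _; rewrite mulrDl; apply: lerD; rewrite // exprVn.
Qed.

(** A partition of size below [N] satisfies lambda_1 <= N automatically, so the full partial sum is
    the one restricted to L = N; all error bounds are uniform in L, which permits this diagonal
    choice. *)
Lemma total_cvg (Z : R) : D @ \oo --> Z ->
  (fun N => \sum_(m < N) sum_partitions_of m (weight c theta)) @ \oo --> Z.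
Proof.
move=> DZ.
have [M HM] := sum_partitions_approx c theta.
have [M1 M10 HM1] := section_det_approx c theta.
apply: (cvg_sub0 _ DZ).
apply: (cvg_dist_le _ (cvg_half (M + M1))); apply: nearW => N /=.
have := HM N N N (leqnn N); have := HM1 N N; rewrite -/(S N N).
have <- : \sum_(m < N) sum_partitions_of m (weight c theta) = S N N.
  apply: eq_bigr => m _; apply: sum_partitions_of_eq => lam _ ls.
  by rewrite (leq_trans (part1_le_sumn _))// ls ltnW.
set E := \det _ => H1 H2.
rewrite subr0; set T := \sum_(m < N) _ in H2 *.
rewrite -[X in `|X|]/(T - D N).
have -> : T - D N = (T - E) + (E - D N) by rewrite addrA subrK.
by apply: le_trans (ler_normD _ _) _; rewrite mulrDl; apply: lerD; rewrite // exprVn.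
Qed.

Definition prob (E : seq nat -> bool) : R := if c then P_sp theta E else P_o theta E.

Lemma probE (Z : R) (E : seq nat -> bool) L : D @ \oo --> Z ->
  (forall lam, E lam = (part1 lam <= L)%N) -> prob E = D L / Z.
Proof.
move=> DZ EL.
have tot : sum_partitions (fun lam => if is_partition lam then weight c theta lam else 0) = Z.
  apply: (cvg_lim (@Rhausdorff R)); apply: cvg_trans (total_cvg DZ); apply: near_eq_cvg.
  apply: nearW => N; apply: eq_bigr => m _; apply: sum_partitions_of_eq => lam -> //.
have res : sum_partitions (fun lam => if E lam then weight c theta lam else 0) = D L.
  apply: (cvg_lim (@Rhausdorff R)); apply: cvg_trans (@section_cvg L); apply: near_eq_cvg.
  apply: nearW => N; apply: eq_bigr => m _; apply: sum_partitions_of_eq => lam _ _.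
  by rewrite EL.
by move: tot res; rewrite /prob /P_sp /P_o /Z_sp /Z_o /weight; case: (c) => -> ->.
Qed.

(** With [L] fixed, [toeplitz_det] of size [L + k] tends to the nonzero total weight, by which the
    approximate identity is divided. *)
Lemma tail_det_cvg (E : seq nat -> bool) L :
  (forall lam, E lam = (part1 lam <= L)%N) ->
  (fun k => tail_det c theta L k) @ \oo --> prob E.
Proof.
move=> EL; have [Z Z0 DZ] := toeplitz_det_cvg.
rewrite (probE DZ EL).
have [M M0 HM] := Borodin_Okounkov_approx c theta.
have DLk : (fun k => D (L + k)%N) @ \oo --> Z.
  have := DZ; rewrite -(cvg_shiftn L) => H.
  by apply: cvg_trans H; apply: near_eq_cvg; apply: nearW => k /=; rewrite addnC.
have num : (fun k => D (L + k)%N * tail_det c theta L k) @ \oo --> D L.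
  apply: (cvg_dist_le _ (cvg_half M)); apply: nearW => k.
  apply: le_trans (HM L k) _; rewrite ler_wpM2l//.
  by apply: ler_wiXn2l; rewrite ?invr_ge0// ?invf_le1// ?ler1n// leq_addl.
apply: cvg_trans (cvgM num (cvgV Z0 DLk)); apply: near_eq_cvg.
have : \forall k \near \oo, D (L + k)%N != 0 by apply: (cvgr_neq0 Z).
apply: filterS => k Dk /=.
by rewrite mulrAC mulfV// mul1r.
Qed.
End probabilities.

(** * Calculus *)

Section derivative_rules.
Variable R : realType.
Implicit Types f g : R -> R.

(* Not a class, so that [apply] leaves it as a goal instead of inferring an instance. *)
Definition has_der f (x a : R) := is_derive x 1 f a.

Lemma der_eq f (x a b : R) : has_der f x a -> a = b -> is_derive x 1 f b.
Proof. by move=> H <-. Qed.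

Lemma der_cst (k x : R) : has_der (fun _ : R => k) x 0.
Proof. exact: is_derive_cst. Qed.

Lemma der_id (x : R) : has_der (fun t : R => t) x 1.
Proof. exact: is_derive_id. Qed.

Lemma der_D f g (x a b : R) : has_der f x a -> has_der g x b ->
  has_der (fun t => f t + g t) x (a + b).
Proof. by move=> fa gb; exact: is_deriveD. Qed.

Lemma der_N f (x a : R) : has_der f x a -> has_der (fun t => - f t) x (- a).
Proof. by move=> fa; exact: is_deriveN. Qed.

Lemma der_M f g (x a b : R) : has_der f x a -> has_der g x b ->
  has_der (fun t => f t * g t) x (f x * b + g x * a).
Proof. by move=> fa gb; exact: is_deriveM. Qed.

Lemma der_comp f g (x a b : R) : has_der f (g x) a -> has_der g x b ->
  has_der (fun t => f (g t)) x (a * b).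
Proof. by move=> fa gb; exact: is_derive1_comp. Qed.

Lemma der_X n f (x a : R) : has_der f x a ->
  has_der (fun t => f t ^+ n) x (n%:R * f x ^+ n.-1 * a).
Proof.
move=> fa; have -> : (fun t => f t ^+ n) = f ^+ n.
  by apply/funext => t; elim: n => [|n IH]; rewrite ?expr0// !exprS IH.
exact: is_deriveX.
Qed.

Lemma der_V f (x a : R) : f x != 0 -> has_der f x a ->
  has_der (fun t => (f t)^-1) x (- a / f x ^+ 2).
Proof.
move=> fx [df <-]; apply: DeriveDef; first exact: derivableV.
by rewrite deriveV// /GRing.scale /= mulNr mulrC -mulNr.
Qed.

Lemma der_sin f (x a : R) : has_der f x a ->
  has_der (fun t => sin (f t)) x (cos (f x) * a).
Proof. by move=> fa; exact: (der_comp (is_derive_sin (f x)) fa). Qed.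

Lemma der_cos f (x a : R) : has_der f x a ->
  has_der (fun t => cos (f t)) x (- sin (f x) * a).
Proof. by move=> fa; exact: (der_comp (is_derive_cos (f x)) fa). Qed.

Lemma der_exp f (x a : R) : has_der f x a ->
  has_der (fun t => expR (f t)) x (expR (f x) * a).
Proof. by move=> fa; exact: (der_comp (is_derive_expR (f x)) fa). Qed.

Lemma is_derive_continuous f (x a : R) : is_derive x 1 f a -> {for x, continuous f}.
Proof. by move=> [fa _]; apply: differentiable_continuous; apply/derivable1_diffP. Qed.

(* A wrapper keeping this condition out of the typeclass search for [is_derive]. *)
Definition derives_on f f' (a b : R) := forall x, a <= x <= b -> is_derive x 1 f (f' x).

Lemma nondecreasing_by_derive f f' (a b : R) : a <= b ->
  derives_on f f' a b ->
  (forall x, a <= x <= b -> 0 <= f' x) -> f a <= f b.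
Proof.
move=> ab fd f0.
have [||c cab E] := @MVT_segment R f f' a b ab.
- by move=> x; rewrite in_itv/= => /andP[ax xb]; apply: fd; rewrite !ltW.
- apply: continuous_in_subspaceT => x; rewrite inE/= in_itv/= => xab.
  exact: is_derive_continuous (fd x xab).
rewrite -subr_ge0 E mulr_ge0 ?subr_ge0//; apply: f0.
by move: cab; rewrite in_itv.
Qed.

Lemma derive_bound f f' (M a b : R) : a <= b ->
  derives_on f f' a b ->
  (forall x, a <= x <= b -> `|f' x| <= M) -> `|f b - f a| <= M * (b - a).
Proof.
move=> ab fd fM.
have [||c cab ->] := @MVT_segment R f f' a b ab.
- by move=> x; rewrite in_itv/= => /andP[ax xb]; apply: fd; rewrite !ltW.
- apply: continuous_in_subspaceT => x; rewrite inE/= in_itv/= => xab.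
  exact: is_derive_continuous (fd x xab).
rewrite normrM [`|b - a|]ger0_norm ?subr_ge0// ler_wpM2r ?subr_ge0//.
by apply: fM; move: cab; rewrite in_itv.
Qed.

End derivative_rules.

Ltac der := repeat first
  [ apply: der_id | apply: der_cst | apply: der_D | apply: der_N | apply: der_M
  | apply: der_X | apply: der_sin | apply: der_cos | apply: der_exp | apply: der_V ].

Section elementary_bounds.
Variable R : realType.
Implicit Types x : R.

(** Applied repeatedly below: starting from cos <= 1, each Taylor bound for sine or cosine is the
    derivative of the next. *)
Lemma nonneg_by_derive (f f' : R -> R) (b x : R) : f 0 = 0 ->
  derives_on f f' 0 b ->
  (forall x, 0 <= x <= b -> 0 <= f' x) -> 0 <= x <= b -> 0 <= f x.
Proof.
move=> f0 fd f'0 /andP[x0 xb]; rewrite -f0.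
apply: (nondecreasing_by_derive (f' := f')) => // y /andP[y0 yx].
  by apply: fd; rewrite y0 (le_trans yx).
by apply: f'0; rewrite y0 (le_trans yx).
Qed.

Lemma sin_le_id x : 0 <= x -> sin x <= x.
Proof.
move=> x0; rewrite -subr_ge0.
apply: (@nonneg_by_derive (fun t => t - sin t) (fun t => 1 - cos t) x); last by rewrite x0 lexx.
- by rewrite sin0 subr0.
- by move=> y _; apply: der_eq; [der|ring].
- by move=> y _; rewrite subr_ge0 cos_le1.
Qed.

Lemma cos_ge x : 0 <= x -> 1 - x ^+ 2 / 2 <= cos x.
Proof.
move=> x0; rewrite -subr_ge0.
apply: (@nonneg_by_derive (fun t => cos t - (1 - t ^+ 2 / 2)) (fun t => t - sin t) x); last by rewrite x0 lexx.
- by rewrite cos0; ring.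
- by move=> y _; apply: der_eq; [der|rewrite /=; field].
- by move=> y /andP[y0 _]; rewrite subr_ge0 sin_le_id.
Qed.

Lemma sin_ge x : 0 <= x -> x - x ^+ 3 / 6 <= sin x.
Proof.
move=> x0; rewrite -subr_ge0.
apply: (@nonneg_by_derive (fun t => sin t - (t - t ^+ 3 / 6)) (fun t => cos t - (1 - t ^+ 2 / 2)) x); last by rewrite x0 lexx.
- by rewrite sin0; ring.
- by move=> y _; apply: der_eq; [der|rewrite /=; field].
- by move=> y /andP[y0 _]; rewrite subr_ge0 cos_ge.
Qed.

Lemma cos_le x : 0 <= x -> cos x <= 1 - x ^+ 2 / 2 + x ^+ 4 / 24.
Proof.
move=> x0; rewrite -subr_ge0.
apply: (@nonneg_by_derive (fun t => 1 - t ^+ 2 / 2 + t ^+ 4 / 24 - cos t)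
  (fun t => sin t - (t - t ^+ 3 / 6)) x); last by rewrite x0 lexx.
- by rewrite cos0; ring.
- by move=> y _; apply: der_eq; [der|rewrite /=; field].
- by move=> y /andP[y0 _]; rewrite subr_ge0 sin_ge.
Qed.

Lemma sin_le x : 0 <= x -> sin x <= x - x ^+ 3 / 6 + x ^+ 5 / 120.
Proof.
move=> x0; rewrite -subr_ge0.
apply: (@nonneg_by_derive (fun t => t - t ^+ 3 / 6 + t ^+ 5 / 120 - sin t)
  (fun t => 1 - t ^+ 2 / 2 + t ^+ 4 / 24 - cos t) x); last by rewrite x0 lexx.
- by rewrite sin0; ring.
- by move=> y _; apply: der_eq; [der|rewrite /=; field].
- by move=> y /andP[y0 _]; rewrite subr_ge0 cos_le.
Qed.

(** 1 - cos x = 2 (sin (x/2))^2, and sin y >= y - y^3/6 >= y/3 for y <= 2; hence the constant 2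
    (1/6)^2 = 1/18. *)
Lemma one_sub_cos_ge x : 0 <= x <= pi -> x ^+ 2 / 18 <= 1 - cos x.
Proof.
move=> /andP[x0 xpi].
have xE : x = x / 2 + x / 2 by field.
rewrite [in leRHS]xE cosD.
have p2 := @pihalf_lt2 R.
have y0 : 0 <= x / 2 by lra.
have y2 : x / 2 <= 2 by lra.
have := sin_ge y0; have := cos2Dsin2 (x / 2).
set y := x / 2 in y0 y2 *; set s := sin y; set c := cos y => cs sy.
have s3 : y / 3 <= s by nra.
have -> : x = 2 * y by rewrite /y; field.
nra.
Qed.

(** The third derivative of the difference of the two sides is 6 e^K - e^x - e^{-x}, nonnegative on
    [0, K]; three integrations from 0 give the bound. *)
Lemma sinh_le (K x : R) : 0 <= x <= K ->
  expR x - expR (- x) <= 2 * x + x ^+ 3 * expR K.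
Proof.
move=> xK; rewrite -subr_ge0.
have eK0 := expR_gt0 K.
have h3 y : 0 <= y <= K -> 0 <= 6 * expR K - expR y - expR (- y).
  move=> /andP[y0 yK].
  have : expR y <= expR K by rewrite ler_expR.
  have : expR (- y) <= expR K by rewrite ler_expR; lra.
  by lra.
have h2 y : 0 <= y <= K -> 0 <= 6 * y * expR K - expR y + expR (- y).
  apply: (@nonneg_by_derive (fun t => 6 * t * expR K - expR t + expR (- t))
     (fun y => 6 * expR K - expR y - expR (- y)) K) => //.
  - by rewrite oppr0; ring.
  - by move=> z _; apply: der_eq; [der|rewrite /=; ring].
have h1 y : 0 <= y <= K -> 0 <= 2 + 3 * y ^+ 2 * expR K - expR y - expR (- y).
  apply: (@nonneg_by_derive (fun t => 2 + 3 * t ^+ 2 * expR K - expR t - expR (- t))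
     (fun y => 6 * y * expR K - expR y + expR (- y)) K) => //.
  - by rewrite oppr0 expR0; ring.
  - by move=> z _; apply: der_eq; [der|rewrite /=; ring].
apply: (@nonneg_by_derive (fun t => 2 * t + t ^+ 3 * expR K - (expR t - expR (- t)))
     (fun y => 2 + 3 * y ^+ 2 * expR K - expR y - expR (- y)) K) => //.
- by rewrite oppr0 expR0; ring.
- by move=> z _; apply: der_eq; [der|rewrite /=; ring].
Qed.

Lemma sinh_ge x : 0 <= x -> 2 * x <= expR x - expR (- x).
Proof.
move=> x0; rewrite -subr_ge0.
apply: (@nonneg_by_derive (fun t => expR t - expR (- t) - 2 * t)
  (fun t => expR t + expR (- t) - 2) x); last by rewrite x0 lexx.
- by rewrite oppr0 expR0; ring.
- by move=> z _; apply: der_eq; [der|rewrite /=; ring].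
move=> y _; rewrite expRN; have := expR_gt0 y; set e := expR y => e0.
have -> : e + e^-1 - 2 = (e - 1) ^+ 2 / e by field; rewrite gt_eqF.
by rewrite divr_ge0 ?sqr_ge0// ltW.
Qed.

(* Partial sums of the real and imaginary parts of [exp (a e^{i t})]. *)
Definition cexp_re (t : R) N (a : R) : R := \sum_(k < N) a ^+ k / k`!%:R * cos (k%:R * t).
Definition cexp_im (t : R) N (a : R) : R := \sum_(k < N) a ^+ k / k`!%:R * sin (k%:R * t).

Lemma der_exp_term k (a : R) :
  is_derive a 1 (fun t : R => t ^+ k.+1 / k.+1`!%:R) (a ^+ k / k`!%:R).
Proof.
apply: der_eq; first by der.
rewrite /= factS natrM; have : (k`!%:R : R) != 0 by rewrite pnatr_eq0 -lt0n fact_gt0.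
have : (k.+1%:R : R) != 0 by rewrite pnatr_eq0.
move: (k.+1%:R : R) (k`!%:R : R) => u v h1 h2; field; by rewrite h1 h2.
Qed.

(** The derivative in a of a partial sum of exp (a e^{it}) is e^{it} times the partial sum with one
    term less; this is its real part. *)
Lemma der_cexp_re t N (a : R) : is_derive a 1 (cexp_re t N.+1)
  (cos t * cexp_re t N a - sin t * cexp_im t N a).
Proof.
elim: N => [|N IH].
  rewrite /cexp_re /cexp_im !big_ord0 !mulr0 subr0.
  have -> : (fun x : R => \sum_(k < 1) x ^+ k / k`!%:R * cos (k%:R * t)) = (fun _ => 1).
    by apply/funext => x; rewrite big_ord1 /= mul0r cos0 expr0 fact0 mulr1 divr1.
  exact: der_cst.
have -> : cexp_re t N.+2 = (fun x => cexp_re t N.+1 x + x ^+ N.+1 / N.+1`!%:R * cos (N.+1%:R * t)).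
  by apply/funext => x; rewrite /cexp_re big_ord_recr.
apply: der_eq.
  apply: der_D; first exact: IH.
  apply: der_M; [exact: der_exp_term|exact: der_cst].
rewrite /cexp_re /cexp_im !big_ord_recr /= -/(cexp_re t N a) -/(cexp_im t N a).
have -> : N.+1%:R * t = N%:R * t + t by rewrite -natr1 mulrDl mul1r.
by rewrite cosD; ring.
Qed.

Lemma der_cexp_im t N (a : R) : is_derive a 1 (cexp_im t N.+1)
  (sin t * cexp_re t N a + cos t * cexp_im t N a).
Proof.
elim: N => [|N IH].
  rewrite /cexp_re /cexp_im !big_ord0 !mulr0 addr0.
  have -> : (fun x : R => \sum_(k < 1) x ^+ k / k`!%:R * sin (k%:R * t)) = (fun _ => 0).
    by apply/funext => x; rewrite big_ord1 /= mul0r sin0 mulr0.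
  exact: der_cst.
have -> : cexp_im t N.+2 = (fun x => cexp_im t N.+1 x + x ^+ N.+1 / N.+1`!%:R * sin (N.+1%:R * t)).
  by apply/funext => x; rewrite /cexp_im big_ord_recr.
apply: der_eq.
  apply: der_D; first exact: IH.
  apply: der_M; [exact: der_exp_term|exact: der_cst].
rewrite /cexp_re /cexp_im !big_ord_recr /= -/(cexp_re t N a) -/(cexp_im t N a).
have -> : N.+1%:R * t = N%:R * t + t by rewrite -natr1 mulrDl mul1r.
by rewrite sinD; ring.
Qed.

Lemma cexp_re0 t N : cexp_re t N.+1 0 = 1.
Proof.
rewrite /cexp_re big_ord_recl /= mul0r cos0 expr0 fact0 mulr1 divr1 big1 ?addr0// => i _.
by rewrite expr0n /= mul0r mul0r.
Qed.

Lemma cexp_im0 t N : cexp_im t N.+1 0 = 0.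
Proof.
rewrite /cexp_im big_ord_recl /= mul0r sin0 mulr0 big1 ?addr0// => i _.
by rewrite expr0n /= mul0r mul0r.
Qed.

Lemma mulr_norm_le1 (x y : R) : `|y| <= 1 -> `|x * y| <= `|x|.
Proof. by move=> y1; rewrite normrM ler_piMr. Qed.

(* Multiplying by [exp (- a e^{i t})] leaves a derivative consisting of the last term only. *)
Lemma cexp_approx t N (a : R) : exists p q : R,
  [/\ cexp_re t N.+1 a = expR (a * cos t) * (p * cos (a * sin t) - q * sin (a * sin t)),
      cexp_im t N.+1 a = expR (a * cos t) * (p * sin (a * sin t) + q * cos (a * sin t)),
      `|p - 1| <= expR `|a| * (`|a| ^+ N / N`!%:R) * 2 * `|a| &
      `|q| <= expR `|a| * (`|a| ^+ N / N`!%:R) * 2 * `|a| ].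
Proof.
pose p (x : R) := expR (- (x * cos t)) * (cexp_re t N.+1 x * cos (x * sin t) + cexp_im t N.+1 x * sin (x * sin t)).
pose q (x : R) := expR (- (x * cos t)) * (cexp_im t N.+1 x * cos (x * sin t) - cexp_re t N.+1 x * sin (x * sin t)).
have cs (x : R) := cos2Dsin2 x.
have eE (x : R) : expR x * expR (- x) = 1 by exact: expRxMexpNx_1.
pose p' (x : R) := - (expR (- (x * cos t)) * (x ^+ N / N`!%:R *
    (cos (N.+1%:R * t) * cos (x * sin t) + sin (N.+1%:R * t) * sin (x * sin t)))).
pose q' (x : R) := - (expR (- (x * cos t)) * (x ^+ N / N`!%:R *
    (sin (N.+1%:R * t) * cos (x * sin t) - cos (N.+1%:R * t) * sin (x * sin t)))).
have NE : N.+1%:R * t = N%:R * t + t by rewrite -natr1 mulrDl mul1r.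
have reS (x : R) : cexp_re t N.+1 x = cexp_re t N x + x ^+ N / N`!%:R * cos (N%:R * t).
  by rewrite /cexp_re big_ord_recr.
have imS (x : R) : cexp_im t N.+1 x = cexp_im t N x + x ^+ N / N`!%:R * sin (N%:R * t).
  by rewrite /cexp_im big_ord_recr.
have dp (x : R) : is_derive x 1 p (p' x).
  apply: der_eq.
    apply: der_M; first by der.
    apply: der_D; apply: der_M; try exact: der_cexp_re; try exact: der_cexp_im; by der.
  rewrite /p' NE cosD sinD !reS !imS; ring.
have dq (x : R) : is_derive x 1 q (q' x).
  apply: der_eq.
    apply: der_M; first by der.
    apply: der_D; first by apply: der_M; [exact: der_cexp_im|der].
    by apply: der_N; apply: der_M; [exact: der_cexp_re|der].
  rewrite /q' NE cosD sinD !reS !imS; ring.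
have bnd (x u : R) : `|x| <= `|a| -> `|u| <= 2 ->
    `|- (expR (- (x * cos t)) * (x ^+ N / N`!%:R * u))| <= expR `|a| * (`|a| ^+ N / N`!%:R) * 2.
  move=> xa u2; rewrite normrN normrM [X in X * _]ger0_norm ?expR_ge0// -[leRHS]mulrA.
  apply: ler_pM; rewrite ?expR_ge0//.
    rewrite ler_expR; apply: le_trans (ler_norm _) _; rewrite normrN.
    by apply: le_trans (mulr_norm_le1 _ (cos_max t)) _.
  rewrite normrM; apply: ler_pM => //.
  rewrite normrM normfV normr_nat ler_wpM2r ?invr_ge0//.
  by rewrite normrX lerXn2r// nnegrE.
have csb (u v w z : R) : `|u| <= 1 -> `|v| <= 1 -> `|w| <= 1 -> `|z| <= 1 -> `|u * v + w * z| <= 2.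
  move=> u1 v1 w1 z1; apply: le_trans (ler_normD _ _) _.
  have : `|u * v| <= 1 by rewrite normrM mulr_ile1.
  have : `|w * z| <= 1 by rewrite normrM mulr_ile1.
  lra.
have sinm (x : R) : `|sin x| <= 1 by rewrite ler_norml sin_le1 sin_geN1.
have main (f f' : R -> R) : (forall x, is_derive x 1 f (f' x)) ->
   (forall x, `|x| <= `|a| -> `|f' x| <= expR `|a| * (`|a| ^+ N / N`!%:R) * 2) ->
   `|f a - f 0| <= expR `|a| * (`|a| ^+ N / N`!%:R) * 2 * `|a|.
  move=> fd fb; have [a0|a0] := leP 0 a.
    rewrite [X in _ * X]ger0_norm// -[X in _ * X]subr0.
    apply: (derive_bound a0 (f' := f')) => [x _|x /andP[x0 xa]]; first exact: fd.
    by apply: fb; rewrite !ger0_norm.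
  rewrite distrC [X in _ * X]ltr0_norm// -[X in _ * X]add0r.
  apply: (derive_bound (ltW a0) (f' := f')) => [x _|x /andP[ax x0]]; first exact: fd.
  by apply: fb; rewrite ler0_norm// [leRHS]ltr0_norm// lerN2.
exists (p a), (q a); split.
- rewrite /p /q; set C := cos (a * sin t); set S := sin (a * sin t).
  set u := cexp_re _ _ _; set v := cexp_im _ _ _.
  transitivity (expR (a * cos t) * expR (- (a * cos t)) * (u * (C ^+ 2 + S ^+ 2))).
    by rewrite eE cs mul1r mulr1.
  by ring.
- rewrite /p /q; set C := cos (a * sin t); set S := sin (a * sin t).
  set u := cexp_re _ _ _; set v := cexp_im _ _ _.
  transitivity (expR (a * cos t) * expR (- (a * cos t)) * (v * (C ^+ 2 + S ^+ 2))).
    by rewrite eE cs mul1r mulr1.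
  by ring.
- have p0 : p 0 = 1.
    by rewrite /p !mul0r oppr0 expR0 cos0 sin0 cexp_re0 cexp_im0; ring.
  have := main p p' dp; rewrite p0; apply => x xa; apply: bnd => //; apply: csb => //; exact: cos_max.
- have q0 : q 0 = 0.
    by rewrite /q !mul0r oppr0 expR0 cos0 sin0 cexp_re0 cexp_im0; ring.
  have := main q q' dq; rewrite q0 subr0; apply => x xa; apply: bnd => //.
  by rewrite -mulNr; apply: csb; rewrite ?normrN//; exact: cos_max.
Qed.

End elementary_bounds.

Section integration.
Variable R : realType.
Implicit Types f g F : R -> R.
Implicit Types D : set (measurableTypeR R).
Notation mu := (@lebesgue_measure R).

Lemma pointwise_within f (a b : R) : (forall x, a <= x <= b -> {for x, continuous f}) ->
  {within `[a, b], continuous f}.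
Proof.
by move=> cf; apply: continuous_in_subspaceT => x; rewrite inE/= in_itv/=; exact: cf.
Qed.

Lemma segment_integrable f (a b : R) : {within `[a, b], continuous f} ->
  mu.-integrable `[a, b] (EFin \o f).
Proof. by apply: continuous_compact_integrable; exact: segment_compact. Qed.

Lemma continuous_integrable f (a b : R) : continuous f ->
  mu.-integrable `[a, b] (EFin \o f).
Proof. by move=> cf; apply: segment_integrable; apply: continuous_subspaceT. Qed.

Lemma continuous_measurable D f : continuous f -> measurable_fun D f.
Proof. by move=> cf; apply: measurable_funTS; exact: continuous_measurable_fun. Qed.

Lemma FTC_segment F f (a b : R) : a <= b -> derives_on F f a b ->
  {within `[a, b], continuous f} -> \int[mu]_(t in `[a, b]) f t = F b - F a.
Proof.
move=> + dF cf; rewrite le_eqVlt => /orP[/eqP <-|ab].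
  by rewrite set_itv1 Rintegral_set1 subrr.
rewrite /Rintegral (continuous_FTC2 (F := F))//.
- split=> [x|| ].
  + by rewrite in_itv/= => /andP[ax xb]; have [] : is_derive x 1 F (f x) by apply: dF; rewrite !ltW.
  + apply: cvg_at_right_filter; apply: (is_derive_continuous (a := f a)).
    by apply: dF; rewrite lexx ltW.
  + apply: cvg_at_left_filter; apply: (is_derive_continuous (a := f b)).
    by apply: dF; rewrite lexx ltW.
- move=> x; rewrite in_itv/= => /andP[ax xb].
  have [_ E] : is_derive x 1 F (f x) by apply: dF; rewrite !ltW.
  by rewrite derive1E.
Qed.

Lemma integrable_dominated D f g : measurable D -> measurable_fun D f ->
  mu.-integrable D (EFin \o g) -> (forall x, D x -> `|f x| <= g x) ->
  mu.-integrable D (EFin \o f).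
Proof.
move=> mD mf ig fg; apply: le_integrable ig => //; first exact/measurable_EFinP.
by move=> x Dx; rewrite /= lee_fin (le_trans (fg _ Dx))// ler_norm.
Qed.

Lemma Rintegral_norm_le D f g : measurable D -> measurable_fun D f ->
  mu.-integrable D (EFin \o g) -> (forall x, D x -> `|f x| <= g x) ->
  `|\int[mu]_(x in D) f x| <= \int[mu]_(x in D) g x.
Proof.
move=> mD mf ig fg; have intf := integrable_dominated mD mf ig fg.
apply: le_trans (le_normr_Rintegral mD intf) _; apply: le_Rintegral => //.
by have := integrable_norm intf; rewrite /comp.
Qed.

Lemma Rdominated_convergence D (f_ : nat -> R -> R) f g : measurable D ->
  (forall n, measurable_fun D (f_ n)) ->
  (forall x, D x -> (fun n => f_ n x) @ \oo --> f x) ->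
  mu.-integrable D (EFin \o g) -> (forall n x, D x -> `|f_ n x| <= g x) ->
  mu.-integrable D (EFin \o f) /\
  (fun n => \int[mu]_(x in D) f_ n x) @ \oo --> \int[mu]_(x in D) f x.
Proof.
move=> mD mf_ ff ig fg.
have ffE x : D x -> (fun n => (EFin \o f_ n) x) @ \oo --> (EFin \o f) x.
  move=> Dx; apply: cvg_EFin; first exact: nearW.
  exact: ff.
have mE n : measurable_fun D (EFin \o f_ n) by exact/measurable_EFinP.
have mf : measurable_fun D (EFin \o f) := emeasurable_fun_cvg _ _ mE ffE.
have [||intf _ cv] := dominated_convergence mD mE mf _ ig.
- by apply: aeW => x; exact: ffE.
- by apply: aeW => x n Dx; rewrite /= lee_fin fg.
split=> //; apply: fine_cvg; rewrite fineK; last exact: integrable_fin_num.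
exact: cv.
Qed.

Lemma expR_ray (k a : R) : 0 < k ->
  mu.-integrable `[a, +oo[ (EFin \o (fun x => expR (- (k * x)))) /\
  \int[mu]_(x in `[a, +oo[) expR (- (k * x)) = expR (- (k * a)) / k.
Proof.
move=> k0; pose F x : R := - (expR (- (k * x)) / k).
have cf : continuous (fun x : R => expR (- (k * x))).
  move=> x; apply: (is_derive_continuous (a := expR (- (k * x)) * (- k))).
  by apply: der_eq; [der|rewrite /=; ring].
have dF (x : R) : is_derive x 1 F (expR (- (k * x))).
  by apply: der_eq; [der|rewrite /=; field; rewrite gt_eqF].
have E : (\int[mu]_(x in `[a, +oo[) (expR (- (k * x)))%:E = 0%:E - (F a)%:E)%E.
  apply: ge0_continuous_FTC2y.
  - by move=> x _; exact: expR_ge0.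
  - exact: continuous_subspaceT.
  - rewrite /F -[X in _ --> X]oppr0 -[X in _ --> - X](mul0r k^-1).
    apply: cvgN; apply: cvgM; last exact: cvg_cst.
    apply: (cvg_comp (fun x : R => k * x) (fun y : R => expR (- y)) _ (@cvgr_expR R)).
    by apply: gt0_cvgMry => //; exact: cvg_id.
  - by move=> x _; have [] := dF x.
  - by apply: cvg_at_right_filter; apply: (is_derive_continuous (dF a)).
  - by move=> x _; rewrite derive1E; have [_ ->] := dF x.
split; last by rewrite /Rintegral E /F /= sub0r opprK.
apply/integrableP; split.
  by apply/measurable_EFinP; exact: continuous_measurable cf.
under eq_integral do rewrite /= ger0_norm ?expR_ge0//.
by rewrite E -EFinB ltry.
Qed.

End integration.

(** * Bessel functions at the edge *)

Section generating_integral.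
Variable R : realType.
Notation mu := (@lebesgue_measure R).

Lemma exp2_nat (s t : R) (n : int) :
  exp_coef2 s t n = tsum (fun l : nat => h_pl s (n + l%:Z) * h_pl t l%:Z).
Proof.
rewrite /exp_coef2 /conv -(tsum_reindex _ oppr_bij).
pose f (k : int) := h_pl s (n + k) * h_pl t k.
have -> : (fun i => h_pl s (n - - i) * refl (h_pl t) (- i)) = f.
  by apply/funext => i; rewrite /refl !opprK.
have sf : abs_summable f.
  by apply: (@abs_summable_mul_bounded R _ _ _ (expR `|s|)) => [k|]; [exact: h_pl_norm_le|exact: abs_summable_h].
apply: (abs_summable_int_nat _ _).2 => [k k0|]; first by rewrite /f [h_pl t k]h_pl_neg// mulr0.
by apply: abs_summable_comp sf => i j [].
Qed.

(** The range of [k] exceeds that of [l] by [|n|], so that every [l] with [0 <= n + l] meets its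
    partner [k = n + l] and the double sum is a partial sum of the series. *)
Definition exp2_trunc (s t : R) (n : int) N : R :=
  \sum_(l < N) \sum_(k < N + `|n|) s ^+ k / k`!%:R * (t ^+ l / l`!%:R) *
    (k%:Z == n + l%:Z)%:R.

Lemma exp2_trunc_cvg (s t : R) (n : int) : exp2_trunc s t n @ \oo --> exp_coef2 s t n.
Proof.
have E N : exp2_trunc s t n N = \sum_(l < N) (fun l : nat => h_pl s (n + l%:Z) * h_pl t l%:Z) l.
  apply: eq_bigr => l _.
  have [nl|nl] := ltP (n + l%:Z) 0.
    rewrite h_pl_neg// mul0r big1// => k _; case: eqP => [e|_]; last by rewrite mulr0.
    by move: nl; rewrite -e.
  have kN : (`|(n + l%:Z)%R| < N + `|n|)%N by have := ltn_ord l; move: (nat_of_ord l) nl => l'; lia.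
  rewrite (bigD1 (Ordinal kN))//= big1 => [|k kk].
    have e : (`|(n + l%:Z)%R|%N)%:Z = n + l%:Z by lia.
    have <- : h_pl s (`|(n + l%:Z)%R|%N)%:Z = h_pl s (n + l%:Z) by rewrite e.
    by rewrite addr0 /= e eqxx mulr1.
  case: eqP => [e|_]; last by rewrite mulr0.
  by case/eqP: kk; apply: val_inj; rewrite /= -e.
pose C := expR `|s| * expR (`|t| * 2).
have C0 : 0 <= C by rewrite mulr_ge0 ?expR_ge0.
apply: (cvg_dist_le (v := fun N => C * 2 * 2^-1 ^+ N)); last exact: cvg_half.
apply: nearW => N; rewrite E exp2_nat distrC; apply: tsum_nat_tail => // l.
rewrite normrM /C -mulrA; apply: ler_pM => //; last by apply: h_pl_le.
exact: h_pl_norm_le.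
Qed.

Lemma expr_fact_cvg0 (a : R) : (fun N => a ^+ N / N`!%:R) @ \oo --> 0.
Proof. exact: (cvg_series_cvg_0 (@is_cvg_series_exp_coeff R a)). Qed.

Lemma cexp_cvg (tau a : R) :
  (fun N => cexp_re tau N a) @ \oo --> expR (a * cos tau) * cos (a * sin tau) /\
  (fun N => cexp_im tau N a) @ \oo --> expR (a * cos tau) * sin (a * sin tau).
Proof.
pose K := expR (a * cos tau) * (expR `|a| * 2 * `|a|) * 2.
have v0 : (fun N => K * (`|a| ^+ N / N`!%:R)) @ \oo --> (0 : R).
  rewrite -[X in _ --> X](mulr0 K); apply: cvgM; first exact: cvg_cst.
  exact: expr_fact_cvg0.
have sm (x : R) : `|sin x| <= 1 by rewrite ler_norml sin_le1 sin_geN1.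
have cm (x : R) : `|cos x| <= 1 := cos_max x.
have key (e p q u v w : R) N : 0 <= e -> `|u| <= 1 -> `|v| <= 1 -> 
   `|p - 1| <= expR `|a| * (`|a| ^+ N / N`!%:R) * 2 * `|a| ->
   `|q| <= expR `|a| * (`|a| ^+ N / N`!%:R) * 2 * `|a| -> w = (p - 1) * u + q * v ->
   `|e * w| <= e * (expR `|a| * 2 * `|a|) * 2 * (`|a| ^+ N / N`!%:R).
  move=> e0 u1 v1 p1 q1 ->.
  rewrite normrM (ger0_norm e0) -!mulrA; apply: ler_wpM2l => //.
  apply: le_trans (ler_normD _ _) _.
  have h1 : `|(p - 1) * u| <= expR `|a| * (`|a| ^+ N / N`!%:R) * 2 * `|a|.
    by apply: le_trans p1; rewrite normrM ler_piMr.
  have h2 : `|q * v| <= expR `|a| * (`|a| ^+ N / N`!%:R) * 2 * `|a|.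
    by apply: le_trans q1; rewrite normrM ler_piMr.
  by apply: le_trans (lerD h1 h2) _; rewrite le_eqVlt; apply/orP; left; apply/eqP; ring.
split; rewrite -(cvg_shiftS _); apply: (cvg_dist_le _ v0); apply: nearW => N /=.
- have [p [q [-> _ p1 q1]]] := cexp_approx tau N a.
  rewrite -mulrBr; apply: (key _ p q (cos (a * sin tau)) (- sin (a * sin tau)) _ N);
    rewrite ?expR_ge0 ?normrN //; ring.
- have [p [q [_ -> p1 q1]]] := cexp_approx tau N a.
  rewrite -mulrBr; apply: (key _ p q (sin (a * sin tau)) (cos (a * sin tau)) _ N);
    rewrite ?expR_ge0 //; ring.
Qed.

Lemma cexp_bound (tau a : R) N :
  `|cexp_re tau N a| <= expR (`|a| * 2) * 2 /\ `|cexp_im tau N a| <= expR (`|a| * 2) * 2.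
Proof.
have key (c : nat -> R) : (forall k, `|c k| <= 1) ->
    `|\sum_(k < N) a ^+ k / k`!%:R * c k| <= expR (`|a| * 2) * 2.
  move=> c1; apply: le_trans (ler_norm_sum _ _ _) _.
  apply: (@le_trans _ _ (\sum_(k < N) expR (`|a| * 2) * 2^-1 ^+ k)).
    apply: ler_sum => k _; apply: le_trans (mulr_norm_le1 _ (c1 k)) _.
    exact: (h_pl_le a k (ltr0Sn R 1)).
  by rewrite -mulr_sumr ler_wpM2l ?expR_ge0//; exact: half_geo_le.
split; [apply: (key (fun k => cos (k%:R * tau)))|apply: (key (fun k => sin (k%:R * tau)))] => k.
  exact: cos_max.
by rewrite ler_norml sin_le1 sin_geN1.
Qed.

(** Real part of z^{-n} times the truncated series of e^{s z + t / z} at z = e^{i tau}. *)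
Definition exp2_wave (s t : R) (n : int) N (tau : R) : R :=
  \sum_(l < N) \sum_(k < N + `|n|) s ^+ k / k`!%:R * (t ^+ l / l`!%:R) *
    cos ((k%:Z - l%:Z - n)%:~R * tau).

Lemma exp2_waveE (s t : R) (n : int) N (tau : R) :
  exp2_wave s t n N tau =
   cos (n%:~R * tau) * (cexp_re tau (N + `|n|) s * cexp_re tau N t + cexp_im tau (N + `|n|) s * cexp_im tau N t) +
   sin (n%:~R * tau) * (cexp_im tau (N + `|n|) s * cexp_re tau N t - cexp_re tau (N + `|n|) s * cexp_im tau N t).
Proof.
set cn := cos _; set sn := sin _; set M := (N + _)%N.
set re := cexp_re tau M s; set im := cexp_im tau M s.
transitivity ((re * cn + im * sn) * cexp_re tau N t + (im * cn - re * sn) * cexp_im tau N t); last by ring.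
rewrite /(cexp_re tau N t) /(cexp_im tau N t) !mulr_sumr -big_split /=; apply: eq_bigr => l _.
set b := t ^+ l / _; set cl := cos (l%:R * tau); set sl := sin (l%:R * tau).
transitivity (re * (b * (cl * cn - sl * sn)) + im * (b * (sl * cn + cl * sn))); last by ring.
rewrite /re /im /cexp_re /cexp_im !mulr_suml -big_split /=; apply: eq_bigr => k _.
have -> : (k%:Z - l%:Z - n)%:~R * tau = k%:R * tau - (l%:R * tau + n%:~R * tau) :> R.
  by rewrite !intrB; ring.
rewrite cosB cosD sinD -/cl -/sl -/cn -/sn; ring.
Qed.

Lemma exp2_wave_cvg (s t : R) (n : int) (tau : R) : (fun N => exp2_wave s t n N tau) @ \oo -->
  expR ((s + t) * cos tau) * cos ((s - t) * sin tau - n%:~R * tau).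
Proof.
under eq_fun do rewrite exp2_waveE.
have [re1 im1] := cexp_cvg tau s; have [re2 im2] := cexp_cvg tau t.
have re3 : (fun N => cexp_re tau (N + `|n|) s) @ \oo --> expR (s * cos tau) * cos (s * sin tau).
  by rewrite -(cvg_shiftn `|n|) in re1.
have im3 : (fun N => cexp_im tau (N + `|n|) s) @ \oo --> expR (s * cos tau) * sin (s * sin tau).
  by rewrite -(cvg_shiftn `|n|) in im1.
set cn := cos (n%:~R * tau); set sn := sin (n%:~R * tau).
rewrite cosB -/cn -/sn !mulrDl mulNr expRD cosB sinB.
move: re2 im2 re3 im3.
move: (expR (s * _)) (expR (t * _)) (cos (s * _)) (sin (s * _)) (cos (t * _)) (sin (t * _)) => S T cs ss ct st re2 im2 re3 im3.
have -> : S * T * ((cs * ct + ss * st) * cn + (ss * ct - cs * st) * sn) =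
  cn * (S * cs * (T * ct) + S * ss * (T * st)) + sn * (S * ss * (T * ct) - S * cs * (T * st)) by ring.
apply: cvgD; apply: cvgM; try exact: cvg_cst.
  by apply: cvgD; apply: cvgM.
by apply: cvgB; apply: cvgM.
Qed.

Lemma exp2_wave_bound (s t : R) (n : int) : exists M : R, forall N tau, `|exp2_wave s t n N tau| <= M.
Proof.
pose A := expR (`|s| * 2) * 2; pose B := expR (`|t| * 2) * 2.
exists (A * B * 4) => N tau; rewrite exp2_waveE.
have [a1 a2] := cexp_bound tau s (N + `|n|); have [b1 b2] := cexp_bound tau t N.
have m (x y : R) : `|x| <= A -> `|y| <= B -> `|x * y| <= A * B.
  by move=> ? ?; rewrite normrM ler_pM.
have c1 (x y : R) : `|x| <= 1 -> `|x * y| <= `|y| by move=> ?; rewrite normrM ler_piMl.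
apply: le_trans (ler_normD _ _) _.
have sm (x : R) : `|sin x| <= 1 by rewrite ler_norml sin_le1 sin_geN1.
have h1 := c1 _ (cexp_re tau (N + `|n|) s * cexp_re tau N t + cexp_im tau (N + `|n|) s * cexp_im tau N t) (cos_max (n%:~R * tau)).
have h2 := c1 _ (cexp_im tau (N + `|n|) s * cexp_re tau N t - cexp_re tau (N + `|n|) s * cexp_im tau N t) (sm (n%:~R * tau)).
apply: le_trans (lerD h1 h2) _.
have h3 := ler_normD (cexp_re tau (N + `|n|) s * cexp_re tau N t) (cexp_im tau (N + `|n|) s * cexp_im tau N t).
have h4 := ler_normB (cexp_im tau (N + `|n|) s * cexp_re tau N t) (cexp_re tau (N + `|n|) s * cexp_im tau N t).
have := m _ _ a1 b1; have := m _ _ a2 b2; have := m _ _ a2 b1; have := m _ _ a1 b2.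
move: (`|_ * _|) (`|_ * _|) (`|_ * _|) (`|_ * _|) h3 h4 => x y z w.
lra.
Qed.

Lemma der_sum n (h : 'I_n -> R -> R) (d : 'I_n -> R) (x : R) :
  (forall i, has_der (h i) x (d i)) -> has_der (fun t => \sum_i h i t) x (\sum_i d i).
Proof.
elim: n h d => [|n IH] h d H.
  rewrite big_ord0; have -> : (fun t => \sum_(i < 0) h i t) = (fun _ => 0).
    by apply/funext => y; rewrite big_ord0.
  exact: der_cst.
rewrite big_ord_recl; have -> : (fun t => \sum_(i < n.+1) h i t) =
    (fun t => h ord0 t + \sum_(i < n) h (lift ord0 i) t).
  by apply/funext => y; rewrite big_ord_recl.
by apply: der_D => //; apply: IH => i.
Qed.

Lemma sin_int_pi (k : int) : sin (k%:~R * pi) = 0 :> R.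
Proof.
have nat_case (m : nat) : sin (m%:R * pi) = 0 :> R.
  elim: m => [|m IH]; first by rewrite mul0r sin0.
  by rewrite -natr1 mulrDl mul1r sinDpi IH oppr0.
by case: k => m; rewrite ?NegzE ?mulrNz ?mulNr ?sinN nat_case ?oppr0.
Qed.

(** Orthogonality: at the end point pi A a nonzero frequency contributes the sine of a multiple of
    pi, so only k - l = n survives. *)
Lemma exp2_wave_integral (s t A : R) (n : int) N : 0 < A ->
  \int[mu]_(x in `[0, pi * A]) exp2_wave s t n N (x / A) = pi * A * exp2_trunc s t n N.
Proof.
move=> A0.
pose G (m : int) (x : R) := if m == 0 then x else A / m%:~R * sin (m%:~R * (x / A)).
have dG m (x : R) : is_derive x 1 (G m) (cos (m%:~R * (x / A))).
  rewrite /G; case: eqP => [->|/eqP m0]; first by apply: der_eq; [der|rewrite mul0r cos0].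
  apply: der_eq; first by der.
  have : (m%:~R : R) != 0 by rewrite intr_eq0.
  by rewrite /=; move=> ?; field; rewrite (gt_eqF A0).
rewrite (FTC_segment (F := fun x => \sum_(l < N) \sum_(k < N + `|n|) s ^+ k / k`!%:R * (t ^+ l / l`!%:R) *
    G (k%:Z - l%:Z - n) x)).
- rewrite /exp2_trunc mulr_sumr -sumrB; apply: eq_bigr => l _.
  rewrite mulr_sumr -sumrB; apply: eq_bigr => k _; rewrite -mulrBr [RHS]mulrCA; congr (_ * _).
  have -> : (k%:Z == n + l%:Z) = (k%:Z - l%:Z - n == 0).
    by rewrite -addrA -opprD subr_eq0 [l%:Z + n]addrC.
  rewrite /G; case: eqP => [_|_]; first by rewrite subr0 mulr1.
  by rewrite mul0r mulr0 sin0 mulfK ?gt_eqF// sin_int_pi !mulr0 subr0.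
- by rewrite mulr_ge0// ?pi_ge0// ltW.
- move=> x _; apply: der_eq; last reflexivity.
  apply: der_sum => l; apply: der_sum => k; apply: (der_eq (a := _)).
    by apply: der_M; [exact: der_cst|exact: dG].
  by rewrite mulr0 addr0.
- apply: continuous_subspaceT => x; apply: is_derive_continuous.
  by apply: der_sum => l; apply: der_sum => k; der.
Qed.

(** The coefficient formula on the unit circle, reduced to half of it by parity and stretched by
    [A], so that the variable is already that of the Airy integral. *)
Lemma exp2_integral (s t A : R) (n : int) : 0 < A ->
  A * exp_coef2 s t n = pi^-1 * \int[mu]_(x in `[0, pi * A])
    (expR ((s + t) * cos (x / A)) * cos ((s - t) * sin (x / A) - n%:~R * (x / A))).
Proof.
move=> A0; have [M HM] := exp2_wave_bound s t n.
have cw N : continuous (fun x : R => exp2_wave s t n N (x / A)).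
  move=> x; apply: is_derive_continuous.
  by apply: der_sum => l; apply: der_sum => k; der.
have [|||||_ cv] := @Rdominated_convergence R `[0, pi * A] (fun N x => exp2_wave s t n N (x / A))
  (fun x => expR ((s + t) * cos (x / A)) * cos ((s - t) * sin (x / A) - n%:~R * (x / A))) (fun _ => M).
- exact: measurable_itv.
- by move=> N; exact: continuous_measurable.
- by move=> x _; exact: exp2_wave_cvg.
- by apply: continuous_integrable => x; exact: cvg_cst.
- by move=> N x _; exact: HM.
have cv2 : (fun N => \int[mu]_(x in `[0, pi * A]) exp2_wave s t n N (x / A)) @ \oo --> pi * A * exp_coef2 s t n.
  under eq_fun do rewrite exp2_wave_integral//.
  by apply: cvgM; [exact: cvg_cst|exact: exp2_trunc_cvg].
have E := @cvg_unique _ (@Rhausdorff R) _ _ _ _ cv2 cv.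
by rewrite -E -mulrA mulKf// gt_eqF// pi_gt0.
Qed.

End generating_integral.

Section bessel_asymptotics.
Variable R : realType.
Notation mu := (@lebesgue_measure R).

(** The substitution z -> r z, which moves the circle of integration without complex analysis. *)
Lemma exp2_scale (s t r : R) (n : int) : 0 < r ->
  exp_coef2 (s * r) (t / r) n = r ^ n * exp_coef2 s t n.
Proof.
move=> r0; have r1 : r \is a GRing.unit by rewrite unitfE gt_eqF.
have hs (a b : R) (k : int) : b \is a GRing.unit -> h_pl (a * b) k = b ^ k * h_pl a k.
  move=> bu; case: k => k; last by rewrite !h_pl_neg// mulr0.
  by rewrite /h_pl exprMn -exprnP; ring.
rewrite !exp2_nat -tsumZ.
  congr tsum; apply/funext => l; rewrite !hs ?unitrV//.
  by rewrite exprzDr// -!exprnP exprVn; field; rewrite expf_neq0 ?gt_eqF.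
apply: (@abs_summable_mul_bounded R _ _ _ (expR `|s|)) => [k|]; first exact: h_pl_norm_le.
by apply: (abs_summable_comp (e := Posz)) (abs_summable_h t) => i j [].
Qed.

Lemma bessel_integral (A y : R) (n : int) : 0 < A -> n%:~R = 2 * A ^+ 3 + A * y ->
  A * bessel (A ^+ 3) n = pi^-1 * \int[mu]_(t in `[0, pi * A])
    cos (y * t + 2 * A ^+ 3 * (t / A - sin (t / A))).
Proof.
move=> A0 ny; rewrite /bessel (exp2_integral _ _ _ A0); congr (_ * _).
apply: eq_Rintegral => t _; rewrite subrr mul0r expR0 mul1r -cosN ny; congr cos.
by field; rewrite gt_eqF.
Qed.

(** With r = e^{k/A}, the amplitude A^3 (r - 1/r) is 2 k A^2 up to a constant, and r^{-n} = e^{-k n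
    / A}; together they centre the bound at 2 A^3. The drop of the cosine away from 0 keeps the
    integral over an interval of length pi A bounded. *)
Lemma bessel_exp_bound (k : R) : 0 < k -> exists2 C : R, 0 <= C & forall (A : R) (n : int), 1 <= A ->
  `|A * bessel (A ^+ 3) n| <= C * expR (- (k * ((n%:~R - 2 * A ^+ 3) / A))).
Proof.
(* [k ^+ 3 * expR k] bounds the excess of the amplitude over 2 k A^2. The term [k / 36] is the price
   of replacing the decay k x^2 / 9 by k x / 9, through x^2 >= x - 1/4. *)
move=> k0; pose E := k ^+ 3 * expR k + k / 36.
exists (pi^-1 * (expR E * (k / 9)^-1)) => [|A n A1].
  by rewrite !mulr_ge0 ?invr_ge0 ?pi_ge0 ?expR_ge0// divr_ge0// ltW.
have A0 : 0 < A by apply: lt_le_trans A1.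
pose r := expR (k / A).
have r0 : 0 < r by exact: expR_gt0.
have -> : bessel (A ^+ 3) n = expR (- (k * n%:~R / A)) * exp_coef2 (A ^+ 3 * r) (- A ^+ 3 / r) n.
  rewrite exp2_scale// mulrA /bessel /r.
  have -> : expR (k / A) ^ n = expR (k * n%:~R / A).
    case: n => m; rewrite -?exprnP ?NegzE -?exprnN -expRM_natl -?expRN; congr expR.
      by rewrite -pmulrn -[m%:R]/(m%:R); ring.
    by rewrite mulrNz -pmulrn; ring.
  by rewrite -expRD addNr expR0 mul1r.
rewrite mulrCA (exp2_integral _ _ _ A0) normrM ger0_norm ?expR_ge0// mulrC.
set s := A ^+ 3 * r + - A ^+ 3 / r.
set w := A ^+ 3 * r - _.
have kA : 0 <= k / A <= k by rewrite divr_ge0 ?(ltW k0) ?(ltW A0)//= ler_pdivrMr// ler_peMr// ltW.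
have sE : s = A ^+ 3 * (expR (k / A) - expR (- (k / A))).
  by rewrite /s /r expRN; ring.
have s_le : s <= 2 * k * A ^+ 2 + k ^+ 3 * expR k.
  rewrite sE; apply: (@le_trans _ _ (A ^+ 3 * (2 * (k / A) + (k / A) ^+ 3 * expR k))).
    by apply: ler_wpM2l; [rewrite exprn_ge0// ltW|exact: sinh_le].
  by rewrite le_eqVlt; apply/orP; left; apply/eqP; field; rewrite gt_eqF.
have s_ge : 2 * k * A ^+ 2 <= s.
  rewrite sE; apply: (@le_trans _ _ (A ^+ 3 * (2 * (k / A)))).
    by rewrite le_eqVlt; apply/orP; left; apply/eqP; field; rewrite gt_eqF.
  by apply: ler_wpM2l; [rewrite exprn_ge0// ltW|apply: sinh_ge; case/andP: kA].
pose G := 2 * k * A ^+ 2 + E.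
have ptw x : `[0, pi * A]%classic x ->
    `|expR (s * cos (x / A)) * cos (w * sin (x / A) - n%:~R * (x / A))| <= expR G * expR (- (k / 9 * x)).
  rewrite /= in_itv/= => /andP[x0 xA].
  apply: le_trans (mulr_norm_le1 _ (cos_max _)) _; rewrite ger0_norm ?expR_ge0//.
  rewrite -expRD ler_expR.
  have xA0 : 0 <= x / A <= pi by rewrite divr_ge0 ?(ltW A0)//= ler_pdivrMr.
  have c1 := one_sub_cos_ge xA0.
  have : 2 * k * A ^+ 2 * ((x / A) ^+ 2 / 18) <= s * (1 - cos (x / A)).
    apply: ler_pM => //; first by rewrite !mulr_ge0 ?sqr_ge0 ?ltW.
    by rewrite divr_ge0 ?sqr_ge0.
  have -> : 2 * k * A ^+ 2 * ((x / A) ^+ 2 / 18) = k / 9 * x ^+ 2 by field; rewrite gt_eqF.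
  have : 0 <= k / 9 * (x - 2^-1) ^+ 2 by rewrite mulr_ge0 ?sqr_ge0// divr_ge0// ltW.
  rewrite /G /E; move: s_le; set K3 := k ^+ 3 * expR k; set c := cos _.
  move=> h1 h2 h3; have h4 : s * c = s - s * (1 - c) by ring.
  rewrite h4; have h5 : k / 9 * (x - 2^-1) ^+ 2 = k / 9 * x ^+ 2 - k / 9 * x + k / 36 by field.
  rewrite h5 in h2; lra.
have k9 : 0 < k / 9 by rewrite divr_gt0.
have cf (c : R) : continuous (fun x : R => c * expR (- (k / 9 * x))).
  by move=> x; apply: is_derive_continuous; der.
have int_le : `|\int[mu]_(x in `[0, pi * A]) (expR (s * cos (x / A)) * cos (w * sin (x / A) - n%:~R * (x / A)))|
     <= expR G * (k / 9)^-1.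
  apply: le_trans (Rintegral_norm_le (g := fun x => expR G * expR (- (k / 9 * x))) _ _ _ ptw) _.
  - exact: measurable_itv.
  - by apply: continuous_measurable => x; apply: is_derive_continuous; der.
  - exact: continuous_integrable.
  rewrite (FTC_segment (F := fun x => - (expR G * expR (- (k / 9 * x)) / (k / 9)))).
  - rewrite mulr0 oppr0 expR0 opprK.
    have : 0 <= expR G * expR (- (k / 9 * (pi * A))) / (k / 9).
      by rewrite divr_ge0 ?mulr_ge0 ?expR_ge0// ltW.
    by rewrite mulr1; lra.
  - by rewrite mulr_ge0 ?pi_ge0// ltW.
  - by move=> x _; apply: der_eq; [der|rewrite /=; field; rewrite gt_eqF].
  - by apply: continuous_subspaceT.
rewrite normrM ger0_norm ?invr_ge0 ?pi_ge0// -[leLHS]mulrA -[leRHS]mulrA; apply: ler_wpM2l; first by rewrite invr_ge0 pi_ge0.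
apply: le_trans (ler_wpM2r (expR_ge0 _) int_le) _.
rewrite -!mulrA ![(k / 9)^-1 * _]mulrC !mulrA -!expRD le_eqVlt; apply/orP; left; apply/eqP.
by congr (expR _ * _); rewrite /G; field; rewrite gt_eqF.
Qed.

(* Integration by parts against [sin phi / phi']. *)
Lemma van_der_Corput (phi phi' phi'' : R -> R) (m a b : R) : a <= b -> 0 < m ->
  derives_on phi phi' a b -> derives_on phi' phi'' a b ->
  (forall x, a <= x <= b -> {for x, continuous phi''}) ->
  (forall x, a <= x <= b -> m <= phi' x) -> (forall x, a <= x <= b -> 0 <= phi'' x) ->
  `|\int[mu]_(x in `[a, b]) cos (phi x)| <= 3 / m.
Proof.
move=> ab m0 d1 d2 c2 mphi phi0.
pose g x := sin (phi x) * (phi'' x / phi' x ^+ 2).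
pose h x := phi'' x / phi' x ^+ 2.
have p0 x : a <= x <= b -> phi' x != 0 by move=> /mphi /(lt_le_trans m0) h0; rewrite gt_eqF.
have cphi x : a <= x <= b -> {for x, continuous phi} by move=> xab; exact: is_derive_continuous (d1 x xab).
have cphi' x : a <= x <= b -> {for x, continuous phi'} by move=> xab; exact: is_derive_continuous (d2 x xab).
have ccos x : a <= x <= b -> {for x, continuous (fun x => cos (phi x))}.
  move=> xab; apply: is_derive_continuous; apply: der_cos; exact: d1.
have csin x : a <= x <= b -> {for x, continuous (fun x => sin (phi x))}.
  move=> xab; apply: is_derive_continuous; apply: der_sin; exact: d1.
have ch x : a <= x <= b -> {for x, continuous h}.
  move=> xab; apply: cvgM; first exact: c2.
  apply: cvgV; first by rewrite expf_neq0// p0.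
  exact: (is_derive_continuous (der_X 2 (d2 x xab))).
have cg x : a <= x <= b -> {for x, continuous g}.
  by move=> xab; apply: cvgM; [exact: csin|exact: ch].
have ccg x : a <= x <= b -> {for x, continuous (fun x => cos (phi x) - g x)}.
  by move=> xab; apply: cvgB; [exact: ccos|exact: cg].
have ig := segment_integrable (pointwise_within cg).
have ih := segment_integrable (pointwise_within ch).
have icg := segment_integrable (pointwise_within ccg).
have mab : measurable (`[a, b]%classic : set (measurableTypeR R)) by exact: measurable_itv.
have -> : \int[mu]_(x in `[a, b]) cos (phi x) =
    \int[mu]_(x in `[a, b]) (cos (phi x) - g x) + \int[mu]_(x in `[a, b]) g x.
  by rewrite -RintegralD//; apply: eq_Rintegral => x _; rewrite subrK.
have aab : a <= a <= b by rewrite lexx.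
have bab : a <= b <= b by rewrite lexx andbT.
have inv_le x : a <= x <= b -> (phi' x)^-1 <= m^-1.
  by move=> xab; rewrite lef_pV2 ?posrE ?mphi// (lt_le_trans m0)// mphi.
have inv_ge x : a <= x <= b -> 0 <= (phi' x)^-1.
  by move=> xab; rewrite invr_ge0 (le_trans (ltW m0))// mphi.
rewrite (FTC_segment (F := fun x => sin (phi x) * (phi' x)^-1))//; last 2 first.
- move=> x xab; apply: der_eq.
    by apply: der_M; [apply: der_sin; exact: d1|apply: der_V; [exact: p0|exact: d2]].
  by rewrite /g; field; exact: p0.
- exact: pointwise_within.
(* The two boundary terms cost 2 / m. Here |g| <= h, and [h] is the derivative of -1/phi', which
   costs the third 1 / m. *)
have hg : `|\int[mu]_(x in `[a, b]) g x| <= m^-1.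
  apply: (@le_trans _ _ (\int[mu]_(x in `[a, b]) h x)).
    apply: Rintegral_norm_le => //; first by have /integrableP[/measurable_EFinP] := ig.
    move=> x; rewrite /= in_itv/= => xab.
    have h0 : 0 <= h x by rewrite /h divr_ge0 ?phi0 ?sqr_ge0.
    by rewrite /g -/(h x) normrM (ger0_norm h0) ler_piMl// ler_norml sin_le1 sin_geN1.
  rewrite (FTC_segment (F := fun x => - (phi' x)^-1))//; last 2 first.
  - move=> x xab; apply: der_eq; first by apply: der_N; apply: der_V; [exact: p0|exact: d2].
    by rewrite /h; field; exact: p0.
  - exact: pointwise_within.
  by rewrite opprK; have := inv_le a aab; have := inv_ge b bab; lra.
have hs x : a <= x <= b -> `|sin (phi x) * (phi' x)^-1| <= m^-1.
  move=> xab; apply: le_trans (inv_le x xab); rewrite normrM (ger0_norm (inv_ge x xab)).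
  by rewrite ler_piMl ?inv_ge// ler_norml sin_le1 sin_geN1.
apply: le_trans (ler_normD _ _) _; have := ler_normB (sin (phi b) * (phi' b)^-1) (sin (phi a) * (phi' a)^-1).
have := hs a aab; have := hs b bab; lra.
Qed.

End bessel_asymptotics.

(** * Comparison of the Bessel and Airy phases *)

Section airy_limit.
Variable R : realType.
Notation mu := (@lebesgue_measure R).

Lemma Rintegral_segmentB (f : R -> R) (a b c : R) : continuous f -> a <= b -> b <= c ->
  \int[mu]_(t in `[a, c]) f t - \int[mu]_(t in `[a, b]) f t = \int[mu]_(t in `[b, c]) f t.
Proof.
move=> cf ab bc; rewrite Rintegral_itvB ?bnd_simp//; last exact: continuous_integrable.
rewrite Rintegral_itv_obnd_cbnd//.
by apply: integrableS (continuous_integrable b c cf) => //; exact: subset_itv_oc_cc.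
Qed.

Lemma Rintegral_segment_bound (f : R -> R) (a b M : R) : continuous f -> a <= b ->
  (forall x, a <= x <= b -> `|f x| <= M) -> `|\int[mu]_(t in `[a, b]) f t| <= M * (b - a).
Proof.
move=> cf ab fM.
have cM : continuous (fun _ : R => M) by move=> x; exact: cvg_cst.
apply: le_trans (Rintegral_norm_le (g := fun _ => M) _ _ _ _) _.
- exact: measurable_itv.
- exact: continuous_measurable.
- exact: continuous_integrable.
- by move=> x; rewrite /= in_itv/=; exact: fM.
rewrite (FTC_segment (F := fun x => M * x)) ?mulrBr//; last exact: continuous_subspaceT.
by move=> x _; apply: der_eq; [der|rewrite /=; ring].
Qed.

Lemma cos_lipschitz (a b : R) : `|cos a - cos b| <= `|a - b|.
Proof.
have H (u v : R) : u <= v -> `|cos v - cos u| <= `|v - u|.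
  move=> uv; rewrite [leRHS]ger0_norm ?subr_ge0// -[leRHS]mul1r.
  apply: (derive_bound (f' := fun x => - sin x)) => // x _.
    by apply: der_eq; [der|rewrite /=; ring].
  by rewrite normrN ler_norml sin_le1 sin_geN1.
have [/H|/ltW/H] := leP b a; first by [].
by rewrite distrC [leRHS]distrC.
Qed.

Definition airy_phase (x t : R) : R := t ^+ 3 / 3 + x * t.
Definition bessel_phase (A y t : R) : R := y * t + 2 * A ^+ 3 * (t / A - sin (t / A)).

Lemma continuous_airy_phase x : continuous (fun t => cos (airy_phase x t)).
Proof. by move=> t; apply: is_derive_continuous; rewrite /airy_phase; der. Qed.

Lemma continuous_bessel_phase A y : continuous (fun t => cos (bessel_phase A y t)).
Proof. by move=> t; apply: is_derive_continuous; rewrite /bessel_phase; der. Qed.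

(** The derivative t^2 + x would allow T^2 instead of T^2 / 9; the weaker threshold is the one
    shared with [bessel_phase_tail]. *)
Lemma airy_phase_tail (x T T' m : R) : 0 <= T -> T <= T' -> 0 < m -> m <= x + T ^+ 2 / 9 ->
  `|\int[mu]_(t in `[T, T']) cos (airy_phase x t)| <= 3 / m.
Proof.
move=> T0 TT m0 mT.
apply: (van_der_Corput (phi' := fun t => t ^+ 2 + x) (phi'' := fun t => 2 * t)) => //.
- by move=> t _; rewrite /airy_phase; apply: der_eq; [der|rewrite /=; field].
- by move=> t _; apply: der_eq; [der|rewrite /=; ring].
- by move=> t _; apply: is_derive_continuous; der.
- by move=> t /andP[tT _]; apply: le_trans mT _; nra.
- by move=> t /andP[tT _]; rewrite mulr_ge0// (le_trans T0).
Qed.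

(** Up to t = pi A the sine is nonnegative, so the phase is convex, and 2 A^2 (1 - cos (t / A)) >=
    t^2 / 9, a lower bound in which [A] has disappeared. *)
Lemma bessel_phase_tail (A y T T' m : R) : 0 < A -> 0 <= T -> T <= T' -> T' <= pi * A ->
  0 < m -> m <= y + T ^+ 2 / 9 ->
  `|\int[mu]_(t in `[T, T']) cos (bessel_phase A y t)| <= 3 / m.
Proof.
move=> A0 T0 TT TA m0 mT.
have tA t : T <= t <= T' -> 0 <= t / A <= pi.
  move=> /andP[h1 h2]; rewrite divr_ge0 ?(ltW A0) ?(le_trans T0)//=.
  by rewrite ler_pdivrMr// (le_trans h2).
apply: (van_der_Corput (phi' := fun t => y + 2 * A ^+ 2 * (1 - cos (t / A)))
   (phi'' := fun t => 2 * A * sin (t / A))) => //.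
- by move=> t _; rewrite /bessel_phase; apply: der_eq; [der|rewrite /=; field; rewrite gt_eqF].
- by move=> t _; apply: der_eq; [der|rewrite /=; field; rewrite gt_eqF].
- by move=> t _; apply: is_derive_continuous; der.
- move=> t tT; apply: le_trans mT _; rewrite lerD2l.
  apply: (@le_trans _ _ (2 * A ^+ 2 * ((t / A) ^+ 2 / 18))).
    have -> : 2 * A ^+ 2 * ((t / A) ^+ 2 / 18) = t ^+ 2 / 9 by field; rewrite gt_eqF.
    by case/andP: tT => h1 _; nra.
  by apply: ler_wpM2l; [rewrite mulr_ge0 ?sqr_ge0|apply: one_sub_cos_ge; exact: tA].
- by move=> t /tA tt; rewrite mulr_ge0 ?sin_ge0_pi// mulr_ge0// ltW.
Qed.

(** The limit in the definition of [Airy] carries information only once it is known to exist; the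
    tail bound verifies Cauchy's criterion. *)
Lemma airy_integral_cvg (x : R) :
  (fun T : R => \int[mu]_(t in `[0, T]) cos (airy_phase x t)) @ +oo --> pi * Airy x.
Proof.
rewrite /Airy mulrA divff ?gt_eqF ?pi_gt0// mul1r.
apply: (@cauchy_cvgP R _ _).1; apply: cauchy_exP => e e0.
(* The tail is then at most 3 / m = e / 2. Taking T >= 9 ensures T <= T^2 / 9, hence m <= x + T^2 /
   9. *)
pose m := 6 / e; have m0 : 0 < m by rewrite divr_gt0.
pose T := m + `|x| + 9.
have T9 : 9 <= T by rewrite /T; have := normr_ge0 x; lra.
exists (\int[mu]_(t in `[0, T]) cos (airy_phase x t)).
exists T; split; first exact: num_real.
move=> T' /= TT'; rewrite -ball_normE /= distrC.
rewrite Rintegral_segmentB ?(ltW TT') //; last 2 first.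
- exact: continuous_airy_phase.
- by apply: le_trans T9.
apply: le_lt_trans (airy_phase_tail (m := m) _ _ m0 _) _.
- by apply: le_trans T9.
- exact: ltW.
- have : T <= T ^+ 2 / 9 by nra.
  have := ler_norm (- x); rewrite normrN /T; lra.
by rewrite /m invf_div mulrA ltr_pdivrMr//; lra.
Qed.

Lemma airy_integral_tail (x T m : R) : 0 <= T -> 0 < m -> m <= x + T ^+ 2 / 9 ->
  `|\int[mu]_(t in `[0, T]) cos (airy_phase x t) - pi * Airy x| <= 3 / m.
Proof.
move=> T0 m0 mT; apply/ler_addgt0Pr => e e0.
have cv := (@cvgrPdist_le _ _ _ _ _ _ _).1 (airy_integral_cvg (x := x)) _ e0.
have [T' [TT' HT']] : exists T', T <= T' /\
    `|pi * Airy x - \int[mu]_(t in `[0, T']) cos (airy_phase x t)| <= e.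
  have : \forall T' \near +oo, T <= T' /\
    `|pi * Airy x - \int[mu]_(t in `[0, T']) cos (airy_phase x t)| <= e.
    by near=> T'; split; near: T'; [exact: nbhs_pinfty_ge (num_real T)|exact: cv].
  by move/filter_ex.
have := airy_phase_tail T0 TT' m0 mT.
rewrite -(Rintegral_segmentB (continuous_airy_phase (x := x)) T0 TT').
move: HT'; set a := \int[mu]_(t in _) _; set b := \int[mu]_(t in _) _.
move=> h1 h2; have -> : b - pi * Airy x = - (a - b) - (pi * Airy x - a) by ring.
by apply: le_trans (ler_normB _ _) _; rewrite normrN lerD.
Unshelve. all: by end_near. Qed.

(** The cubic term of the sine produces t^3 / 3 exactly. The remainder is at most 2 A^3 (t / A)^5 /
    120 = t^5 / (60 A^2). *)
Lemma phase_diff (A x y t : R) : 1 <= A -> 0 <= t ->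
  `|bessel_phase A y t - airy_phase x t| <= `|y - x| * t + t ^+ 5 / A.
Proof.
move=> A1 t0; have A0 : 0 < A by apply: lt_le_trans A1.
have tA : 0 <= t / A by rewrite divr_ge0// ltW.
have h1 := sin_ge tA; have h2 := sin_le tA.
have -> : bessel_phase A y t - airy_phase x t =
   (y - x) * t + 2 * A ^+ 3 * (t / A - (t / A) ^+ 3 / 6 - sin (t / A)).
  by rewrite /bessel_phase /airy_phase; field; rewrite gt_eqF.
apply: le_trans (ler_normD _ _) _; rewrite normrM (ger0_norm t0) lerD2l.
have A3 : 0 < 2 * A ^+ 3 by rewrite mulr_gt0// exprn_gt0.
rewrite normrM gtr0_norm//; set d := _ - sin _.
have d1 : `|d| <= (t / A) ^+ 5 / 120.
  by rewrite ler_norml; apply/andP; split; rewrite /d; [|have : 0 <= (t / A) ^+ 5 / 120 by rewrite divr_ge0// exprn_ge0]; lra.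
apply: le_trans (ler_wpM2l (ltW A3) d1) _.
have -> : 2 * A ^+ 3 * ((t / A) ^+ 5 / 120) = t ^+ 5 / A * (60 * A)^-1 by field; rewrite gt_eqF.
by rewrite ler_piMr ?divr_ge0 ?exprn_ge0 ?(ltW A0)// invf_le1 ?mulr_gt0//; lra.
Qed.

(** Both integrals are cut at a fixed [T]: the tails are small uniformly in [A], and on [0, T] the
    phases are uniformly close. *)
Lemma bessel_airy_close (x e : R) : 0 < e -> exists2 d : R, 0 < d & exists B : R,
  forall (A : R) (n : int), B <= A -> 1 <= A -> `|(n%:~R - 2 * A ^+ 3) / A - x| <= d ->
   `|A * bessel (A ^+ 3) n - Airy x| <= e.
Proof.
(* Each of the two tails costs 3 / m = e / 4. The surplus in [T] below absorbs the displacement |y -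
   x| <= 1. *)
move=> e0; pose m := 12 / e; have m0 : 0 < m by rewrite divr_gt0.
pose T := m + `|x| + 10; have xa := normr_ge0 x.
have T9 : 9 <= T by rewrite /T; lra.
have T0 : 0 < T by lra.
have TT : T <= T ^+ 2 / 9 by nra.
have xN : - x <= `|x| by rewrite -normrN ler_norm.
(* With |y - x| <= e / (8 T^2) and A >= 8 T^6 / e, each term of [phase_diff] integrated over [0, T]
   costs e / 8. *)
pose d := Num.min 1 (e / (8 * T ^+ 2)).
exists d; first by rewrite lt_min ltr01 /= divr_gt0// mulr_gt0// exprn_gt0.
exists (Num.max T (8 * T ^+ 6 / e)) => A n; rewrite ge_max => /andP[TA TA6] A1 yd.
have A0 : 0 < A by apply: lt_le_trans A1.
set y := _ / A in yd.
have ny : n%:~R = 2 * A ^+ 3 + A * y by rewrite /y; field; rewrite gt_eqF.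
rewrite (bessel_integral A0 ny).
have [yd1 yd2] : `|y - x| <= 1 /\ `|y - x| <= e / (8 * T ^+ 2).
  by move: yd; rewrite le_min => /andP.
have TpA : T <= pi * A.
  by apply: le_trans TA _; rewrite ler_peMl ?(ltW A0)// (le_trans _ (@pi_ge2 R))// ler1n.
have h1 := bessel_phase_tail (y := y) (m := m) A0 (ltW T0) TpA (lexx _) m0 _.
have {}h1 := h1 ltac:(by move: yd1; rewrite ler_norml => /andP[]; rewrite /T in TT *; lra).
have h2 := airy_integral_tail (x := x) (m := m) (ltW T0) m0 ltac:(rewrite /T in TT *; lra).
move: h1; rewrite -(Rintegral_segmentB (continuous_bessel_phase (A := A) (y := y)) (ltW T0) TpA).
have h3 : `|\int[mu]_(t in `[0, T]) cos (bessel_phase A y t) -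
    \int[mu]_(t in `[0, T]) cos (airy_phase x t)| <= e / 4.
  rewrite -RintegralB; last 3 first.
  - exact: measurable_itv.
  - by apply: continuous_integrable; exact: continuous_bessel_phase.
  - by apply: continuous_integrable; exact: continuous_airy_phase.
  apply: (@le_trans _ _ ((e / (4 * T)) * (T - 0))); last first.
    by rewrite subr0 le_eqVlt; apply/orP; left; apply/eqP; field; rewrite gt_eqF.
  apply: Rintegral_segment_bound (ltW T0) _ => [t|t /andP[t0 tT]].
    by apply: is_derive_continuous; rewrite /bessel_phase /airy_phase; der.
  apply: le_trans (cos_lipschitz _ _) _; apply: le_trans (phase_diff _ _ A1 t0) _.
  have -> : e / (4 * T) = e / (8 * T ^+ 2) * T + T ^+ 5 / (8 * T ^+ 6 / e).
    by field; rewrite !gt_eqF.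
  apply: lerD; first by apply: ler_pM.
  apply: ler_pM; rewrite ?invr_ge0 ?exprn_ge0 ?(ltW A0)//.
    by rewrite lerXn2r// nnegrE// ltW.
  by rewrite lef_pV2 ?posrE// divr_gt0// mulr_gt0// exprn_gt0.
rewrite -/(bessel_phase A y).
have -> : (fun t => cos (y * t + 2 * A ^+ 3 * (t / A - sin (t / A)))) = (fun t => cos (bessel_phase A y t)) by [].
move: h2 h3; set P := \int[mu]_(t in _) _; set Q := \int[mu]_(t in _) _; set S := \int[mu]_(t in _) _.
move=> h2 h3 h1.
have -> : pi^-1 * S - Airy x = pi^-1 * ((S - Q) + (Q - P) + (P - pi * Airy x)).
  have pi0 : (pi : R) != 0 by rewrite gt_eqF ?pi_gt0.
  by rewrite !subrKA mulrBr mulKf.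
have p1 : (pi : R)^-1 <= 1 by rewrite invf_le1 ?pi_gt0// (le_trans _ (@pi_ge2 R))// ler1n.
have m3 : 3 / m = e / 4 by rewrite /m; field; rewrite gt_eqF.
rewrite m3 in h1 h2.
rewrite normrM ger0_norm ?invr_ge0 ?pi_ge0//.
apply: (@le_trans _ _ (1 * e)); last by rewrite mul1r.
apply: ler_pM => //; first by rewrite invr_ge0 pi_ge0.
have := ler_normD (S - Q + (Q - P)) (P - pi * Airy x); have := ler_normD (S - Q) (Q - P).
lra.
Qed.

Lemma bessel_cvg_Airy (A : nat -> R) (n : nat -> int) (x : R) :
  A @ \oo --> +oo -> (fun k => ((n k)%:~R - 2 * A k ^+ 3) / A k) @ \oo --> x ->
  (fun k => A k * bessel (A k ^+ 3) (n k)) @ \oo --> Airy x.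
Proof.
move=> Ay nx; apply/cvgrPdist_le => e e0.
have [d d0 [B HB]] := bessel_airy_close x e0.
near=> k; rewrite distrC; apply: HB.
- near: k; move/cvgryPge: Ay; exact.
- near: k; move/cvgryPge: Ay; exact.
- by rewrite distrC; near: k; move/cvgrPdist_le: nx; exact.
Unshelve. all: by end_near. Qed.

End airy_limit.

(** * The kernel at the edge *)

Section step_functions.
Variable R : realType.
Notation mu := (@lebesgue_measure R).

(** Number of the interval of length 1/A, counted from [s], that contains [x]. A sequence evaluated
    at [cell] is a step function, whose integral is 1/A times a sum. *)
Definition cell (s A x : R) : nat := Num.truncn ((x - s) * A).

Lemma cell_itv (s A x : R) : 0 < A -> s <= x ->
  s + (cell s A x)%:R / A <= x < s + (cell s A x).+1%:R / A.
Proof.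
move=> A0 sx; have xs : 0 <= (x - s) * A by rewrite mulr_ge0 ?subr_ge0 ?(ltW A0).
have /andP[h1 h2] := truncn_itv xs; rewrite -/(cell s A x) in h1 h2.
by apply/andP; split; [rewrite -lerBrDl ler_pdivrMr|rewrite -ltrBlDl ltr_pdivlMr].
Qed.

Lemma cell_cst (s A x : R) (n : nat) : 0 < A -> s + n%:R / A <= x < s + n.+1%:R / A -> cell s A x = n.
Proof.
move=> A0 /andP[h1 h2]; apply: truncn_def; apply/andP; split.
  by rewrite -ler_pdivrMr// lerBrDl.
by rewrite -ltr_pdivlMr// ltrBlDl.
Qed.

Lemma measurable_cell (D : set (measurableTypeR R)) (s A : R) (g : nat -> R) : measurable D ->
  measurable_fun D (fun x => g (cell s A x)).
Proof.
move=> mD; apply: measurable_funTS => _ B mB; rewrite setTI.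
have -> : (fun x => g (cell s A x)) @^-1` B =
   \bigcup_(n in [set n | B (g n)]) (cell s A @^-1` [set n]).
  apply/seteqP; split=> x /=; first by move=> Bx; exists (cell s A x).
  by move=> [n /= Bn ->].
apply: bigcup_measurable => n _.
have mlin : measurable_fun setT (fun x : measurableTypeR R => (x - s) * A).
  apply: continuous_measurable_fun => x; apply: is_derive_continuous; der.
have nd (k : nat) : measurable ((fun x => (cell s A x <= k)%N) @^-1` [set true] : set (measurableTypeR R)).
  have -> : (fun x => (cell s A x <= k)%N) @^-1` [set true] = (fun x : R => (x - s) * A) @^-1` `]-oo, k.+1%:R[.
    by apply/seteqP; split=> x /=; rewrite /cell truncn_le_nat in_itv.
  by rewrite -[X in measurable X]setTI; apply: mlin => //; exact: measurable_itv.
case: n => [|n].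
  have -> : cell s A @^-1` [set 0%N] = (fun x => (cell s A x <= 0)%N) @^-1` [set true]; last exact: nd.
  by apply/seteqP; split=> x /=; rewrite leqn0; move=> /eqP.
have -> : cell s A @^-1` [set n.+1] =
   ((fun x => (cell s A x <= n.+1)%N) @^-1` [set true]) `\` ((fun x => (cell s A x <= n)%N) @^-1` [set true]).
  apply/seteqP; split=> x /=; first by move=> ->; rewrite leqnn ltnn.
  move=> [h1 /negP h2]; apply/eqP; rewrite eqn_leq h1 ltnNge; exact: h2.
exact: measurableD.
Qed.

(** Rounding down loses less than one cell, of length 1/A <= 1; this costs the factor e^k. *)
Lemma cell_decay (s A k x : R) : 0 < k -> 1 <= A -> s <= x ->
  expR (- (k * ((cell s A x)%:R / A))) <= expR (k + k * s) * expR (- (k * x)).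
Proof.
move=> k0 A1 sx; have A0 : 0 < A by apply: lt_le_trans A1.
have /andP[_ h] := cell_itv A0 sx.
rewrite -expRD ler_expR -subr_ge0; set c := (cell s A x)%:R / A.
have -> : k + k * s - k * x - - (k * c) = k * (1 + s - x + c) by ring.
rewrite mulr_ge0 ?(ltW k0)//; have : A^-1 <= 1 by rewrite invf_le1.
by move: h; rewrite -natr1 mulrDl mul1r -/c; lra.
Qed.

Lemma ray_measurable (s : R) : measurable (`]s, +oo[%classic : set (measurableTypeR R)).
Proof. exact: measurable_itv. Qed.

Lemma expR_open_ray (k s c : R) : 0 < k ->
  mu.-integrable `]s, +oo[ (EFin \o (fun x => c * expR (- (k * x)))) /\
  \int[mu]_(x in `]s, +oo[) (c * expR (- (k * x))) = c * (expR (- (k * s)) / k).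
Proof.
move=> k0; have [i1 e1] := expR_ray s k0.
have i2 : mu.-integrable `]s, +oo[ (EFin \o (fun x => expR (- (k * x)))).
  by apply: integrableS i1 => //; apply: subset_itvr; rewrite bnd_simp.
split; last by rewrite RintegralZl// Rintegral_itv_obnd_cbnd// e1.
have -> : EFin \o (fun x => c * expR (- (k * x))) = (fun x => c%:E * (EFin \o (fun x => expR (- (k * x)))) x)%E.
  by apply/funext => x /=; rewrite EFinM.
exact: integrableZl.
Qed.

Lemma integrable_cell (s A k C : R) (g : nat -> R) : 0 < k -> 1 <= A ->
  (forall n, `|g n| <= C * expR (- (k * (n%:R / A)))) ->
  mu.-integrable `]s, +oo[ (EFin \o (fun x => g (cell s A x))).
Proof.
move=> k0 A1 gC.
have C0 : 0 <= C.
  by have := gC 0%N; rewrite mul0r mulr0 oppr0 expR0 mulr1; exact: le_trans.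
apply: (integrable_dominated (g := fun x => C * expR (k + k * s) * expR (- (k * x)))).
- exact: ray_measurable.
- exact: measurable_cell (ray_measurable s).
- exact: (expR_open_ray _ _ k0).1.
- move=> x; rewrite /= in_itv/= andbT => sx; apply: le_trans (gC _) _.
  by rewrite -mulrA ler_wpM2l// cell_decay// ltW.
Qed.

Lemma integral_cell_prefix (s A : R) (g : nat -> R) N : 0 < A ->
  mu.-integrable `]s, +oo[ (EFin \o (fun x => g (cell s A x))) ->
  \int[mu]_(x in `]s, s + N%:R / A]) g (cell s A x) = A^-1 * \sum_(n < N) g n.
Proof.
move=> A0 ig.
have sub (b : R) : mu.-integrable `]s, b] (EFin \o (fun x => g (cell s A x))).
  by apply: integrableS ig => //; apply: subset_itvl; rewrite bnd_simp.
elim: N => [|N IH].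
  by rewrite mul0r addr0 big_ord0 mulr0 set_itv_ge ?Rintegral_set0// bnd_simp ltxx.
have sN : s <= s + N%:R / A by rewrite lerDl divr_ge0// ltW.
have NN : s + N%:R / A <= s + N.+1%:R / A by rewrite lerD2l ler_pM2r ?invr_gt0// ler_nat.
apply/eqP; rewrite -subr_eq0 big_ord_recr /= mulrDr opprD addrA -IH.
rewrite Rintegral_itvB ?bnd_simp//.
rewrite -Rintegral_itv_bndo_bndc; last first.
  apply: integrableS ig => // x /=; rewrite !in_itv/= => /andP[h _]; rewrite andbT.
  by apply: le_lt_trans h.
rewrite (@eq_Rintegral _ _ _ _ _ (fun _ => g N)); last first.
  move=> x; rewrite inE/= in_itv/= => /andP[h1 h2]; congr g.
  by apply: cell_cst => //; rewrite (ltW h1).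
have lt1 : s + N%:R / A < s + N.+1%:R / A by rewrite ltrD2l ltr_pM2r ?invr_gt0// ltr_nat.
rewrite Rintegral_cst; last exact: measurable_itv.
have -> : fine (mu `]s + N%:R / A, s + N.+1%:R / A[) = s + N.+1%:R / A - (s + N%:R / A).
  by rewrite lebesgue_measure_itv /= lte_fin lt1 -EFinD.
rewrite -natr1.
by apply/eqP; field; rewrite gt_eqF.
Qed.

Lemma integral_cell_cvg (s A k C : R) (g : nat -> R) : 0 < k -> 1 <= A ->
  (forall n, `|g n| <= C * expR (- (k * (n%:R / A)))) ->
  (fun N => A^-1 * \sum_(n < N) g n) @ \oo --> \int[mu]_(x in `]s, +oo[) g (cell s A x).
Proof.
move=> k0 A1 gC; have A0 : 0 < A by apply: lt_le_trans A1.
have ig := integrable_cell s k0 A1 gC.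
have C0 : 0 <= C.
  by have := gC 0%N; rewrite mul0r mulr0 oppr0 expR0 mulr1; exact: le_trans.
pose M := C * expR (k + k * s) * (expR (- (k * s)) / k).
apply: (cvg_dist_le (v := fun N => M * expR (- (k / A)) ^+ N)); last first.
  rewrite -[X in _ --> X](mulr0 M); apply: cvgM; first exact: cvg_cst.
  apply: cvg_expr; rewrite ger0_norm ?expR_ge0// -expR0 ltr_expR oppr_lt0.
  by rewrite divr_gt0.
apply: nearW => N; rewrite -(integral_cell_prefix (s := s))// distrC.
have sN : s <= s + N%:R / A by rewrite lerDl divr_ge0// ltW.
rewrite Rintegral_itvB ?bnd_simp//.
have [i1 e1] := expR_open_ray (s + N%:R / A) (C * expR (k + k * s)) k0.
apply: le_trans (Rintegral_norm_le _ _ i1 _) _.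
- exact: ray_measurable.
- exact: measurable_cell (ray_measurable _).
- move=> x; rewrite /= in_itv/= andbT => sx; apply: le_trans (gC _) _.
  by rewrite -mulrA ler_wpM2l// cell_decay// (le_trans sN)// ltW.
rewrite e1 /M -expRM_natl le_eqVlt; apply/orP; left; apply/eqP.
have -> : - (k * (s + N%:R / A)) = - (k * s) + N%:R * - (k / A) by ring.
by rewrite [expR (- (k * s) + _)]expRD; ring.
Qed.

(** The first bound gives integrability on the ray, the second the convergence of the partial sums
    to [tsum]; both evaluate the same limit. *)
Lemma integral_cell_tsum (A k C C' : R) (g : nat -> R) : 0 < k -> 1 <= A ->
  (forall n, `|g n| <= C * expR (- (k * (n%:R / A)))) ->
  (forall n, `|g n| <= C' * 2^-1 ^+ n) ->
  \int[mu]_(u in `[0, +oo[) g (cell 0 A u) = A^-1 * tsum g.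
Proof.
move=> k0 A1 gC gC'.
have C0 : 0 <= C' by have := gC' 0%N; rewrite expr0 mulr1; exact: le_trans.
rewrite -Rintegral_itv_obnd_cbnd; last first.
  exact: (integrable_cell 0 k0 A1 gC).
have c1 := integral_cell_cvg (s := 0) k0 A1 gC.
have c2 : (fun N => A^-1 * \sum_(n < N) g n) @ \oo --> A^-1 * tsum g.
  apply: cvgM; first exact: cvg_cst.
  apply: (cvg_dist_le (v := fun N => C' * 2 * 2^-1 ^+ N)); last exact: cvg_half.
  by apply: nearW => N; rewrite distrC; apply: tsum_nat_tail.
exact: (@cvg_unique _ (@Rhausdorff R) _ _ _ _ c1 c2).
Qed.

Lemma integral_cell_finite (s A : R) (g : nat -> R) N : 1 <= A ->
  (forall n, (N <= n)%N -> g n = 0) ->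
  \int[mu]_(x in `]s, +oo[) g (cell s A x) = A^-1 * \sum_(n < N) g n.
Proof.
move=> A1 g0; have A0 : 0 < A by apply: lt_le_trans A1.
pose C := (\sum_(n < N) `|g n|) * expR (N%:R / A).
have gC n : `|g n| <= C * expR (- (1 * (n%:R / A))).
  have [nN|Nn] := ltnP n N; last by rewrite g0// normr0 !mulr_ge0 ?expR_ge0 ?sumr_ge0.
  rewrite mul1r /C -mulrA -expRD; apply: (@le_trans _ _ ((\sum_(n < N) `|g n|) * 1)).
    by rewrite mulr1 (bigD1 (Ordinal nN))//= lerDl sumr_ge0.
  apply: ler_wpM2l; first exact: sumr_ge0.
  by rewrite -[leLHS]expR0 ler_expR -mulrBl divr_ge0 ?(ltW A0)// subr_ge0 ler_nat ltnW.
have c1 := integral_cell_cvg (s := s) ltr01 A1 gC.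
apply: (@cvg_unique _ (@Rhausdorff R) _ _ _ _ c1).
apply: (cvg_dist_le (v := fun _ => 0)); last exact: cvg_cst.
exists N => // M /= NM; rewrite -mulrBr -(subnKC NM) big_split_ord /= addrAC subrr add0r.
by rewrite big1 ?mulr0 ?normr0// => i _; rewrite g0// leq_addr.
Qed.

End step_functions.

(** * Bounds and limit of the scaled kernel *)

Section kernel_limit.
Variable R : realType.
Notation mu := (@lebesgue_measure R).
Implicit Types (A s : R) (L i j m : nat).

(** Measured from the edge, (z - 2 A^3) / A is at least s - 2 + w / A: the hypotheses lose at most 2
    units of index, and 2 / A <= 2. *)
Lemma bessel_shift_bound (k s : R) : 0 < k -> exists2 M : R, 0 <= M &
  forall A L (w z : int), 1 <= A -> 2 * A ^+ 3 + s * A < L%:R + 1 -> L%:Z - 1 + w <= z ->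
  `|A * bessel (A ^+ 3) z| <= M * expR (- (k * (w%:~R / A))).
Proof.
move=> k0; have [C C0 HC] := @bessel_exp_bound R k k0.
exists (C * expR (- (k * (s - 2)))) => [|A L w z A1 LA wz]; first by rewrite mulr_ge0 ?expR_ge0.
have A0 : 0 < A by apply: lt_le_trans A1.
apply: le_trans (HC A z A1) _; rewrite -mulrA -expRD; apply: ler_wpM2l => //.
rewrite ler_expR -opprD lerN2 -mulrDr ler_pM2l//.
have wzR : L%:R - 1 + w%:~R <= z%:~R :> R.
  by move: wz; rewrite -(ler_int R) intrD intrB.
rewrite ler_pdivlMr// mulrDl mulfVK ?gt_eqF//.
have -> : (s - 2) * A = s * A - 2 * A by ring.
lra.
Qed.

(** The constant may depend on everything but [m]: this only secures summability at a fixed scale.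
    Radius 4 again beats the growth 2^m of the factor with decreasing index. *)
Lemma bessel_geometric (theta : R) (z w : int) : exists C : R, forall m,
  `|bessel theta (z + m%:Z) * bessel theta (w + m%:Z)| <= C * 2^-1 ^+ m /\
  `|bessel theta (z - m%:Z) * bessel theta (w + m%:Z)| <= C * 2^-1 ^+ m.
Proof.
have [|C1 C10 H1] := exp2_bound theta (- theta) (r := 1) _ => //.
have [|C2 C20 H2] := exp2_bound theta (- theta) (r := 2); first by rewrite ler1n.
have [|C4 C40 H4] := exp2_bound theta (- theta) (r := 4); first by rewrite ler1n.
pose D1 := C1 * (C2 * 2 ^ (- w)); pose D2 := C2 * 2 ^ (- z) * (C4 * 4 ^ (- w)).
have p2 (k : int) : 0 <= (2 : R) ^ k by rewrite exprz_ge0.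
have p4 (k : int) : 0 <= (4 : R) ^ k by rewrite exprz_ge0.
have D10 : 0 <= D1 by rewrite !mulr_ge0.
have D20 : 0 <= D2 by rewrite !mulr_ge0.
have u2 : (2 : R) != 0 by rewrite pnatr_eq0.
have u4 : (4 : R) != 0 by rewrite pnatr_eq0.
exists (D1 + D2) => m; rewrite !normrM mulrDl; split.
  apply: (@le_trans _ _ (D1 * 2^-1 ^+ m)); last by rewrite lerDl mulr_ge0// exprn_ge0.
  rewrite /D1 -mulrA; apply: ler_pM => //.
    by apply: le_trans (H1 _) _; rewrite exp1rz mulr1.
  apply: le_trans (H2 _) _; rewrite -mulrA ler_wpM2l// opprD expfzDr//.
  by rewrite exprVn exprnN.
apply: (@le_trans _ _ (D2 * 2^-1 ^+ m)); last by rewrite lerDr mulr_ge0// exprn_ge0.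
apply: (@le_trans _ _ (C2 * 2 ^ (- (z - m%:Z)) * (C4 * 4 ^ (- (w + m%:Z))))).
  by apply: ler_pM => //; [exact: H2|exact: H4].
rewrite /D2 opprB opprD addrC !expfzDr// -exprnP -[4 ^ (- m%:Z)]exprnN.
have -> : (4 : R) ^- m = 2^-1 ^+ m * 2^-1 ^+ m.
  by rewrite -exprMn -exprVn; congr (_ ^+ m); field.
have e : (2 : R) ^+ m * 2^-1 ^+ m = 1 by rewrite -exprMn divff// expr1n.
have -> : C2 * (2 ^ (- z) * 2 ^+ m) * (C4 * (4 ^ (- w) * (2^-1 ^+ m * 2^-1 ^+ m))) =
  C2 * 2 ^ (- z) * (C4 * 4 ^ (- w)) * 2^-1 ^+ m * (2 ^+ m * 2^-1 ^+ m) by ring.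
by rewrite e mulr1.
Qed.

Definition straight_term A (q j m : nat) : R :=
  A * bessel (A ^+ 3) (q%:Z + 1 + m%:Z) * (A * bessel (A ^+ 3) (j%:Z + 1 + m%:Z)).
Definition folded_term (c : bool) A (q j m : nat) : R :=
  A * bessel (A ^+ 3) (q%:Z + (c : nat)%:Z - 1 - m%:Z) *
  (A * bessel (A ^+ 3) (j%:Z + (c : nat)%:Z + 1 + m%:Z)).

(** In the folded term the first factor is bounded at rate 1 by e^{-(i - m)/A}, which grows in [m];
    rate 2 for the second gives e^{-2 m / A}. Decay in the row index [i] alone is kept, as
    Hadamard's inequality works by rows. *)
Lemma kernel_term_bound (c : bool) (s : R) : exists2 M : R, 0 <= M &
  forall A L i j m, 1 <= A -> 2 * A ^+ 3 + s * A < L%:R + 1 ->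
   `|straight_term A (L + i) (L + j) m| <= M * expR (- (i%:R / A)) * expR (- (1 * (m%:R / A))) /\
   `|folded_term c A (L + i) (L + j) m| <= M * expR (- (i%:R / A)) * expR (- (1 * (m%:R / A))).
Proof.
have [M1 M10 H1] := bessel_shift_bound s (ltr01 : (0 : R) < 1).
have [M2 M20 H2] := bessel_shift_bound s (ltr0Sn R 1).
exists (M1 * M1 + M1 * M2) => [|A L i j m A1 LA]; first by rewrite addr_ge0 ?mulr_ge0.
have A0 : 0 < A by apply: lt_le_trans A1.
have cc : (0 <= (c : nat)%:Z <= 1) by case: (c).
have mA : 0 <= m%:R / A by rewrite divr_ge0 ?(ltW A0).
have jA : 0 <= j%:R / A by rewrite divr_ge0 ?(ltW A0).
have e0 (x : R) := expR_ge0 x.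
rewrite !mulrDl; split; rewrite /straight_term /folded_term normrM.
  apply: (@le_trans _ _ (M1 * M1 * expR (- (i%:R / A)) * expR (- (1 * (m%:R / A))))); last first.
    by rewrite lerDl !mulr_ge0.
  have h1 := H1 A L (i%:Z + m%:Z) ((L + i)%N%:Z + 1 + m%:Z) A1 LA ltac:(lia).
  have h2 := H1 A L 0 ((L + j)%N%:Z + 1 + m%:Z) A1 LA ltac:(lia).
  apply: le_trans (ler_pM _ _ h1 h2) _ => //.
  rewrite mul0r mulr0 oppr0 expR0 mulr1 intrD -!pmulrn !mul1r mulrDl opprD expRD.
  by rewrite le_eqVlt; apply/orP; left; apply/eqP; ring.
apply: (@le_trans _ _ (M1 * M2 * expR (- (i%:R / A)) * expR (- (1 * (m%:R / A))))); last first.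
  by rewrite lerDr !mulr_ge0.
have h1 := H1 A L (i%:Z - m%:Z) ((L + i)%N%:Z + (c : nat)%:Z - 1 - m%:Z) A1 LA ltac:(lia).
have h2 := H2 A L m%:Z ((L + j)%N%:Z + (c : nat)%:Z + 1 + m%:Z) A1 LA ltac:(lia).
apply: le_trans (ler_pM _ _ h1 h2) _ => //.
rewrite le_eqVlt; apply/orP; left; apply/eqP.
rewrite intrB -!pmulrn !mul1r mulrACA -expRD -[RHS]mulrA -expRD; congr (_ * expR _).
by field; rewrite gt_eqF.
Qed.

Lemma integrable_Rintegral_open_ray (f : R -> R) (s : R) :
  mu.-integrable `]s, +oo[ (EFin \o f) ->
  \int[mu]_(x in `[s, +oo[) f x = \int[mu]_(x in `]s, +oo[) f x.
Proof. by move=> i; rewrite Rintegral_itv_obnd_cbnd. Qed.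

Section fixed_scale.
Variables (c : bool) (s M A : R) (L : nat).
Hypotheses (A1 : 1 <= A) (LA : 2 * A ^+ 3 + s * A < L%:R + 1).
Hypothesis HM : forall A L i j m, 1 <= A -> 2 * A ^+ 3 + s * A < L%:R + 1 ->
   `|straight_term A (L + i) (L + j) m| <= M * expR (- (i%:R / A)) * expR (- (1 * (m%:R / A))) /\
   `|folded_term c A (L + i) (L + j) m| <= M * expR (- (i%:R / A)) * expR (- (1 * (m%:R / A))).

(** The two scaled Bessel factors bring A^2 and the cell length takes away one A, leaving the
    density [A] in front of the kernel. *)
Lemma scaled_kernel_integral i j : A * fold_kernel c (A ^+ 3) (L + i) (L + j) =
  \int[mu]_(u in `]0, +oo[) straight_term A (L + i) (L + j) (cell 0 A u) -
  (-1) ^+ c * \int[mu]_(u in `]0, +oo[) folded_term c A (L + i) (L + j) (cell 0 A u).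
Proof.
have A0 : 0 < A by apply: lt_le_trans A1.
have b1 m := (HM i j m A1 LA).1.
have b2 m := (HM i j m A1 LA).2.
have [C1 g1] := bessel_geometric (A ^+ 3) ((L + i)%N%:Z + 1) ((L + j)%N%:Z + 1).
have [C2 g2] := bessel_geometric (A ^+ 3) ((L + i)%N%:Z + (c : nat)%:Z - 1) ((L + j)%N%:Z + (c : nat)%:Z + 1).
have AA (u v : R) : A * u * (A * v) = A ^+ 2 * (u * v) by ring.
have s1 : forall m, `|straight_term A (L + i) (L + j) m| <= (A ^+ 2 * C1) * 2^-1 ^+ m.
  move=> m; rewrite /straight_term AA normrM ger0_norm ?sqr_ge0// -mulrA.
  by apply: ler_wpM2l; [exact: sqr_ge0|exact: (g1 m).1].
have s2 : forall m, `|folded_term c A (L + i) (L + j) m| <= (A ^+ 2 * C2) * 2^-1 ^+ m.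
  move=> m; rewrite /folded_term AA normrM ger0_norm ?sqr_ge0// -mulrA.
  by apply: ler_wpM2l; [exact: sqr_ge0|exact: (g2 m).2].
rewrite -!integrable_Rintegral_open_ray; last 2 first.
- exact: (integrable_cell 0 ltr01 A1 b2).
- exact: (integrable_cell 0 ltr01 A1 b1).
rewrite (integral_cell_tsum ltr01 A1 b1 s1) (integral_cell_tsum ltr01 A1 b2 s2).
rewrite /fold_kernel mulrBr mulrCA; congr (_ - _ * _).
  have sm := abs_summable_half_bound (fun m => (g1 m).1).
  rewrite (_ : straight_term A (L + i) (L + j) = fun m => A ^+ 2 * (bessel (A ^+ 3) ((L + i)%N%:Z + 1 + m%:Z) * bessel (A ^+ 3) ((L + j)%N%:Z + 1 + m%:Z))).
    by rewrite tsumZ// expr2 mulrA mulKf// gt_eqF.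
  by apply/funext => m; rewrite /straight_term AA.
have sm := abs_summable_half_bound (fun m => (g2 m).2).
rewrite (_ : folded_term c A (L + i) (L + j) = fun m => A ^+ 2 * (bessel (A ^+ 3) ((L + i)%N%:Z + (c : nat)%:Z - 1 - m%:Z) * bessel (A ^+ 3) ((L + j)%N%:Z + (c : nat)%:Z + 1 + m%:Z))).
  by rewrite tsumZ// expr2 mulrA mulKf// gt_eqF.
by apply/funext => m; rewrite /folded_term AA.
Qed.

Lemma integral_cell_bound (g : nat -> R) (C : R) :
  (forall m, `|g m| <= C * expR (- (1 * (m%:R / A)))) ->
  (forall u, `]0, +oo[%classic u -> `|g (cell 0 A u)| <= C * expR 1 * expR (- (1 * u))) /\
  `|\int[mu]_(u in `]0, +oo[) g (cell 0 A u)| <= C * expR 1.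
Proof.
move=> gC; have C0 : 0 <= C.
  by have := gC 0%N; rewrite mul0r mulr0 oppr0 expR0 mulr1; exact: le_trans.
have ptw u : `]0, +oo[%classic u -> `|g (cell 0 A u)| <= C * expR 1 * expR (- (1 * u)).
  rewrite /= in_itv/= andbT => u0; apply: le_trans (gC _) _; rewrite -mulrA ler_wpM2l//.
  by have := cell_decay ltr01 A1 (ltW u0); rewrite mulr0 addr0.
split=> //; have [i1 e1] := expR_open_ray 0 (C * expR 1) (ltr01 : (0 : R) < 1).
apply: le_trans (Rintegral_norm_le _ _ i1 ptw) _.
- exact: ray_measurable.
- exact: measurable_cell (ray_measurable 0).
by rewrite e1 mulr0 oppr0 expR0 divr1 mulr1.
Qed.

Lemma scaled_kernel_bound i j :
  `|A * fold_kernel c (A ^+ 3) (L + i) (L + j)| <= M * expR 1 * 2 * expR (- (i%:R / A)).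
Proof.
have b1 m := (HM i j m A1 LA).1.
have b2 m := (HM i j m A1 LA).2.
rewrite scaled_kernel_integral; apply: le_trans (ler_normB _ _) _.
rewrite normrM normrX normrN1 expr1n mul1r.
apply: le_trans (lerD (integral_cell_bound b1).2 (integral_cell_bound b2).2) _.
by rewrite le_eqVlt; apply/orP; left; apply/eqP; ring.
Qed.

End fixed_scale.

Lemma kernel_bound (c : bool) (s : R) : exists2 C : R, 0 <= C &
  forall A L i j, 1 <= A -> 2 * A ^+ 3 + s * A < L%:R + 1 ->
   `|A * fold_kernel c (A ^+ 3) (L + i) (L + j)| <= C * expR (- (i%:R / A)).
Proof.
have [M M0 HM] := kernel_term_bound c s.
exists (M * expR 1 * 2) => [|A L i j A1 LA]; first by rewrite !mulr_ge0 ?expR_ge0.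
exact: (scaled_kernel_bound A1 LA HM).
Qed.

(** A bounded rounding error of the index disappears after division by [A k]. *)
Lemma scaled_index_cvg (A : nat -> R) (z : nat -> int) (X K : R) :
  A @ \oo --> +oo -> (forall k, 1 <= A k) ->
  (forall k, `|(z k)%:~R - (2 * A k ^+ 3 + A k * X)| <= K) ->
  (fun k => ((z k)%:~R - 2 * A k ^+ 3) / A k) @ \oo --> X.
Proof.
move=> Ay A1 zK; apply: (cvg_dist_le (v := fun k => K * (A k)^-1)); last first.
  rewrite -[X in _ --> X](mulr0 K); apply: cvgM; first exact: cvg_cst.
  by apply/gtr0_cvgV0 => //; apply: nearW => k; apply: lt_le_trans (A1 k).
apply: nearW => k; have A0 : 0 < A k by apply: lt_le_trans (A1 k).
have -> : ((z k)%:~R - 2 * A k ^+ 3) / A k - X = ((z k)%:~R - (2 * A k ^+ 3 + A k * X)) * (A k)^-1.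
  by field; rewrite gt_eqF.
by rewrite normrM [X in _ * X <= _]ger0_norm ?invr_ge0 ?(ltW A0)// ler_wpM2r ?invr_ge0 ?(ltW A0).
Qed.

(** Up to rounding, [L] + [cell s A x] + [cell 0 A u] equals 2 A^3 + A (x + u), so each scaled
    Bessel factor tends to an Airy value; the reflected index gives x - u. The exponential bound in
    [u] permits dominated convergence. *)
Lemma kernel_cvg (c : bool) (s : R) (A : nat -> R) (L : nat -> nat) (x y : R) :
  A @ \oo --> +oo -> (forall k, 1 <= A k) ->
  (forall k, (L k)%:R <= 2 * A k ^+ 3 + s * A k < (L k)%:R + 1) -> s < x -> s < y ->
  (fun k => A k * fold_kernel c (A k ^+ 3) (L k + cell s (A k) x) (L k + cell s (A k) y)) @ \oo -->
    Akernel (if c then 1 else -1) x y.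
Proof.
move=> Ay A1 LA sx sy.
have A0 k : 0 < A k by apply: lt_le_trans (A1 k).
have LA2 k : 2 * A k ^+ 3 + s * A k < (L k)%:R + 1 by case/andP: (LA k).
have [M M0 HM] := kernel_term_bound c s.
have cb k (t a : R) : t <= a -> (a - t) * A k - 1 < (cell t (A k) a)%:R <= (a - t) * A k.
  move=> ta; have /andP[h1 h2] := cell_itv (A0 k) ta; apply/andP; split.
    by rewrite ltrBlDr natr1 -ltr_pdivlMr// ltrBlDl.
  by rewrite -ler_pdivrMr// lerBrDl.
have e1 k (i : nat) : expR (- (i%:R / A k)) <= 1.
  by rewrite -[leRHS]expR0 ler_expR oppr_le0 divr_ge0// ltW.
have dom k i j m : `|straight_term (A k) (L k + i) (L k + j) m| <= M * expR (- (1 * (m%:R / A k))) /\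
   `|folded_term c (A k) (L k + i) (L k + j) m| <= M * expR (- (1 * (m%:R / A k))).
  have [h1 h2] := HM (A k) (L k) i j m (A1 k) (LA2 k).
  by split; [apply: le_trans h1 _|apply: le_trans h2 _]; rewrite ler_wpM2r ?expR_ge0// ler_piMr.
have [ie _] := expR_open_ray 0 (M * expR 1) (ltr01 : (0 : R) < 1).
have [|||i1 c1] := @Rdominated_convergence R `]0, +oo[
   (fun k u => straight_term (A k) (L k + cell s (A k) x) (L k + cell s (A k) y) (cell 0 (A k) u))
   (fun u => Airy (x + u) * Airy (y + u)) _ (ray_measurable 0) _ _ ie.
- by move=> k; exact: measurable_cell (ray_measurable 0).
- move=> u; rewrite /= in_itv/= andbT => u0.
  (* The index is off by less than 1 for [L] and for each of the two cells, plus the fixed shift 1,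
     which 5 covers. *)
  apply: cvgM; apply: bessel_cvg_Airy => //; apply: (scaled_index_cvg (K := 5)) => // k.
    have := cb k s x (ltW sx); have := cb k 0 u (ltW u0); have := LA k; have := A1 k.
    rewrite subr0 !intrD -!pmulrn natrD ler_norml.
    by move=> h1 /andP[h2 h3] /andP[h4 h5] /andP[h6 h7]; apply/andP; split; lra.
  have := cb k s y (ltW sy); have := cb k 0 u (ltW u0); have := LA k; have := A1 k.
  rewrite subr0 !intrD -!pmulrn natrD ler_norml.
  by move=> h1 /andP[h2 h3] /andP[h4 h5] /andP[h6 h7]; apply/andP; split; lra.
- by move=> k u u0; exact: (integral_cell_bound (A1 k) (fun m => (dom k _ _ m).1)).1.
have [|||i2 c2] := @Rdominated_convergence R `]0, +oo[
   (fun k u => folded_term c (A k) (L k + cell s (A k) x) (L k + cell s (A k) y) (cell 0 (A k) u))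
   (fun u => Airy (x - u) * Airy (y + u)) _ (ray_measurable 0) _ _ ie.
- by move=> k; exact: measurable_cell (ray_measurable 0).
- have /andP[cc0 cc1] : 0 <= ((c : nat)%:R : R) <= 1 by rewrite ler0n lern1; case: (c).
  move=> u; rewrite /= in_itv/= andbT => u0.
  apply: cvgM; apply: bessel_cvg_Airy => //; apply: (scaled_index_cvg (K := 5)) => // k.
    have := cb k s x (ltW sx); have := cb k 0 u (ltW u0); have := LA k; have := A1 k.
    rewrite subr0 !intrB intrD -!pmulrn natrD ler_norml.
    by move=> h1 /andP[h2 h3] /andP[h4 h5] /andP[h6 h7]; apply/andP; split; lra.
  have := cb k s y (ltW sy); have := cb k 0 u (ltW u0); have := LA k; have := A1 k.
  rewrite subr0 !intrD -!pmulrn natrD ler_norml.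
  by move=> h1 /andP[h2 h3] /andP[h4 h5] /andP[h6 h7]; apply/andP; split; lra.
- by move=> k u u0; exact: (integral_cell_bound (A1 k) (fun m => (dom k _ _ m).2)).1.
under eq_fun => k do rewrite (scaled_kernel_integral (A1 k) (LA2 k) HM).
rewrite /Akernel (integrable_Rintegral_open_ray i1) (integrable_Rintegral_open_ray i2).
have -> : (if c then 1 else -1) = - (-1) ^+ c :> R by case: (c); rewrite ?expr1 ?opprK ?expr0.
rewrite mulNr; move: c1 c2.
set I1 := \int[mu]_(u in _) _; set I2 := \int[mu]_(u in _) _.
move=> c1 c2.
have comb (f1 f2 : nat -> R) (a l1 l2 : R) : f1 @ \oo --> l1 -> f2 @ \oo --> l2 ->
    (fun k => f1 k - a * f2 k) @ \oo --> l1 - a * l2.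
  by move=> h1 h2; apply: cvgB => //; apply: cvgM => //; exact: cvg_cst.
exact: comb _ _ _ _ _ c1 c2.
Qed.

End kernel_limit.

(** * Fredholm determinants *)

Section iterated_cells.
Variable R : realType.
Notation mu := (@lebesgue_measure R).
Variable s : R.
Implicit Types (A : R) (l : seq R).

Definition above l := all (fun x => s < x) l.

(** The integrand sees its variables only through their cells, so every inner iterated integral is a
    step function of the outer variable, hence measurable. *)
Lemma iter_cell_bound (g : R -> R) n A (G : seq nat -> R) (c : R) :
  mu.-integrable `]s, +oo[ (EFin \o g) ->
  (forall l, size l = n -> above l -> `|G (map (cell s A) l)| <= c * \prod_(x <- l) g x) ->
  `|iter_int s n (fun l => G (map (cell s A) l))| <= c * (\int[mu]_(x in `]s, +oo[) g x) ^+ n.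
Proof.
move=> ig; elim: n G c => [|n IH] G c GC.
  by have := GC [::] erefl isT; rewrite big_nil /= expr0.
pose I := \int[mu]_(x in `]s, +oo[) g x.
pose H (i : nat) := iter_int s n (fun l => G (i :: map (cell s A) l)).
have -> : iter_int s n.+1 (fun l => G (map (cell s A) l)) = \int[mu]_(x in `]s, +oo[) H (cell s A x) by [].
have HB x : `]s, +oo[%classic x -> `|H (cell s A x)| <= c * I ^+ n * g x.
  rewrite /= in_itv/= andbT => sx; rewrite mulrAC; apply: (IH (fun t => G (cell s A x :: t))) => l sl al.
  by have := GC (x :: l); rewrite big_cons mulrA; apply; [rewrite /= sl|rewrite /above /= sx].
have igc : mu.-integrable `]s, +oo[ (EFin \o (fun x => c * I ^+ n * g x)).
  have -> : EFin \o (fun x => c * I ^+ n * g x) = (fun x => (c * I ^+ n)%:E * (EFin \o g) x)%E.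
    by apply/funext => x /=; rewrite EFinM.
  by apply: integrableZl => //; exact: ray_measurable.
apply: le_trans (Rintegral_norm_le _ _ igc HB) _.
- exact: ray_measurable.
- exact: (measurable_cell s A H (ray_measurable s)).
by rewrite RintegralZl// -/I exprSr mulrA.
Qed.

(** Dominated convergence, one variable at a time: [iter_cell_bound] dominates the inner integrals,
    and the limit inherits measurability from the step functions. *)
Lemma iter_cell_cvg (g : R -> R) n (A : nat -> R) (G : nat -> seq nat -> R) (F : seq R -> R) (c : R) :
  mu.-integrable `]s, +oo[ (EFin \o g) ->
  (forall k l, size l = n -> above l -> `|G k (map (cell s (A k)) l)| <= c * \prod_(x <- l) g x) ->
  (forall l, size l = n -> above l -> (fun k => G k (map (cell s (A k)) l)) @ \oo --> F l) ->
  (fun k => iter_int s n (fun l => G k (map (cell s (A k)) l))) @ \oo --> iter_int s n F.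
Proof.
move=> ig; elim: n G F c => [|n IH] G F c GC GF; first exact: (GF [::]).
pose I := \int[mu]_(x in `]s, +oo[) g x.
pose H k (i : nat) := iter_int s n (fun l => G k (i :: map (cell s (A k)) l)).
have GC' k x l : s < x -> size l = n -> above l ->
    `|G k (cell s (A k) x :: map (cell s (A k)) l)| <= c * g x * \prod_(y <- l) g y.
  move=> sx sl al; have := GC k (x :: l); rewrite big_cons mulrA; apply; first by rewrite /= sl.
  by rewrite /above /= sx.
have HB k x : `]s, +oo[%classic x -> `|H k (cell s (A k) x)| <= c * I ^+ n * g x.
  rewrite /= in_itv/= andbT => sx; rewrite mulrAC.
  by apply: (iter_cell_bound (G := fun t => G k (cell s (A k) x :: t)) ig) => l sl al; exact: GC'.
have igc : mu.-integrable `]s, +oo[ (EFin \o (fun x => c * I ^+ n * g x)).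
  have -> : EFin \o (fun x => c * I ^+ n * g x) = (fun x => (c * I ^+ n)%:E * (EFin \o g) x)%E.
    by apply/funext => x /=; rewrite EFinM.
  by apply: integrableZl => //; exact: ray_measurable.
have [||_ cv] := @Rdominated_convergence R `]s, +oo[ (fun k x => H k (cell s (A k) x))
   (fun x => iter_int s n (fun l => F (x :: l))) _ (ray_measurable s) _ _ igc HB.
- by move=> k; exact: (measurable_cell s (A k) (H k) (ray_measurable s)).
- move=> x; rewrite /= in_itv/= andbT => sx.
  apply: (IH (fun k t => G k (cell s (A k) x :: t)) (fun l => F (x :: l)) (c * g x)).
    by move=> k l sl al; exact: GC'.
  move=> l sl al; apply: (GF (x :: l)); first by rewrite /= sl.
  by rewrite /above /= sx.
exact: cv.
Qed.

Definition cons_ffun (T : finType) n (x : T) (f : {ffun 'I_n -> T}) : {ffun 'I_n.+1 -> T} :=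
  [ffun k => if unlift ord0 k is Some j then f j else x].

Lemma sum_cons_ffun (T : finType) n (F : {ffun 'I_n.+1 -> T} -> R) :
  \sum_f F f = \sum_x \sum_(f : {ffun 'I_n -> T}) F (cons_ffun x f).
Proof.
rewrite pair_big /=; pose tl (f : {ffun 'I_n.+1 -> T}) := (f ord0, [ffun j : 'I_n => f (lift ord0 j)]).
rewrite (reindex (fun p : T * {ffun 'I_n -> T} => cons_ffun p.1 p.2)) /=; first exact: eq_bigr.
exists tl => [[x f]|f] _ /=.
  rewrite /tl /cons_ffun ffunE unlift_none; congr pair.
  by apply/ffunP => j; rewrite !ffunE liftK.
by apply/ffunP => k; rewrite ffunE; case: unliftP => [j ->|->]; rewrite ?ffunE.
Qed.

Definition ffun_seq n N (f : {ffun 'I_n -> 'I_N}) : seq nat := [seq val (f j) | j <- enum 'I_n].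

Lemma ffun_seq_cons n N (x : 'I_N) (f : {ffun 'I_n -> 'I_N}) :
  ffun_seq (cons_ffun x f) = (x : nat) :: ffun_seq f.
Proof.
rewrite /ffun_seq enum_ordSl /= /cons_ffun ffunE unlift_none; congr cons.
by rewrite -map_comp; apply: eq_map => j /=; rewrite ffunE liftK.
Qed.

Lemma nth_ffun_seq n N (f : {ffun 'I_n -> 'I_N}) (i : 'I_n) : nth 0%N (ffun_seq f) i = f i.
Proof. by rewrite /ffun_seq (nth_map i) ?size_enum_ord// nth_ord_enum. Qed.

Lemma iter_cell_finite n N A (G : seq nat -> R) : 1 <= A ->
  (forall t : seq nat, size t = n -> has (fun i => N <= i)%N t -> G t = 0) ->
  iter_int s n (fun l => G (map (cell s A) l)) =
  (A ^- n) * \sum_(f : {ffun 'I_n -> 'I_N}) G (ffun_seq f).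
Proof.
move=> A1; elim: n G => [|n IH] G G0.
  have e (f : {ffun 'I_0 -> 'I_N}) : f = [ffun j : 'I_0 => match notF (ltn_ord j) return 'I_N with end].
    by apply/ffunP => -[].
  rewrite expr0 invr1 mul1r (bigD1 [ffun j : 'I_0 => match notF (ltn_ord j) return 'I_N with end])//=.
  rewrite big1 ?addr0 => [|f /eqP fe]; last by case: fe; exact: e.
  by rewrite /ffun_seq (_ : enum 'I_0 = [::])//; apply: size0nil; rewrite size_enum_ord.
pose H (i : nat) := iter_int s n (fun l => G (i :: map (cell s A) l)).
have HE i : H i = (A ^- n) * \sum_(f : {ffun 'I_n -> 'I_N}) G (i :: ffun_seq f).
  apply: (IH (fun t => G (i :: t))) => t st ht; apply: G0; first by rewrite /= st.
  by rewrite /= ht orbT.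
have -> : iter_int s n.+1 (fun l => G (map (cell s A) l)) = \int[mu]_(x in `]s, +oo[) H (cell s A x) by [].
rewrite (@integral_cell_finite R s A H N)// => [|i Ni]; last first.
  rewrite HE big1 ?mulr0// => f _; apply: G0 => /=.
    by rewrite /ffun_seq size_map size_enum_ord.
  by rewrite Ni.
rewrite sum_cons_ffun exprS invfM -mulrA; congr (_ * _).
rewrite mulr_sumr; apply: eq_bigr => i _; rewrite HE; congr (_ * _).
by apply: eq_bigr => f _; rewrite ffun_seq_cons.
Qed.

End iterated_cells.

Section fredholm_limit.
Variable R : realType.
Notation mu := (@lebesgue_measure R).

Lemma cvg_bigsum (I : Type) (r : seq I) (f : I -> nat -> R) (l : I -> R) :
  (forall i, f i @ \oo --> l i) -> (fun k => \sum_(i <- r) f i k) @ \oo --> \sum_(i <- r) l i.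
Proof.
move=> fl; elim: r => [|i r IH].
  by under eq_fun do rewrite big_nil; rewrite big_nil; exact: cvg_cst.
by under eq_fun do rewrite big_cons; rewrite big_cons; apply: cvgD => //; exact: fl.
Qed.

Lemma cvg_bigprod (I : Type) (r : seq I) (f : I -> nat -> R) (l : I -> R) :
  (forall i, f i @ \oo --> l i) -> (fun k => \prod_(i <- r) f i k) @ \oo --> \prod_(i <- r) l i.
Proof.
move=> fl; elim: r => [|i r IH].
  by under eq_fun do rewrite big_nil; rewrite big_nil; exact: cvg_cst.
by under eq_fun do rewrite big_cons; rewrite big_cons; apply: cvgM => //; exact: fl.
Qed.

Lemma cvg_det n (M : nat -> 'M[R]_(n, n)) (M' : 'M[R]_(n, n)) :
  (forall i j, (fun k => M k i j) @ \oo --> M' i j) -> (fun k => \det (M k)) @ \oo --> \det M'.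
Proof.
move=> MM; rewrite /determinant; apply: cvg_bigsum => p.
by apply: cvgM; [exact: cvg_cst|apply: cvg_bigprod => i; exact: MM].
Qed.

(** Dominated convergence for sums whose length also varies; the same majorant makes the limiting
    series summable. *)
Lemma Tannery (a : nat -> nat -> R) (l : nat -> R) (M : nat -> nat) (B : R) :
  (forall k n, `|a k n| <= B * 2^-1 ^+ n) -> (forall n, (fun k => a k n) @ \oo --> l n) ->
  (forall p, \forall k \near \oo, (p <= M k)%N) ->
  (fun k => \sum_(n < M k) a k n) @ \oo --> limn (fun N => \sum_(n < N) l n).
Proof.
move=> aB al My.
have B0 : 0 <= B by have := aB 0%N 0%N; rewrite expr0 mulr1; exact: le_trans.
have lB n : `|l n| <= B * 2^-1 ^+ n.
  apply: (@ler_cvg_to _ (nbhs \oo) _ R (fun k => `|a k n|) (fun _ => B * 2^-1 ^+ n)).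
  - exact: (cvg_norm (al n)).
  - exact: cvg_cst.
  - by apply: nearW => k; exact: aB.
have lS : (fun N => \sum_(n < N) l n) @ \oo --> tsum l.
  apply: (cvg_dist_le (v := fun N => B * 2 * 2^-1 ^+ N)); last exact: cvg_half.
  by apply: nearW => N; rewrite distrC; exact: tsum_nat_tail.
rewrite (cvg_lim (@Rhausdorff R) lS); apply/cvgrPdist_le => e e0.
have [p Hp] : exists p : nat, B * 4 * 2^-1 ^+ p <= e / 2.
  have e2 : 0 < e / 2 by rewrite divr_gt0.
  have /cvgrPdist_le /(_ _ e2) /filter_ex [p] := @cvg_half R (B * 4).
  by rewrite sub0r normrN => /(le_trans (ler_norm _)); exists p.
have sp : (fun k => \sum_(n < p) a k n) @ \oo --> \sum_(n < p) l n.
  by apply: (@cvg_bigsum _ _ (fun (n : 'I_p) k => a k n) (fun n => l n)) => n; exact: al.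
have e2 : 0 < e / 2 by rewrite divr_gt0.
near=> k.
have pM : (p <= M k)%N by near: k; exact: My.
have h1 : `|\sum_(n < p) l n - \sum_(n < p) a k n| <= e / 2.
  by near: k; move/cvgrPdist_le: sp; exact.
have h2 : `|tsum l - \sum_(n < p) l n| <= B * 2 * 2^-1 ^+ p by exact: tsum_nat_tail.
have h3 : `|\sum_(n < M k) a k n - \sum_(n < p) a k n| <= B * 2 * 2^-1 ^+ p.
  rewrite -(subnKC pM) big_split_ord /= addrAC subrr add0r.
  apply: le_trans (ler_norm_sum _ _ _) _.
  apply: (@le_trans _ _ (\sum_(i < M k - p) B * 2^-1 ^+ p * 2^-1 ^+ i)).
    by apply: ler_sum => i _; apply: le_trans (aB _ _) _; rewrite exprD mulrA.
  rewrite -mulr_sumr [leRHS]mulrAC ler_wpM2l ?mulr_ge0 ?exprn_ge0//; exact: half_geo_le.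
have -> : tsum l - \sum_(n < M k) a k n = (tsum l - \sum_(n < p) l n) +
   (\sum_(n < p) l n - \sum_(n < p) a k n) - (\sum_(n < M k) a k n - \sum_(n < p) a k n) by ring.
apply: le_trans (ler_normB _ _) _.
have h4 := ler_normD (tsum l - \sum_(n < p) l n) (\sum_(n < p) l n - \sum_(n < p) a k n).
lra.
Unshelve. all: by end_near. Qed.

(** The square of the left side is (n^n / n!) (D^{2n} / n!). The first factor is at most e^n, and (4
    e D^2)^n / n! is at most e^{4 e D^2}, the square of the constant; 4^-n remains. *)
Lemma sqrt_power_bound (D : R) n : 0 <= D ->
  Num.sqrt n%:R ^+ n * D ^+ n / n`!%:R <= expR (2 * D ^+ 2 * expR 1) * 2^-1 ^+ n.
Proof.
move=> D0; set B := expR _; set X := (X in X <= _).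
have f0 : (0 : R) < n`!%:R by rewrite ltr0n fact_gt0.
have X0 : 0 <= X by rewrite /X divr_ge0 ?mulr_ge0 ?exprn_ge0 ?sqrtr_ge0 ?(ltW f0).
have Y0 : 0 <= B * 2^-1 ^+ n by rewrite mulr_ge0 ?expR_ge0 ?exprn_ge0.
rewrite -(@ler_pXn2r _ 2)// ?nnegrE//.
have sq : (Num.sqrt n%:R ^+ n) ^+ 2 = n%:R ^+ n :> R by rewrite exprAC sqr_sqrtr.
have h1 : (n%:R : R) ^+ n / n`!%:R <= expR 1 ^+ n.
  by rewrite -expRM_natl mulr1; exact: exp_term_le.
have h2 : (4 * D ^+ 2 * expR 1) ^+ n / n`!%:R <= B ^+ 2.
  apply: le_trans (exp_term_le n _) _; first by rewrite !mulr_ge0 ?sqr_ge0 ?expR_ge0.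
  rewrite /B -expRM_natl ler_expR le_eqVlt; apply/orP; left; apply/eqP; ring.
have -> : X ^+ 2 = (n%:R ^+ n / n`!%:R) * ((D ^+ 2) ^+ n / n`!%:R).
  by rewrite /X -sq [(D ^+ 2) ^+ n]exprAC; move: (Num.sqrt _ ^+ n) (D ^+ n) => u v; field; rewrite gt_eqF.
apply: (@le_trans _ _ (expR 1 ^+ n * ((D ^+ 2) ^+ n / n`!%:R))).
  by apply: ler_wpM2r => //; rewrite divr_ge0 ?exprn_ge0 ?sqr_ge0 ?(ltW f0).
have -> : expR 1 ^+ n * ((D ^+ 2) ^+ n / n`!%:R) = ((4 * D ^+ 2 * expR 1) ^+ n / n`!%:R) * 4^-1 ^+ n :> R.
  have -> : 4 * D ^+ 2 * expR 1 = 4 * (expR 1 * D ^+ 2) by ring.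
  rewrite [(4 * _) ^+ n]exprMn [(expR 1 * _) ^+ n]exprMn.
  have e4 : (4 : R) ^+ n * 4^-1 ^+ n = 1 by rewrite -exprMn divff// expr1n.
  transitivity (4 ^+ n * 4^-1 ^+ n * (expR 1 ^+ n * ((D ^+ 2) ^+ n / n`!%:R))); last by ring.
  by rewrite e4 mul1r.
have -> : (B * 2^-1 ^+ n) ^+ 2 = B ^+ 2 * 4^-1 ^+ n.
  by rewrite exprMn exprAC; congr (_ * _ ^+ n); field.
by apply: ler_wpM2r; rewrite ?exprn_ge0.
Qed.

(** One bound per row is enough, matching a kernel that is known to decay only in its row index. *)
Lemma Hadamard_row_bound n (M : 'M[R]_(n, n)) (g : 'I_n -> R) : (forall i, 0 <= g i) ->
  (forall i j, `|M i j| <= g i) -> `|\det M| <= Num.sqrt n%:R ^+ n * \prod_i g i.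
Proof.
move=> g0 Mg.
have p0 : 0 <= \prod_i g i by apply: prodr_ge0.
rewrite -(@ler_pXn2r _ 2)// ?nnegrE// ?mulr_ge0 ?exprn_ge0 ?sqrtr_ge0//.
rewrite real_normK ?num_real//; apply: le_trans (Hadamard M) _.
rewrite exprMn exprAC sqr_sqrtr//.
apply: (@le_trans _ _ (\prod_(i < n) (n%:R * g i ^+ 2))).
  apply: ler_prod => i _; apply/andP; split; first by apply: sumr_ge0 => j _; exact: sqr_ge0.
  apply: (@le_trans _ _ (\sum_(j < n) g i ^+ 2)).
    apply: ler_sum => j _; rewrite -[leLHS]real_normK ?num_real//.
    by apply: lerXn2r; rewrite ?nnegrE.
  by rewrite sumr_const card_ord mulr_natl.
by rewrite big_split /= prodr_const card_ord prodrXl.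
Qed.

Section scaled_sequences.
Variables (c : bool) (s : R) (A : nat -> R) (L N : nat -> nat).
Hypothesis Ay : A @ \oo --> +oo.
Hypothesis A1 : forall k, 1 <= A k.
Hypothesis LA : forall k, (L k)%:R <= 2 * A k ^+ 3 + s * A k < (L k)%:R + 1.
Hypothesis NA : forall k, A k ^+ 2 <= (N k)%:R.

(** Cutting the row index at [N k] makes a minor vanish as soon as one index leaves the section, so
    an integral over the ray is a finite sum. *)
Definition cell_kernel k (a b : nat) : R :=
  (a < N k)%N%:R * (A k * fold_kernel c (A k ^+ 3) (L k + a) (L k + b)).

Definition cell_det k n (t : seq nat) : R :=
  \det (\matrix_(i < n, j < n) cell_kernel k (nth 0%N t i) (nth 0%N t j)).

Definition fredholm_term k n : R :=
  (-1) ^+ n / n`!%:R * iter_int s n (fun l => cell_det k n (map (cell s (A k)) l)).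

Lemma cell_det_eq0 k n t : size t = n -> has (fun i => N k <= i)%N t -> cell_det k n t = 0.
Proof.
move=> st /(has_nthP 0%N) [i it Ni]; rewrite st in it.
rewrite /cell_det (expand_det_row _ (Ordinal it)) big1// => j _.
by rewrite mxE /cell_kernel /= ltnNge Ni !mul0r.
Qed.

(** Von Koch's sum over all maps is an n-fold integral of a step function: the factor A^n of the
    scaled kernel cancels the cell volume A^-n. *)
Lemma tail_det_fredholm k : tail_det c (A k ^+ 3) (L k) (N k) = \sum_(n < (N k).+1) fredholm_term k n.
Proof.
pose K : 'M[R]_(N k, N k) := \matrix_(i, j) (- fold_kernel c (A k ^+ 3) (L k + i) (L k + j)).
have A0 : A k != 0 by rewrite gt_eqF// (lt_le_trans ltr01).
have -> : tail_det c (A k ^+ 3) (L k) (N k) = \det (1%:M + K).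
  by congr determinant; apply/matrixP => i j; rewrite !mxE /fredholm_entry eqn_add2l.
rewrite von_Koch; apply: eq_bigr => n _.
rewrite /fredholm_term (iter_cell_finite s (A1 k) (@cell_det_eq0 k n)) mulrCA [RHS]mulrC.
rewrite !mulr_sumr; rewrite mulr_suml; apply: eq_bigr => f _.
pose F : 'M[R]_(n, n) := \matrix_(i, j) fold_kernel c (A k ^+ 3) (L k + f i) (L k + f j).
have -> : cell_det k n (ffun_seq f) = A k ^+ n * \det F.
  rewrite -detZ; congr determinant; apply/matrixP => i j.
  by rewrite !mxE !nth_ffun_seq /cell_kernel ltn_ord mul1r.
have -> : \det (\matrix_(i, j) K (f i) (f j)) = (-1) ^+ n * \det F.
  by rewrite -detZ; congr determinant; apply/matrixP => i j; rewrite !mxE mulN1r.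
have -> : (-1) ^+ n / n`!%:R * (A k ^+ n * \det F) * (A k ^- n) =
   (-1) ^+ n / n`!%:R * \det F * (A k ^+ n * (A k ^- n)) by ring.
rewrite divff ?expf_neq0// mulr1. ring.
Qed.

Lemma cell_kernel_decay : exists2 C : R, 0 <= C & forall k (x : R) (b : nat), s < x ->
  `|cell_kernel k (cell s (A k) x) b| <= C * expR (- (1 * x)).
Proof.
have [C C0 HC] := kernel_bound c s.
exists (C * expR (1 + 1 * s)) => [|k x b sx]; first by rewrite mulr_ge0 ?expR_ge0.
have b1 (d : bool) (u : R) : `|d%:R * u| <= `|u| by rewrite normrM; case: d; rewrite ?normr1 ?normr0 ?mul1r ?mul0r.
apply: le_trans (b1 _ _) _; have /andP[_ LA2] := LA k.
apply: le_trans (HC _ _ _ _ (A1 k) LA2) _; rewrite -mulrA; apply: ler_wpM2l => //.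
by have := cell_decay ltr01 (A1 k) (ltW sx); rewrite [1 * (_ / _)]mul1r.
Qed.

Lemma cell_det_bound (C : R) : 0 <= C ->
  (forall k (x : R) (b : nat), s < x -> `|cell_kernel k (cell s (A k) x) b| <= C * expR (- (1 * x))) ->
  forall k n l, size l = n -> above s l ->
  `|cell_det k n (map (cell s (A k)) l)| <= Num.sqrt n%:R ^+ n * \prod_(x <- l) (C * expR (- (1 * x))).
Proof.
move=> C0 HC k n l sl al.
rewrite (big_nth 0) sl big_mkord; apply: Hadamard_row_bound => [i|i j].
  by rewrite mulr_ge0 ?expR_ge0.
rewrite mxE [X in cell_kernel _ X](nth_map 0) ?sl//; apply: HC.
by apply: (allP al); rewrite mem_nth// sl.
Qed.

(** Hadamard's n^{n/2} loses against n!, which gives a majorant uniform in [k], as [Tannery]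
    requires. *)
Lemma fredholm_term_bound : exists B : R, forall k n, `|fredholm_term k n| <= B * 2^-1 ^+ n.
Proof.
have [C C0 HC] := cell_kernel_decay.
have [ig eg] := expR_open_ray s C (ltr01 : (0 : R) < 1).
pose D := \int[mu]_(x in `]s, +oo[) (C * expR (- (1 * x))).
have D0 : 0 <= D by rewrite /D eg !mulr_ge0 ?expR_ge0 ?invr_ge0.
exists (expR (2 * D ^+ 2 * expR 1)) => k n; apply: le_trans (sqrt_power_bound n D0).
have f0 : (0 : R) < n`!%:R by rewrite ltr0n fact_gt0.
rewrite /fredholm_term normrM [leLHS]mulrC normrM normrX normrN1 expr1n mul1r normfV (gtr0_norm f0).
apply: ler_wpM2r; first by rewrite invr_ge0 ltW.
by apply: (iter_cell_bound ig) => l sl al; exact: cell_det_bound.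
Qed.

(** The cell of a fixed [x] has index at most (x - s) A, which is below A^2 <= N once A exceeds x -
    s; from then on the cut is not felt. *)
Lemma cell_kernel_cvg (x y : R) : s < x -> s < y ->
  (fun k => cell_kernel k (cell s (A k) x) (cell s (A k) y)) @ \oo --> Akernel (if c then 1 else -1) x y.
Proof.
move=> sx sy; rewrite -[X in _ --> X]mul1r; apply: cvgM; last exact: kernel_cvg.
apply: (cvg_dist_le (v := fun _ => 0)); last exact: cvg_cst.
near=> k; have A0 : 0 < A k by apply: lt_le_trans (A1 k).
have xA : x - s + 1 <= A k by near: k; move/cvgryPge: Ay; exact.
rewrite (_ : (_ < _)%N = true) ?subrr ?normr0//.
rewrite -(ltr_nat R); apply: lt_le_trans (NA k).
have /andP[h1 _] := cell_itv A0 (ltW sx).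
have h2 : (cell s (A k) x)%:R <= (x - s) * A k by rewrite -ler_pdivrMr// lerBrDl.
by apply: le_lt_trans h2 _; rewrite expr2 ltr_pM2r//; lra.
Unshelve. all: by end_near. Qed.

Lemma fredholm_term_cvg n : (fun k => fredholm_term k n) @ \oo -->
  (-1) ^+ n / n`!%:R * iter_int s n (fun l => \det (\matrix_(i < n, j < n)
     Akernel (if c then 1 else -1) (nth 0 l i) (nth 0 l j))).
Proof.
have [C C0 HC] := cell_kernel_decay.
have [ig _] := expR_open_ray s C (ltr01 : (0 : R) < 1).
apply: cvgM; first exact: cvg_cst.
apply: (iter_cell_cvg (G := fun k t => cell_det k n t) (c := Num.sqrt n%:R ^+ n) ig).
  by move=> k l sl al; exact: cell_det_bound.
move=> l sl al; apply: cvg_det => i j; rewrite mxE.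
under eq_fun do rewrite mxE !(nth_map 0) ?sl//.
by apply: cell_kernel_cvg; apply: (allP al); rewrite mem_nth// sl.
Qed.

Lemma tail_det_cvg_fredholm : (fun k => tail_det c (A k ^+ 3) (L k) (N k)) @ \oo -->
  fredholm_det (Akernel (if c then 1 else -1)) s.
Proof.
have [B HB] := fredholm_term_bound.
under eq_fun do rewrite tail_det_fredholm.
apply: (Tannery (M := fun k => (N k).+1) HB fredholm_term_cvg) => p.
near=> k; apply: leqW; rewrite -(ler_nat R); apply: le_trans (NA k).
have pA : p%:R <= A k by near: k; move/cvgryPge: Ay; exact.
by apply: le_trans pA _; rewrite expr2 ler_peMl// (le_trans _ (A1 k)).
Unshelve. all: by end_near. Qed.

End scaled_sequences.

(** Two limits are merged along an arbitrary sequence tending to infinity: the size [N k] is chosen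
    so that the finite determinant is within 1 / (k + 1) of the probability and the section still
    covers the ray in scaled coordinates. *)
Lemma prob_cvg_fredholm (c : bool) (s : R) :
  (fun theta : R => prob c theta (edge_event theta s)) @ +oo -->
  fredholm_det (Akernel (if c then 1 else -1)) s.
Proof.
apply/cvg_pinftyP => u uy.
(* A >= 1 + |s| yields A >= 1 and 2 A^2 + s >= 0. Truncating the sequence from below by a^3 changes
   finitely many terms and makes this hold for every [k]. *)
pose a := 1 + `|s|; have a1 : 1 <= a by rewrite lerDl.
pose v k := Num.max (u k) (a ^+ 3).
have v_near : \forall k \near \oo, u k = v k.
  by move/cvgryPge: uy => /(_ (a ^+ 3)); apply: filterS => k h; rewrite /v max_l.
have v0 k : 0 < v k by rewrite lt_max exprn_gt0 ?orbT// (lt_le_trans ltr01).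
pose A k := v k `^ 3^-1.
have A0 k : 0 < A k by exact: powR_gt0.
have A3 k : A k ^+ 3 = v k.
  by rewrite /A -powR_mulrn ?powR_ge0// -powRrM mulVf// powRr1// ltW.
have Aa k (b : R) : 0 <= b -> b ^+ 3 <= v k -> b <= A k.
  by move=> b0; rewrite -A3 ler_pXn2r// nnegrE// ltW.
have a0 : 0 <= a by exact: le_trans a1.
have aA k : a <= A k by apply: Aa => //; rewrite /v le_max lexx orbT.
have A1 k : 1 <= A k by exact: le_trans (aA k).
have Ay : A @ \oo --> +oo.
  apply/cvgryPge => b; pose b' := Num.max b 0.
  move/cvgryPge: uy => /(_ (b' ^+ 3)); apply: filterS => k h.
  apply: (@le_trans _ _ b'); first by rewrite le_max lexx.
  by apply: Aa; rewrite /v le_max ?lexx ?orbT// h.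
pose L k := Num.truncn (2 * A k ^+ 3 + s * A k).
have X0 k : 0 <= 2 * A k ^+ 3 + s * A k.
  have h := aA k; have h2 : - s <= `|s| by rewrite -normrN ler_norm.
  have -> : 2 * A k ^+ 3 + s * A k = A k * (2 * A k ^+ 2 + s) by ring.
  rewrite mulr_ge0 ?(ltW (A0 k))//; have := A1 k; rewrite /a in h; nra.
have LA k : (L k)%:R <= 2 * A k ^+ 3 + s * A k < (L k)%:R + 1.
  by rewrite natr1; exact: truncn_itv.
(* lambda_1 is a natural number, so the event depends only on the integer part of 2 theta + s
   theta^{1/3}; nonnegativity makes [Num.truncn] that integer part. *)
have EL k lam : edge_event (v k) s lam = (part1 lam <= L k)%N.
  rewrite /L truncn_ge_nat// /edge_event -/(A k) ler_pdivrMr// lerBlDl A3.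
  by [].
have choose k : exists n : nat, A k ^+ 2 <= n%:R /\
    `|tail_det c (v k) (L k) n - prob c (v k) (edge_event (v k) s)| <= k.+1%:R^-1.
  have cv := @tail_det_cvg R c (v k) _ _ (EL k).
  have /cvgrPdist_le /(_ k.+1%:R^-1) := cv; rewrite invr_gt0 ltr0n => /(_ isT) [n0 _ Hn].
  exists (n0 + (Num.truncn (A k ^+ 2)).+1)%N; split.
    by apply: (le_trans (ltW (truncnS_gt _))); rewrite ler_nat leq_addl.
  by rewrite distrC; apply: Hn; exact: leq_addr.
have [N HN] := @choice _ _ _ choose.
have t_cvg := tail_det_cvg_fredholm (c := c) Ay A1 LA (fun k => (HN k).1).
suff pv : (fun k => prob c (v k) (edge_event (v k) s)) @ \oo --> fredholm_det (Akernel (if c then 1 else -1)) s.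
  apply: cvg_trans pv; apply: near_eq_cvg.
  by apply: filterS v_near => k ->.
have d_cvg : (fun k => prob c (v k) (edge_event (v k) s) - tail_det c (A k ^+ 3) (L k) (N k)) @ \oo --> (0 : R).
  apply: (cvg_dist_le (v := fun k => k.+1%:R^-1)); last exact: (@cvg_harmonic R).
  by apply: nearW => k; rewrite subr0 distrC A3; exact: (HN k).2.
have sum_cvg := cvgD d_cvg t_cvg; rewrite add0r in sum_cvg.
have -> : (fun k => prob c (v k) (edge_event (v k) s)) =
    (fun k => prob c (v k) (edge_event (v k) s) - tail_det c (A k ^+ 3) (L k) (N k)) \+
    (fun k => tail_det c (A k ^+ 3) (L k) (N k)).
  by apply/funext => k /=; rewrite subrK.
exact: sum_cvg.
Qed.

End fredholm_limit.

Theorem theorem5 (R : realType) (s : R) :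
  (fun theta : R => P_sp theta (edge_event theta s)) @ +oo
    --> fredholm_det (Akernel 1) s /\
  (fun theta : R => P_o theta (edge_event theta s)) @ +oo
    --> fredholm_det (Akernel (-1)) s.
Proof. by split; [exact: (@prob_cvg_fredholm R true s)|exact: (@prob_cvg_fredholm R false s)]. Qed.
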